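(* Let $f:S^1\to S^2$ be a CaTherine wheel. Let $S^2_f=S^1\cup P^+\cup P^-$ and let $\mathcal{C}$ be the collection of subsets of $S^2_f$ consisting of: $\{p\}$ for each $p\in S^1$ lying in no nontrivial class of $\mathcal{L}^+(f)\cup\mathcal{L}^-(f)$; $\nu\cup H^+(\nu)$ for each nontrivial class $\nu$ of $\mathcal{L}^+(f)$; and $\nu\cup H^-(\nu)$ for each nontrivial class $\nu$ of $\mathcal{L}^-(f)$. Then $\mathcal{C}$ is an upper semi-continuous decomposition of $S^2_f$. Furthermore the quotient space of $S^2_f$ by $\mathcal{C}$ is homeomorphic to $S^2$, and there is a unique choice of this homeomorphism such that the restriction to $S^1$ of the quotient map $F:S^2_f\to S^2$ equals $f$.
   Context: $S^1,S^2$ are the oriented circle and 2-sphere. A closed interval $I\subset S^1$ is a closed subset homeomorphic to $[0,1]$ oriented from $S^1$ with endpoints $I^-,I^+$; $[p,q]$ is the oriented interval from $p$ to $q$. A CaTherine wheel is a continuous surjection $f:S^1\to S^2$ such that for each closed interval $I$, $f(I)$ is a closed disk and $f(\partial I)\subset\partial f(I)$. For such $f$ and $I$, each component $Y$ of $\partial f(I)\setminus f(\partial I)$ has a unique orientation (canonical orientation) making $f:I\cap f^{-1}(Y)\to Y$ monotone increasing; $Z^+(I)$ is the component (or $\emptyset$) whose canonical orientation agrees with its boundary orientation from the disk $f(I)\subset S^2$, $Z^-(I)$ the one (or $\emptyset$) where they disagree. $I$ is degenerate if $f(\partial I)$ is a point; then it is positively degenerate if $Z^+(I)=\emptyset$,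 negatively degenerate otherwise. $\mathcal{L}^\pm(f)$ is the set of unordered pairs $\{p,q\}$ with $[p,q]$ positively/negatively degenerate; each (with the diagonal) is an equivalence relation on $S^1$ whose classes are the nontrivial classes referred to. $P^+$ and $P^-$ are two copies of the hyperbolic plane (Poincaré disk), each with ideal boundary identified with $S^1$, so $S^2_f=S^1\cup P^+\cup P^-$ is topologized as a 2-sphere with $S^1$ as equator. $H^\pm(\nu)$ is the hyperbolic convex hull of $\nu$ in $P^\pm$. An upper semi-continuous decomposition of a compact Hausdorff space $X$ is a collection of pairwise disjoint closed subsets covering $X$ such that for each element $K$ and each open $V\supset K$ there is an open $U$ with $K\subset U\subset V$ that is a union of elements. *)

(* Defs.v *)
From HB Require Import structures.
From mathcomp Require Import all_boot all_order all_algebra.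
From mathcomp Require Import all_classical all_reals all_analysis.
Set Implicit Arguments. Unset Strict Implicit. Unset Printing Implicit Defensive.
Import Order.TTheory GRing.Theory Num.Theory.
Import numFieldNormedType.Exports.
Local Open Scope classical_set_scope.
Local Open Scope ring_scope.

Section CT.
Variable R : realType.
Notation P2 := (R * R)%type.
Notation P3 := (R * R * R)%type.

Definition add3 (a b : P3) : P3 := ((a.1.1 + b.1.1, a.1.2 + b.1.2), a.2 + b.2).
Definition sub3 (a b : P3) : P3 := ((a.1.1 - b.1.1, a.1.2 - b.1.2), a.2 - b.2).
Definition scale3 (c : R) (a : P3) : P3 := ((c * a.1.1, c * a.1.2), c * a.2).
Definition dot3 (a b : P3) : R := a.1.1 * b.1.1 + a.1.2 * b.1.2 + a.2 * b.2.
Definition norm3 (a : P3) : R := Num.sqrt (dot3 a a).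
Definition cross3 (a b : P3) : P3 :=
  ((a.1.2 * b.2 - a.2 * b.1.2, a.2 * b.1.1 - a.1.1 * b.2),
   a.1.1 * b.1.2 - a.1.2 * b.1.1).
Definition sq2 (p : P2) : R := p.1 ^+ 2 + p.2 ^+ 2.

(** The circle S^1 (unit circle in R^2, counterclockwise orientation) and
    the 2-sphere S^2 (unit sphere in R^3, outward-normal orientation). *)
Definition S1 : set P2 := [set p | sq2 p = 1].
Definition S2 : set P3 := [set x | dot3 x x = 1].
Definition cdisk : set P2 := [set p | sq2 p <= 1].

Definition rot (th : R) (p : P2) : P2 :=
  (p.1 * cos th - p.2 * sin th, p.1 * sin th + p.2 * cos th).
Definition ccw (p r : P2) (th : R) := 0 <= th < 2 * pi /\ r = rot th p.
Definition arc (p q : P2) : set P2 :=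
  [set r | S1 r /\ exists thr thq, [/\ ccw p r thr, ccw p q thq & thr <= thq]].
Definition arcle (p s t : P2) :=
  exists ths tht, [/\ ccw p s ths, ccw p t tht & ths <= tht].

Definition homeomorphic {T U : topologicalType} (A : set T) (B : set U) :=
  exists (g : T -> U) (h : U -> T),
    [/\ {within A, continuous g}, {within B, continuous h},
        (forall x, A x -> B (g x) /\ h (g x) = x) &
        (forall y, B y -> A (h y) /\ g (h y) = y)].

Definition is_closed_disk (D : set P3) := D `<=` S2 /\ homeomorphic cdisk D.

(** boundary (frontier) of a closed set D relative to S^2 *)
Definition sbd (D : set P3) : set P3 :=
  [set x | D x /\ forall U, nbhs x U -> exists y, [/\ U y, S2 y & ~ D y]].
Definition sint (D : set P3) : set P3 :=
  [set x | D x /\ exists U, nbhs x U /\ forall y, U y -> S2 y -> D y].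

Definition stereo (N x : P3) : P3 :=
  scale3 ((1 - dot3 x N)^-1) (sub3 x (scale3 (dot3 x N) N)).

Definition I01 : set R := [set t | 0 <= t <= 1].

(** the loop gam (on [0,1]) winds once positively around z, as seen in the
    stereographic projection from N, the plane N^perp being oriented by the
    normal -N (this matches the outward orientation of S^2). *)
Definition winds_once_pos (N z : P3) (gam : R -> P3) :=
  let v t := sub3 (stereo N (gam t)) (stereo N z) in
  let u0 := scale3 ((norm3 (v 0))^-1) (v 0) in
  let c0 := cross3 (scale3 (-1) N) u0 in
  exists th : R -> R,
    [/\ {within I01, continuous th},
        (forall t, I01 t ->
           v t = scale3 (norm3 (v t))
                   (add3 (scale3 (cos (th t - th 0)) u0)
                         (scale3 (sin (th t - th 0)) c0))) &
        th 1 - th 0 = 2 * pi].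

Definition posloop (D : set P3) (gam : R -> P3) :=
  [/\ {within I01, continuous gam}, gam 0 = gam 1,
      (forall s t, 0 <= s < 1 -> 0 <= t < 1 -> gam s = gam t -> s = t),
      gam @` I01 = sbd D &
      exists N z, [/\ S2 N, ~ D N, sint D z & winds_once_pos N z gam]].

Definition is_component {T : topologicalType} (B Y : set T) :=
  exists y, B y /\ Y = connected_component B y.

Definition catherine (f : P2 -> P3) :=
  [/\ {within S1, continuous f}, f @` S1 = S2 &
      forall p q, S1 p -> S1 q -> p <> q ->
        [/\ is_closed_disk (f @` arc p q), sbd (f @` arc p q) (f p) &
            sbd (f @` arc p q) (f q)]].

(** Z^+([p,q]) is nonempty: some component Y of the boundary of f([p,q])
    minus f({p,q}) whose canonical orientation (the one making f monotone
    increasing) agrees with the boundary orientation of the disk. *)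
Definition Zplus_nonempty (f : P2 -> P3) (p q : P2) :=
  let D := f @` arc p q in
  exists Y, is_component (sbd D `\` [set f p; f q]) Y /\
  exists gam, [/\ posloop D gam, gam 0 = f p &
    forall s t u v, arc p q s -> arc p q t -> Y (f s) -> Y (f t) ->
      arcle p s t -> 0 < u < 1 -> 0 < v < 1 ->
      gam u = f s -> gam v = f t -> u <= v].

Definition degenerate (f : P2 -> P3) (p q : P2) :=
  [/\ S1 p, S1 q, p <> q & f p = f q].
Definition pos_degenerate f p q := degenerate f p q /\ ~ Zplus_nonempty f p q.
Definition neg_degenerate f p q := degenerate f p q /\ Zplus_nonempty f p q.

Definition Lplus f (p q : P2) := pos_degenerate f p q \/ pos_degenerate f q p.
Definition Lminus f (p q : P2) := neg_degenerate f p q \/ neg_degenerate f q p.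

Definition eqclass (L : P2 -> P2 -> Prop) (p : P2) : set P2 :=
  [set q | S1 q /\ (q = p \/ L p q)].
Definition nt_class (L : P2 -> P2 -> Prop) (nu : set P2) :=
  exists p, [/\ S1 p, exists q, L p q & nu = eqclass L p].

(** Euclidean convex hull in R^2 (Klein model hull) *)
Definition conv (nu : set P2) : set P2 :=
  [set x | exists n (w : 'I_n -> R) (pt : 'I_n -> P2),
     [/\ forall i, 0 <= w i, \sum_i w i = 1, forall i, nu (pt i) &
         x = (\sum_i w i * (pt i).1, \sum_i w i * (pt i).2)]].

(** Klein -> Poincare disk isometry (identity on the ideal boundary) *)
Definition KtoP (k : P2) : P2 :=
  let c := (1 + Num.sqrt (1 - sq2 k))^-1 in (c * k.1, c * k.2).

(** S^2_f := unit sphere of R^3; S^1 = equator, P^+ = open upper hemisphere,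
    P^- = open lower hemisphere, the Poincare disk being identified with the
    hemisphere by vertical projection. *)
Definition equator (p : P2) : P3 := (p, 0).
Definition lift (s : R) (x : P2) : P3 := (x, s * Num.sqrt (1 - sq2 x)).

(** hyperbolic convex hull H^s(nu) in P^s (s = 1 for +, s = -1 for -) *)
Definition hull (s : R) (nu : set P2) : set P3 :=
  [set lift s (KtoP x) | x in [set x | conv nu x /\ sq2 x < 1]].

Definition elem (s : R) (nu : set P2) : set P3 :=
  (equator @` nu) `|` hull s nu.

Definition Ccoll (f : P2 -> P3) (K : set P3) :=
  (exists p, [/\ S1 p,
      ~ (exists nu, nt_class (Lplus f) nu /\ nu p),
      ~ (exists nu, nt_class (Lminus f) nu /\ nu p) &
      K = [set equator p]])
  \/ (exists nu, nt_class (Lplus f) nu /\ K = elem 1 nu)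
  \/ (exists nu, nt_class (Lminus f) nu /\ K = elem (-1) nu).

Definition ropen (X V : set P3) := exists W, open W /\ V = W `&` X.

Definition usc_decomposition (X : set P3) (C : set (set P3)) :=
  [/\ (forall K, C K -> K `<=` X /\ closed K),
      (forall K K', C K -> C K' -> K <> K' -> K `&` K' = set0),
      (forall x, X x -> exists K, C K /\ K x) &
      (forall K V, C K -> ropen X V -> K `<=` V ->
         exists U, [/\ ropen X U, K `<=` U, U `<=` V &
           forall K', C K' -> K' `&` U !=set0 -> K' `<=` U])].

(** F : X -> S^2 realises (up to homeomorphism) the quotient map X -> X/C *)
Definition quotient_onto_S2 (X : set P3) (C : set (set P3)) (F : P3 -> P3) :=
  [/\ {within X, continuous F}, F @` X = S2,
      (forall x y, X x -> X y -> (F x = F y <-> exists K, [/\ C K, K x & K y])) &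
      (forall V, V `<=` S2 -> (ropen S2 V <-> ropen X (X `&` F @^-1` V)))].

End CT.

(* Main.v *)
(** Write [phi] for the periodic lift of [f] to the line and [D a b] for the
    disk [phi ([a, b])]. Since [phi a] and [phi b] lie on its boundary, the
    interior of [D a b] is the complement of the complementary disk
    [D b (a + T)], and the common boundary is a Jordan curve. The planar
    facts needed about such curves follow from winding numbers: invariance of
    domain, crossing of paths with linked endpoints in a disk, and degree
    [+1] or [-1] of the boundary loop of a disk.

    If [a < b < c < d < a + T] and [phi a = phi c <> phi b = phi d], the
    boundary loop of [D a c] in its canonical orientation runs from [phi a] to
    [phi b] inside [D a b] and back inside [D c d], that of [D b d] runs from
    [phi b] to [phi a] inside [D a b] and back inside [D c d]. Seen from
    interior points of [D b c] and [D d (a + T)] their winding numbers are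
    opposite, so the pairs [{a, c}] and [{b, d}] have opposite signs. It follows
    that a fibre of [f] has only one sign, that fibres of the same sign are
    unlinked, and that two points of the circle which are not a pair of a given
    sign are separated by a pair of that sign. Hence the convex hulls of the
    classes of one sign are disjoint and cover the disk.

    Sending each element of the decomposition to the common value of [f] on its
    points of the circle thus defines [F]. Its graph is compact, because every
    point of a hull lies in an ideal triangle of the class and the pairs of
    one sign form a closed set; so [F] is a closed continuous map, which gives
    upper semicontinuity and the quotient topology. *)
From HB Require Import structures.
From mathcomp Require Import all_boot all_order all_algebra.
From mathcomp Require Import all_classical all_reals all_analysis.
From mathcomp Require Import ring lra zify.
Require Import Defs.
Set Implicit Arguments. Unset Strict Implicit. Unset Printing Implicit Defensive.
Import Order.TTheory GRing.Theory Num.Theory.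
Import numFieldNormedType.Exports.
Local Open Scope classical_set_scope.
Local Open Scope ring_scope.

(** The obstacle is the definition of the signs, which speaks of boundary loops that are monotone on
    a whole component. A pair linked with [{a, c}] turns it into a finite test: a simple boundary
    loop of [D a c] based at [phi a] is monotone when it passes through [D a b] before [D b c], and
    the sign of the pair is then read off from the winding number of this loop about any one
    interior point. A linked pair always exists, because the common boundary of the two disks has
    points other than [phi a], and each of them is hit from both sides. A fibre has one sign because
    each of the three pairs among three of its points is crossed by a pair of another fibre, which
    must cross a second one of them as well; two pairs crossed by the same pair have the same sign,
    and at least two of the three equalities hold, which imply the third. *)

Section ContinuousAt.
Variable R : realType.
Notation P2 := (R * R)%type.
Notation P3 := (R * R * R)%type.

Variables (T : topologicalType) (x : T).
Lemma continuous_at_cst (U : topologicalType) (c : U) : continuous_at x (fun _ : T => c).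
Proof. exact: cvg_cst. Qed.
Lemma continuous_at_add (F G : T -> R) : continuous_at x F -> continuous_at x G ->
  continuous_at x (fun y => F y + G y).
Proof. move=> cF cG; exact: cvgD. Qed.
Lemma continuous_at_opp (F : T -> R) : continuous_at x F -> continuous_at x (fun y => - F y).
Proof. move=> cF; exact: cvgN. Qed.
Lemma continuous_at_mul (F G : T -> R) : continuous_at x F -> continuous_at x G ->
  continuous_at x (fun y => F y * G y).
Proof. move=> cF cG; exact: cvgM. Qed.
Lemma continuous_at_inv (F : T -> R) : F x != 0 -> continuous_at x F -> continuous_at x (fun y => (F y)^-1).
Proof. move=> F0 cF; exact: cvgV. Qed.
Lemma continuous_at_exp (F : T -> R) n : continuous_at x F -> continuous_at x (fun y => F y ^+ n).
Proof.
move=> cF; elim: n => [|n IH]; rewrite /continuous_at.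
  by under eq_fun do rewrite expr0; rewrite expr0; exact: continuous_at_cst.
by under eq_fun do rewrite exprS; rewrite exprS; exact: continuous_at_mul.
Qed.
Lemma continuous_at_comp (U V : topologicalType) (g : U -> V) (F : T -> U) :
  continuous_at (F x) g -> continuous_at x F -> continuous_at x (fun y => g (F y)).
Proof. by move=> cg cF; exact: (cvg_comp _ _ cF cg). Qed.
Lemma continuous_at_compT (U V : topologicalType) (g : U -> V) (F : T -> U) :
  continuous g -> continuous_at x F -> continuous_at x (fun y => g (F y)).
Proof. by move=> cg cF; exact: (cvg_comp _ _ cF (cg _)). Qed.
Lemma continuous_at_fst (U V : topologicalType) (F : T -> U * V) : continuous_at x F ->
  continuous_at x (fun y => (F y).1).
Proof. by move=> cF; apply: (cvg_comp _ _ cF); exact: cvg_fst. Qed.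
Lemma continuous_at_snd (U V : topologicalType) (F : T -> U * V) : continuous_at x F ->
  continuous_at x (fun y => (F y).2).
Proof. by move=> cF; apply: (cvg_comp _ _ cF); exact: cvg_snd. Qed.
Lemma continuous_at_pair (U V : topologicalType) (F : T -> U) (G : T -> V) :
  continuous_at x F -> continuous_at x G -> continuous_at x (fun y => (F y, G y)).
Proof. by move=> cF cG; exact: cvg_pair. Qed.
Lemma continuous_at_cos (F : T -> R) : continuous_at x F -> continuous_at x (fun y => cos (F y)).
Proof. by apply: continuous_at_comp; exact: continuous_cos. Qed.
Lemma continuous_at_sin (F : T -> R) : continuous_at x F -> continuous_at x (fun y => sin (F y)).
Proof. by apply: continuous_at_comp; exact: continuous_sin. Qed.
Lemma continuous_at_atan (F : T -> R) : continuous_at x F -> continuous_at x (fun y => atan (F y)).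
Proof. by apply: continuous_at_comp; exact: continuous_atan. Qed.
Lemma continuous_at_sqrt (F : T -> R) : continuous_at x F -> continuous_at x (fun y => Num.sqrt (F y)).
Proof. by apply: continuous_at_comp; exact: sqrt_continuous. Qed.
Lemma continuous_at_id : continuous_at x (fun y : T => y).
Proof. exact: cvg_id. Qed.
Lemma continuous_at_max (F G : T -> R) : continuous_at x F -> continuous_at x G ->
  continuous_at x (fun y => Num.max (F y) (G y)).
Proof. by move=> cF cG; exact: (continuous_max cF cG). Qed.
Lemma continuous_at_min (F G : T -> R) : continuous_at x F -> continuous_at x G ->
  continuous_at x (fun y => Num.min (F y) (G y)).
Proof. by move=> cF cG; exact: (continuous_min cF cG). Qed.
Lemma continuous_at_sum (I : Type) (r : seq I) (F : I -> T -> R) :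
  (forall i, continuous_at x (F i)) -> continuous_at x (fun y => \sum_(i <- r) F i y).
Proof.
move=> cF; elim: r => [|i r IH]; rewrite /continuous_at.
  by under eq_fun do rewrite big_nil; rewrite big_nil; exact: continuous_at_cst.
by under eq_fun do rewrite big_cons; rewrite big_cons; exact: continuous_at_add.
Qed.
End ContinuousAt.

(** Second-order patterns such as [@?F y] split a function of [y] by its head symbol. The only goals
    that are not continuity are the denominators of inverses, which must be matched by a hypothesis
    [_ != 0]. *)
Ltac cont1 :=
  match goal with
  | H : continuous_at ?x ?F |- continuous_at ?x ?F => exact: H
  | H : continuous ?F |- continuous_at _ ?F => exact: H
  | H : is_true (?a != 0) |- is_true (?a != 0) => exact: H
  | |- continuous_at _ (fun y => ?c) => exact: continuous_at_cst
  | |- continuous_at _ (fun y => y) => exact: continuous_at_id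
  | |- continuous_at _ (fun y => (@?F y, @?G y)) => apply: (@continuous_at_pair _ _ _ _ F G)
  | |- continuous_at _ (fun y => @?F y + @?G y) => apply: (@continuous_at_add _ _ _ F G)
  | |- continuous_at _ (fun y => - @?F y) => apply: (@continuous_at_opp _ _ _ F)
  | |- continuous_at _ (fun y => @?F y * @?G y) => apply: (@continuous_at_mul _ _ _ F G)
  | |- continuous_at _ (fun y => @?F y ^+ ?n) => apply: (@continuous_at_exp _ _ _ F n)
  | |- continuous_at _ (fun y => (@?F y)^-1) => apply: (@continuous_at_inv _ _ _ F)
  | |- continuous_at _ (fun y => cos (@?F y)) => apply: (@continuous_at_cos _ _ _ F)
  | |- continuous_at _ (fun y => sin (@?F y)) => apply: (@continuous_at_sin _ _ _ F)
  | |- continuous_at _ (fun y => atan (@?F y)) => apply: (@continuous_at_atan _ _ _ F)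
  | |- continuous_at _ (fun y => Num.sqrt (@?F y)) => apply: (@continuous_at_sqrt _ _ _ F)
  | |- continuous_at _ (fun y => Num.max (@?F y) (@?G y)) => apply: (@continuous_at_max _ _ _ F G)
  | |- continuous_at _ (fun y => Num.min (@?F y) (@?G y)) => apply: (@continuous_at_min _ _ _ F G)
  | |- continuous_at _ (fun y => (@?F y).1) => apply: (@continuous_at_fst _ _ _ _ F)
  | |- continuous_at _ (fun y => (@?F y).2) => apply: (@continuous_at_snd _ _ _ _ F)
  | H : continuous ?g |- continuous_at _ (fun y => ?g (@?F y)) =>
      apply: (@continuous_at_compT _ _ _ _ g F H)
  end.
Ltac cont := repeat cont1.

(** * Angles and winding numbers *)

Definition tau (R : realType) : R := 2 * pi.

Section Angles.
Variable R : realType.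
Notation P2 := (R * R)%type.
Notation T := (tau R).

Definition dot2 (v w : P2) : R := v.1 * w.1 + v.2 * w.2.
Definition cross2 (v w : P2) : R := v.1 * w.2 - v.2 * w.1.
Definition expi (t : R) : P2 := (cos t, sin t).
(** A relation instead of an argument function: no branch is chosen, and continuous choices are
    constructed on paths and disks where they are needed. *)
Definition ang (v : P2) (a : R) := exists2 r, 0 < r & v = (r * cos a, r * sin a).

Lemma tau_gt0 : 0 < T. Proof. by rewrite mulr_gt0// pi_gt0. Qed.

Lemma cos2sin2 (t : R) : cos t ^+ 2 + sin t ^+ 2 = 1.
Proof. exact: cos2Dsin2. Qed.

Lemma cosDT (t : R) : cos (t + T) = cos t.
Proof. by rewrite /tau mulrC mulr_natr cosD2pi. Qed.
Lemma sinDT (t : R) : sin (t + T) = sin t.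
Proof. by rewrite /tau mulrC mulr_natr sinD2pi. Qed.

Lemma sq2_ge0 (v : P2) : 0 <= sq2 v.
Proof. by rewrite /sq2 addr_ge0 ?sqr_ge0. Qed.

Lemma sq2_eq0 (v : P2) : sq2 v = 0 -> v = 0.
Proof.
rewrite /sq2 => h; apply/eqP; case: v h => [x y] /= /eqP.
by rewrite paddr_eq0 ?sqr_ge0// !sqrf_eq0 => /andP[/eqP-> /eqP->].
Qed.

Lemma ang_neq0 v a : ang v a -> v <> 0.
Proof.
move=> [r r0 ->] /= [] h1 h2; have := cos2sin2 a.
have -> : cos a = 0 by apply: (mulfI (lt0r_neq0 r0)); rewrite mulr0.
have -> : sin a = 0 by apply: (mulfI (lt0r_neq0 r0)); rewrite mulr0.
by rewrite expr0n /= addr0 => /esym/eqP; rewrite oner_eq0.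
Qed.

Lemma expi_surj (v : P2) : sq2 v = 1 -> exists t, v = expi t.
Proof.
move=> v1; have h : -1 <= v.1 <= 1.
  rewrite -ler_norml -(ler_pXn2r (n := 2))// ?nnegrE// expr1n -normrX ger0_norm ?sqr_ge0//.
  by rewrite -v1 /sq2 lerDl sqr_ge0.
have c := acosK h; have s := sin_acos h.
have e : v.2 ^+ 2 = 1 - v.1 ^+ 2 by rewrite -v1 /sq2; ring.
have [v2|v2] := leP 0 v.2.
  exists (acos v.1); rewrite /expi c s -e sqrtr_sqr ger0_norm//; by case: (v).
exists (- acos v.1); rewrite /expi cosN sinN c s -e sqrtr_sqr ltr0_norm// opprK; by case: (v).
Qed.

Lemma ang_exists v : v <> 0 -> exists a, ang v a.
Proof.
move=> v0; have s0 : 0 < sq2 v.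
  by rewrite lt_neqAle sq2_ge0 andbT; apply/eqP => /esym/sq2_eq0.
have r0 : 0 < Num.sqrt (sq2 v) by rewrite sqrtr_gt0.
have r2 : Num.sqrt (sq2 v) ^+ 2 = sq2 v by rewrite sqr_sqrtr// sq2_ge0.
set r := Num.sqrt _ in r0 r2.
have [|a [e1 e2]] := @expi_surj (v.1 / r, v.2 / r).
  by rewrite /sq2 /= !exprMn -mulrDl -/(sq2 v) -r2 exprVn divff// expf_neq0// lt0r_neq0.
exists a, r => //; rewrite -e1 -e2 ![r * _]mulrC !divfK ?lt0r_neq0//; by case: (v).
Qed.

Lemma cosDTn (a : R) n : cos (a + T * n%:R) = cos a /\ sin (a + T * n%:R) = sin a.
Proof.
elim: n => [|n [<- <-]]; first by rewrite mulr0 addr0.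
have -> : n.+1%:R = n%:R + 1 :> R by rewrite -natr1.
by rewrite -(cosDT (a + T * n%:R)) -(sinDT (a + T * n%:R)) mulrDr mulr1 addrA.
Qed.

Lemma cosDTz (a : R) (k : int) : cos (a + T * k%:~R) = cos a /\ sin (a + T * k%:~R) = sin a.
Proof.
case: k => n; first by rewrite -pmulrn; exact: cosDTn.
rewrite NegzE mulrNz; have [] := cosDTn (a + T * - n.+1%:R) n.+1.
by rewrite -!addrA -mulrDr addNr mulr0 addr0 => -> ->.
Qed.

(** [cos] is injective only on [[0, pi]], so the remainder [s] of [t] modulo [T] is treated either
    as [s] or as [T - s]. *)
Lemma cos_eq1 (t : R) : cos t = 1 -> exists k : int, t = T * k%:~R.
Proof.
move=> ct; set k := Num.floor (t / T); exists k.
have := floor_itv (t / T); rewrite -/k => /andP[].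
rewrite ler_pdivlMr ?tau_gt0// ltr_pdivrMr ?tau_gt0// intrD mulrDl mul1r => h1 h2.
set s := t - k%:~R * T; suff e : s = 0.
  by rewrite -[LHS](subrK (k%:~R * T)) -/s e add0r mulrC.
have cs : cos s = 1.
  by rewrite -(cosDTz s k).1 -[RHS]ct; congr cos; rewrite /s; ring.
have s0 : 0 <= s by rewrite /s subr_ge0.
have sT : s < T by rewrite /s; lra.
have [sp|sp] := leP s pi.
  by apply: (@cos_inj R); rewrite ?in_itv/= ?s0 ?sp ?lexx ?pi_ge0 ?cos0.
suff e : T - s = 0 by move: sT; rewrite -subr_gt0 e ltxx.
apply: (@cos_inj R); rewrite ?in_itv/= ?lexx ?pi_ge0//; last first.
  by rewrite cos0 -cs -[LHS]cosN opprB -[LHS]cosDT subrK.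
by clear ct cs; clearbody s; move: sp sT; rewrite /tau => sp sT; apply/andP; split; lra.
Qed.

Lemma ang_uniq v a b : ang v a -> ang v b -> exists k : int, a - b = T * k%:~R.
Proof.
move=> [r r0 ->] [s s0] [h1 h2]; apply: cos_eq1.
have rs : r = s.
  apply/eqP; rewrite -(eqrXn2 (n := 2))// ?ltW//; apply/eqP.
  rewrite -[LHS]mulr1 -[RHS]mulr1 -{1}(cos2sin2 a) -(cos2sin2 b) !mulrDr -!exprMn.
  by rewrite h1 h2.
rewrite -{}rs in h1 h2.
have /(_ _ _ h1) := mulfI (lt0r_neq0 r0); move/(mulfI (lt0r_neq0 r0)): h2 => h2 {}h1.
by rewrite cosB h1 h2 -!expr2 cos2sin2.
Qed.

Lemma ang_shift v a (k : int) : ang v a -> ang v (a + T * k%:~R).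
Proof.
move=> [r r0 ->]; exists r => //.
by rewrite (cosDTz a k).1 (cosDTz a k).2.
Qed.

(** The one explicit argument in use: in the right half plane it is [atan] of the slope, a
    continuous function of the vector. *)
Lemma cross_atan (x y : R) : 0 < x -> ang (x, y) (atan (y / x)).
Proof.
move=> x0; set t := atan (y / x).
have [/andP[t1 t2] tt] := atan_def (y / x); rewrite -/t in t1 t2 tt.
have c0 : 0 < cos t by apply: cos_gt0_pihalf; rewrite t1 t2.
exists (x / cos t); first by rewrite divr_gt0.
rewrite divfK ?lt0r_neq0//; congr pair.
by rewrite -mulrA [_^-1 * _]mulrC -/(tan t) tt mulrC divfK// lt0r_neq0.
Qed.

(** In complex notation the vector [(dot2 v w, cross2 v w)] is [w] times the conjugate of [v], so
    its argument is that of [w] minus that of [v]. *)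
Lemma ang_rot v w a b : ang v a -> ang (dot2 v w, cross2 v w) b -> ang w (a + b).
Proof.
move=> [r r0 ->] [s s0]; rewrite /dot2 /cross2 /= => -[h1 h2].
exists (s / r); first by rewrite divr_gt0.
have r1 := lt0r_neq0 r0.
have [w1 w2] : r * w.1 = s * cos (a + b) /\ r * w.2 = s * sin (a + b).
  rewrite cosD sinD.
  have -> : s * (cos a * cos b - sin a * sin b) = cos a * (s * cos b) - sin a * (s * sin b) by ring.
  have -> : s * (sin a * cos b + cos a * sin b) = sin a * (s * cos b) + cos a * (s * sin b) by ring.
  rewrite -h1 -h2 -[in X in X /\ _](mulr1 (r * w.1)) -[in X in _ /\ X](mulr1 (r * w.2)) -(cos2sin2 a).
  by split; ring.
rewrite [RHS]surjective_pairing/= ![s / r * _]mulrAC -w1 -w2 ![r * _ / r]mulrAC divff// !mul1r.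
exact: surjective_pairing.
Qed.

Lemma ang_angle v w a b : ang v a -> ang w b -> ang (dot2 v w, cross2 v w) (b - a).
Proof.
move=> [r r0 ->] [s s0 ->]; exists (r * s); first by rewrite mulr_gt0.
by rewrite /dot2 /cross2 /= cosB sinB; congr pair; ring.
Qed.

End Angles.

(** * Continuous choice of an argument on star-shaped compact sets *)

Section Lifting.
Variable R : realType.
Notation P2 := (R * R)%type.
Notation T := (tau R).

Lemma dot2_gt0 (v : P2) : v <> 0 -> 0 < dot2 v v.
Proof.
move=> v0; have e : dot2 v v = sq2 v by rewrite /dot2 /sq2 !expr2.
by rewrite e lt_neqAle sq2_ge0 andbT; apply/eqP => /esym/sq2_eq0.
Qed.

(** [dot2 (h x) (h x)] is positive on the diagonal, hence near it, and compactness of [K] makes the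
    distance uniform. *)
Lemma uniform_dot2 (K : set P2) (h : P2 -> P2) : compact K -> continuous h ->
  (forall x, K x -> h x <> 0) ->
  exists2 d, 0 < d & forall x y, K x -> `|x - y| < d -> 0 < dot2 (h x) (h y).
Proof.
move=> cK ch h0.
pose P (d : R) (x : P2) := forall y, `|x - y| < d -> 0 < dot2 (h x) (h y).
have : \forall d \near (0 : R)^'+, K `<=` P d.
  have /compact_near_coveringP := cK; apply => x Kx.
  have c : continuous_at (x, x) (fun p : P2 * P2 => dot2 (h p.1) (h p.2)).
    by rewrite /dot2; cont.
  have : \forall p \near (x, x), 0 < dot2 (h p.1) (h p.2).
    apply: (c [set r | 0 < r]); apply: open_nbhs_nbhs; split; first exact: open_gt.
    exact/dot2_gt0/h0.
  move=> /nbhs_ballP[e /= e0 he].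
  exists (ball x (e / 2), [set d | 0 < d < e / 2]); rewrite /=.
    split; first by apply: nbhsx_ballx; rewrite divr_gt0.
    near=> d; apply/andP; split; first by near: d; exact: nbhs_right_gt.
    by near: d; apply: nbhs_right_lt; rewrite divr_gt0.
  case=> [x' d] /= [xx' /andP[d0 de]] y xy.
  apply: (he (x', y)); split => /=.
    by apply: le_ball xx'; rewrite ler_pdivrMr// mulr_natr mulr2n lerDl ltW.
  rewrite -ball_normE/= in xx' *; rewrite -(subrK x' x) -addrA.
  rewrite (le_lt_trans (ler_normD _ _))// [ltRHS]splitr ltrD//.
  exact: lt_trans de.
move=> H; have [d [d0 hd]] : exists d, 0 < d /\ K `<=` P d.
  apply: (@filter_ex _ (0 : R)^'+); apply: filterI => //; exact: nbhs_right_gt.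
by exists d => // x y Kx; exact: hd.
Unshelve. all: by end_near. Qed.

(** The argument at [r x] is that at 0 plus [n] increments along the segment from 0, each of them an
    [atan] because consecutive values of [h] make an acute angle. Precomposing with the retraction
    [r] makes the result continuous on the whole plane. *)
Lemma lift_star (K : set P2) (r h : P2 -> P2) : compact K -> continuous r ->
  (forall x, K (r x)) -> (forall x, K x -> r x = x) ->
  (forall (x : P2) (t : R), K x -> 0 <= t <= 1 -> K (t * x.1, t * x.2)) ->
  continuous h -> (forall x, K x -> h x <> 0) ->
  exists2 th : P2 -> R, continuous th & forall x, K x -> ang (h x) (th x).
Proof.
move=> cK cr Kr rK star ch h0.
have [d d0 hd] := uniform_dot2 cK ch h0.
have [M [_ hM]] := compact_bounded cK.
have {}hM x : K x -> `|x| <= `|M| + 1.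
  by apply: hM; rewrite (le_lt_trans (ler_norm M))// ltrDl.
set B := `|M| + 1 in hM; have B0 : 0 < B by rewrite ltr_wpDl.
(* [B] bounds [r x], so the steps along the segment have length at most [B / n < d] and
   [uniform_dot2] applies to them. *)
pose n := (Num.truncn (B / d)).+1.
have n0 : (0 : R) < n%:R by rewrite ltr0n.
have Bn : B / n%:R < d.
  by rewrite ltr_pdivrMr// mulrC -ltr_pdivrMr// truncnS_gt.
pose c (i : nat) (x : P2) : P2 := ((i%:R / n%:R) * (r x).1, (i%:R / n%:R) * (r x).2).
have K0 : K 0.
  have := star _ 0 (Kr 0); rewrite lexx ler01 !mul0r; exact.
have Kc i x : (i <= n)%N -> K (c i x).
  move=> iN; apply: star; first exact: Kr.
  by rewrite divr_ge0//= ler_pdivrMr// mul1r ler_nat.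
have dc i x : (i < n)%N -> 0 < dot2 (h (c i x)) (h (c i.+1 x)).
  move=> iN; apply: hd; first by apply: Kc; exact: ltnW.
  have -> : c i x - c i.+1 x = (- n%:R^-1) *: (r x).
    rewrite /c /=; congr pair => /=; rewrite -mulrBl -natr1.
      by rewrite -mulrBl opprD addrA subrr add0r mulN1r.
    by rewrite -mulrBl opprD addrA subrr add0r mulN1r.
  rewrite normrZ normrN ger0_norm ?invr_ge0// mulrC.
  by rewrite (le_lt_trans _ Bn)// ler_pM2r ?invr_gt0// hM.
have cc i : continuous (c i) by move=> x; rewrite /c; cont.
have [a0 ha0] := ang_exists (h0 _ K0).
pose D i x := atan (cross2 (h (c i x)) (h (c i.+1 x)) / dot2 (h (c i x)) (h (c i.+1 x))).
have cD i : (i < n)%N -> continuous (D i).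
  move=> iN x; rewrite /D; have := dc i x iN; have := cc i; have := cc i.+1.
  move: (c i) (c i.+1) => u v cv cu; rewrite /dot2 /cross2 => /lt0r_neq0 e; by cont.
exists (fun x => a0 + \sum_(i < n) D i x).
  move=> x; apply: continuous_at_add; first exact: continuous_at_cst.
  by apply: continuous_at_sum => i; apply: cD.
move=> x Kx; have -> : h x = h (c n x).
  by rewrite /c divff ?lt0r_neq0// !mul1r rK//; case: (x).
suff H m : (m <= n)%N -> ang (h (c m x)) (a0 + \sum_(i < m) D i x) by exact: H.
elim: m => [_|i IH iN].
  by rewrite big_ord0 addr0 /c !mul0r.
rewrite big_ord_recr /= addrA; apply: ang_rot; first by apply: IH; exact: ltnW.
exact/cross_atan/dc.
Qed.

End Lifting.

(** * Winding numbers and their homotopy invariance *)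

Section Winding.
Variable R : realType.
Notation P2 := (R * R)%type.
Notation T := (tau R).

Lemma closed_le_cont (U : topologicalType) (F : U -> R) c : continuous F ->
  closed [set x | F x <= c].
Proof. by move=> cF; apply: (@preimage_closed _ _ F [set r | r <= c]) => //; exact: closed_le. Qed.

Lemma closed_ge_cont (U : topologicalType) (F : U -> R) c : continuous F ->
  closed [set x | c <= F x].
Proof. by move=> cF; apply: (@preimage_closed _ _ F [set r | c <= r]) => //; exact: closed_ge. Qed.

Lemma closed_eq_cont (U : topologicalType) (F : U -> R) c : continuous F ->
  closed [set x | F x = c].
Proof.
move=> cF; have -> : [set x | F x = c] = [set x | F x <= c] `&` [set x | c <= F x].
  apply/seteqP; split => x /=; first by move=> ->.
  by case=> h1 h2; apply/eqP; rewrite eq_le h1 h2.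
by apply: closedI; [exact: closed_le_cont|exact: closed_ge_cont].
Qed.

Definition usq : set P2 := [set p | 0 <= p.1 <= 1 /\ 0 <= p.2 <= 1].
(** Retraction of the line onto [[0, 1]]: it replaces continuity on the interval by continuity
    everywhere. *)
Definition clamp (t : R) : R := Num.max 0 (Num.min t 1).

Lemma clamp01 t : 0 <= clamp t <= 1.
Proof. by rewrite /clamp le_max lexx ge_max ler01 ge_min lexx orbT. Qed.
Lemma clamp_ge0 t : 0 <= clamp t. Proof. by have /andP[] := clamp01 t. Qed.
Lemma clamp_le1 t : clamp t <= 1. Proof. by have /andP[] := clamp01 t. Qed.
Lemma clampK t : 0 <= t <= 1 -> clamp t = t.
Proof. by move=> /andP[t0 t1]; rewrite /clamp (min_idPl t1) (max_idPr t0). Qed.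
Lemma continuous_clamp : continuous clamp.
Proof. by move=> t; rewrite /clamp; cont. Qed.

Lemma compact_usq : compact usq.
Proof.
have -> : usq = `[0, 1] `*` `[0, 1].
  by apply/seteqP; split => -[x y] /=; rewrite !in_itv.
by apply: compact_setX; exact: segment_compact.
Qed.

Lemma lift_square (h : P2 -> P2) : continuous h -> (forall x, usq x -> h x <> 0) ->
  exists2 th : P2 -> R, continuous th & forall x, usq x -> ang (h x) (th x).
Proof.
apply: (@lift_star _ usq (fun x => (clamp x.1, clamp x.2))).
- exact: compact_usq.
- have cc := continuous_clamp; move=> x; cont.
- by move=> x; split; exact: clamp01.
- by move=> [x y] [/= h1 h2]; rewrite !clampK.
- move=> [x y] t [/= /andP[x0 x1] /andP[y0 y1]] /andP[t0 t1].
  by split; rewrite /= mulr_ge0// mulr_ile1.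
Qed.

Lemma lift_path (h : R -> P2) (u v : R) : u <= v -> continuous h ->
  (forall t, u <= t <= v -> h t <> 0) ->
  exists2 th : R -> R, continuous th & forall t, u <= t <= v -> ang (h t) (th t).
Proof.
move=> uv ch h0.
have [] := @lift_square (fun p => h (u + p.1 * (v - u))).
- by move=> p; cont.
- move=> [x y] [/= /andP[x0 x1] _]; apply: h0.
  rewrite lerDl mulr_ge0 ?subr_ge0//= -lerBrDl ler_piMl// subr_ge0//.
move=> th cth hth.
(* An interval of length 0 cannot be rescaled to [[0, 1]]; a constant angle serves there. *)
have [E|uv'] := eqVneq u v.
  subst v; have [a ha] : exists a, ang (h u) a by apply: ang_exists; apply: h0; rewrite lexx.
  exists (fun=> a); first exact: cst_continuous.
  by move=> t /andP[h1 h2]; have -> : t = u by apply/eqP; rewrite eq_le h1 h2.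
have uv0 : 0 < v - u by rewrite subr_gt0 lt_neqAle uv'.
exists (fun t => th ((t - u) / (v - u), 0)); first by move=> t; cont.
move=> t /andP[t0 t1]; have /= := hth ((t - u) / (v - u), 0).
rewrite divfK ?lt0r_neq0// addrCA subrr addr0; apply; split => /=; last by rewrite lexx ler01.
by rewrite divr_ge0 ?(ltW uv0) ?subr_ge0//= ler_pdivrMr// mul1r lerD2r.
Qed.

Lemma intT_half (k : int) : T * k%:~R != T / 2.
Proof.
apply/eqP => /(mulfI (lt0r_neq0 (tau_gt0 R))) /(congr1 (fun x => x * 2)).
rewrite mulVf ?pnatr_eq0// => h.
have : (k * 2)%:~R = 1%:~R :> R by rewrite intrM.
by move=> /intr_inj; lia.
Qed.

(** Two different values differ by at least [T], so the intermediate value theorem would produce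
    [f u + T / 2], which is not congruent to [c] modulo [T]. *)
Lemma discrete_const (f : R -> R) (c u v : R) : u <= v -> continuous f ->
  (forall t, u <= t <= v -> exists k : int, f t = c + T * k%:~R) -> f u = f v.
Proof.
wlog: f c / f u <= f v => [H uv cf hf|].
  have [|/ltW h] := leP (f u) (f v); first by move=> h; apply: (H f c).
  apply: oppr_inj; apply: (H (fun x => - f x) (- c)) => //.
  - by rewrite lerN2.
  - by move=> x; cont.
  by move=> t /hf[k ->]; exists (- k); rewrite opprD mulrNz mulrN.
rewrite le_eqVlt => /orP[/eqP//|fuv] uv cf hf; exfalso.
have [k hk] := hf u (introT andP (conj (lexx u) uv)).
have [l hl] := hf v (introT andP (conj uv (lexx v))).
have kl : (k + 1 <= l)%R.
  rewrite lezD1 -(ltr_int R) -(ltr_pM2l (tau_gt0 R)); move: fuv; rewrite hk hl; lra.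
have : T * (k + 1)%:~R <= T * l%:~R by rewrite ler_pM2l ?tau_gt0// ler_int.
rewrite intrD mulrDr mulr1 => h.
have T0 := tau_gt0 R.
have [|z /[!in_itv]/= z1 z2] := @IVT _ f u v (f u + T / 2) uv (continuous_subspaceT cf).
  by rewrite (min_idPl (ltW fuv)) (max_idPr (ltW fuv)); apply/andP; split; lra.
have [m hm] := hf z z1.
have /eqP := intT_half (m - k); apply; rewrite intrD mulrDr mulrNz mulrN; lra.
Qed.

Lemma lift_unique (h : R -> P2) (u v : R) (th th' : R -> R) : u <= v ->
  continuous th -> continuous th' ->
  (forall t, u <= t <= v -> ang (h t) (th t)) ->
  (forall t, u <= t <= v -> ang (h t) (th' t)) -> th v - th u = th' v - th' u.
Proof.
move=> uv c c' H H'.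
have : th u - th' u = th v - th' v.
  apply: (@discrete_const (fun t => th t - th' t) 0) => //; first by move=> t; cont.
  by move=> t ht; have [k hk] := ang_uniq (H t ht) (H' t ht); exists k; rewrite add0r.
lra.
Qed.

(** Total change of the argument in radians. Open paths are allowed; only for loops is it a multiple
    of [T]. *)
Definition wind (h : R -> P2) (w : R) := exists th : R -> R,
  [/\ continuous th, forall t, 0 <= t <= 1 -> ang (h t) (th t) & th 1 - th 0 = w].

Lemma wind_uniq h w w' : wind h w -> wind h w' -> w = w'.
Proof. by move=> [th [c H <-]] [th' [c' H' <-]]; exact: (lift_unique ler01 c c' H H'). Qed.

Lemma wind_ext (h h' : R -> P2) w : (forall t, 0 <= t <= 1 -> h t = h' t) -> wind h w -> wind h' w.
Proof. by move=> hh [th [c H e]]; exists th; split => // t ht; rewrite -hh//; exact: H. Qed.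

Lemma wind_exists (h : R -> P2) : continuous h -> (forall t, 0 <= t <= 1 -> h t <> 0) ->
  exists w, wind h w.
Proof.
move=> ch h0; have [th c H] := lift_path ler01 ch h0.
by exists (th 1 - th 0), th.
Qed.

Lemma wind_loop (h : R -> P2) w : h 0 = h 1 -> wind h w -> exists k : int, w = T * k%:~R.
Proof.
move=> h01 [th [c H <-]].
by apply: ang_uniq (H 1 _) _; rewrite ?ler01 ?lexx// -h01; apply: H; rewrite ler01 lexx.
Qed.

(** With an argument on the whole square, the winding number at level [l] is the difference of its
    values on two sides of the square; it is continuous in [l] and takes only multiples of [T]. *)
Lemma wind_homotopy (H : P2 -> P2) w : continuous H -> (forall x, usq x -> H x <> 0) ->
  (forall l, 0 <= l <= 1 -> H (0, l) = H (1, l)) ->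
  wind (fun t => H (t, 0)) w -> wind (fun t => H (t, 1)) w.
Proof.
move=> cH H0 loop w0.
have [th c Hth] := lift_square cH H0.
have i0 : 0 <= (0 : R) <= 1 by rewrite lexx ler01.
have i1 : 0 <= (1 : R) <= 1 by rewrite lexx ler01.
have wl l : 0 <= l <= 1 -> wind (fun t => H (t, l)) (th (1, l) - th (0, l)).
  move=> hl; exists (fun t => th (t, l)); split => //; first by move=> t; cont.
  by move=> t ht; apply: Hth.
rewrite (wind_uniq w0 (wl 0 i0)).
suff -> : th (1, 0) - th (0, 0) = th (1, 1) - th (0, 1) by exact: wl.
apply: (@discrete_const (fun l => th (1, l) - th (0, l)) 0 0 1) => //.
  by move=> l; cont.
move=> l hl; have [||k hk] := @ang_uniq _ (H (0, l)) (th (1, l)) (th (0, l)).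
- by rewrite loop//; exact: Hth.
- exact: Hth.
by exists k; rewrite add0r.
Qed.

Lemma cdisk_compact : compact (@cdisk R).
Proof.
apply: (@subclosed_compact _ _ (`[-1, 1]%classic `*` `[-1, 1]%classic : set P2)).
- by apply: closed_le_cont => p; rewrite /sq2; cont.
- by apply: compact_setX; exact: segment_compact.
move=> [x y]; rewrite /cdisk /sq2 /= !in_itv /= => h.
have hx := sqr_ge0 x; have hy := sqr_ge0 y.
by split; apply/andP; split; nra.
Qed.

(** Radial projection to the unit disk, playing the part of [clamp] for maps on the disk. *)
Definition retr (x : P2) : P2 :=
  let m := (Num.max 1 (Num.sqrt (sq2 x)))^-1 in (m * x.1, m * x.2).

Lemma sq2Z (c : R) (x : P2) : sq2 (c * x.1, c * x.2) = c ^+ 2 * sq2 x.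
Proof. by rewrite /sq2 /= !exprMn mulrDr. Qed.

Lemma retr_cdisk x : cdisk (retr x).
Proof.
rewrite /cdisk /= /retr sq2Z exprVn.
have s2 := sqr_sqrtr (sq2_ge0 x); have s0 := sqrtr_ge0 (sq2 x).
move: (Num.sqrt _) s2 s0 => s <- s0.
have m0 : 0 < Num.max 1 s by rewrite lt_max ltr01.
rewrite mulrC ler_pdivrMr ?exprn_gt0// mul1r ler_pXn2r ?nnegrE// ?(ltW m0)//.
by rewrite le_max lexx orbT.
Qed.

Lemma retrK x : cdisk x -> retr x = x.
Proof.
rewrite /cdisk /= => h; rewrite /retr.
have -> : Num.max 1 (Num.sqrt (sq2 x)) = 1.
  by apply/max_idPl; rewrite -sqrtr1 ler_wsqrtr.
by rewrite invr1 !mul1r; case: (x).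
Qed.

Lemma continuous_retr : continuous retr.
Proof.
move=> x; rewrite /retr /sq2 /=.
have m0 : Num.max 1 (Num.sqrt (x.1 ^+ 2 + x.2 ^+ 2)) != 0.
  by rewrite lt0r_neq0// lt_max ltr01.
by cont.
Qed.

Lemma lift_disk (h : P2 -> P2) : continuous h -> (forall x, cdisk x -> h x <> 0) ->
  exists2 th : P2 -> R, continuous th & forall x, cdisk x -> ang (h x) (th x).
Proof.
apply: (@lift_star _ (@cdisk R) retr).
- exact: cdisk_compact.
- exact: continuous_retr.
- exact: retr_cdisk.
- exact: retrK.
- move=> x t; rewrite /cdisk /= sq2Z => x1 /andP[t0 t1].
  by rewrite mulr_ile1 ?sq2_ge0 ?sqr_ge0// expr_le1.
Qed.

End Winding.

(** * Injective maps of the disk *)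

Section Plane.
Variable R : realType.
Notation P2 := (R * R)%type.
Notation T := (tau R).

Lemma continuous_comp_within (S U V : topologicalType) (A : set U) (h : U -> V) (F : S -> U) :
  {within A, continuous h} -> continuous F -> (forall y, A (F y)) ->
  continuous (fun y => h (F y)).
Proof.
move=> /subspace_continuousP ch cF AF y.
apply: (@cvg_comp _ _ _ F h (nbhs y) (within A (nbhs (F y))) _ _ (ch _ (AF y))) => B.
move=> hB; have {}hB : nbhs (F y) (fun u => A u -> B u) by exact: hB.
have {}hB : nbhs y (fun z => A (F z) -> B (F z)) := cF y _ hB.
have : nbhs y (fun z => B (F z)) by apply: filterS hB => z; apply; exact: AF.
exact.
Qed.

Definition sub2 (v w : P2) : P2 := (v.1 - w.1, v.2 - w.2).

Lemma sub2_neq0 v w : v <> w -> sub2 v w <> 0.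
Proof.
move=> vw [] /eqP; rewrite subr_eq0 => /eqP e1 /eqP; rewrite subr_eq0 => /eqP e2.
by apply: vw; case: v w e1 e2 => [? ?] [? ?] /= -> ->.
Qed.

Lemma sq2_expi t : sq2 (expi t : P2) = 1. Proof. exact: cos2sin2. Qed.
Lemma expi_neq0 (t : R) : expi t <> 0.
Proof. by move=> h; have := sq2_expi t; rewrite h /sq2 /= expr0n /= addr0 => /eqP; rewrite eq_sym oner_eq0. Qed.
Lemma continuous_expi : continuous (@expi R).
Proof. by move=> t; rewrite /expi; cont. Qed.
Lemma expiDT t : expi (t + T) = expi t :> P2. Proof. by rewrite /expi cosDT sinDT. Qed.
Lemma expiDTz t (k : int) : expi (t + T * k%:~R) = expi t :> P2.
Proof. by rewrite /expi (cosDTz t k).1 (cosDTz t k).2. Qed.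
Lemma expiDpi t : expi (t + pi) = (- cos t, - sin t) :> P2.
Proof. by rewrite /expi cosDpi sinDpi. Qed.

Lemma ang_expi t : ang (expi t : P2) t.
Proof. by exists 1; rewrite // !mul1r. Qed.

Lemma ang_opp (v : P2) a : ang v a -> ang (- v.1, - v.2) (a + pi).
Proof. by move=> [r r0 ->]; exists r => //; rewrite cosDpi sinDpi /= !mulrN. Qed.

Lemma tau_half : T / 2 = pi. Proof. by rewrite /tau mulrC mulKf// pnatr_eq0. Qed.

(** The angle changes by [pi + T * k] over each half, with the same integer [k] because this change
    is continuous in the starting point; the total [T * (2 * k + 1)] is not 0. *)
Lemma antipodal_wind (h : R -> P2) w : continuous h ->
  (forall t, 0 <= t <= 2^-1 -> h (t + 2^-1) = (- (h t).1, - (h t).2)) -> wind h w -> w <> 0.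
Proof.
move=> ch odd [th [c H <-]].
have hh t : 0 <= t <= 2^-1 -> exists k : int, th (t + 2^-1) - th t = pi + T * k%:~R.
  move=> /andP[t0 t1]; have [||k hk] := @ang_uniq _ (h (t + 2^-1)) (th (t + 2^-1)) (th t + pi).
  - by apply: H; apply/andP; split; lra.
  - by rewrite odd ?t0 ?t1//; apply/ang_opp/H; apply/andP; split; lra.
  by exists k; rewrite -hk; ring.
have e : th (0 + 2^-1) - th 0 = th (2^-1 + 2^-1) - th (2^-1).
  by apply: (@discrete_const _ (fun t => th (t + 2^-1) - th t) pi) => // t; cont.
have [|k hk] := hh 0; first by rewrite lexx; lra.
have h1 : 2^-1 + 2^-1 = 1 :> R by lra.
move=> w0; have : 2 * (th (0 + 2^-1) - th 0) = 0.
  by move: e; rewrite h1 add0r; lra.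
rewrite hk => /eqP; rewrite mulf_eq0 pnatr_eq0 /= -tau_half addrC addr_eq0 => /eqP hT.
have /eqP := intT_half R (- k); apply; rewrite mulrNz mulrN hT; ring.
Qed.

(* [G x - G 0] deforms through [G (x / (1 + l)) - G (- l x / (1 + l))] to an
   odd map, whose degree is odd. *)
Lemma injective_wind_neq0 (G : P2 -> P2) w : continuous G ->
  (forall x y, cdisk x -> cdisk y -> G x = G y -> x = y) ->
  wind (fun t => sub2 (G (expi (T * t))) (G 0)) w -> w <> 0.
Proof.
move=> cG iG w0.
pose a (l : R) := (1 + clamp l)^-1.
have ca : continuous a.
  move=> l.
  have cc := @continuous_clamp R; rewrite /a; cont.
  by rewrite lt0r_neq0// ltr_wpDr// clamp_ge0.
pose X (p : P2) : P2 := (a p.2 * cos (T * p.1), a p.2 * sin (T * p.1)).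
pose Y (p : P2) : P2 := (- (clamp p.2 * (a p.2 * cos (T * p.1))), - (clamp p.2 * (a p.2 * sin (T * p.1)))).
pose H (p : P2) := sub2 (G (X p)) (G (Y p)).
have cX : continuous X by move=> p; rewrite /X; cont.
have cY : continuous Y.
  by have cc := @continuous_clamp R; move=> p; rewrite /Y; cont.
have cH : continuous H by move=> p; rewrite /H /sub2; cont.
have a0 l : 0 < a l.
  by rewrite invr_gt0 ltr_wpDr// clamp_ge0.
have a1 l : a l <= 1.
  by rewrite invf_le1 ?ltr_wpDr ?lerDl ?clamp_ge0.
have dX p : cdisk (X p).
  rewrite /cdisk /= (sq2Z (a p.2) (expi (T * p.1))) sq2_expi mulr1.
  by rewrite expr_le1// ?ltW.
have dY p : cdisk (Y p).
  have -> : Y p = (- clamp p.2 * (X p).1, - clamp p.2 * (X p).2) by rewrite /Y /= !mulNr.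
  have /andP[c0 c1] := clamp01 p.2.
  rewrite /cdisk /mkset sq2Z sqrrN mulr_ile1 ?sq2_ge0 ?sqr_ge0//; last exact: dX.
  by rewrite expr_le1.
(* [X p - Y p] is [expi (T * p.1)], since [(1 + clamp p.2) * a p.2 = 1]; so the two points of the
   disk are distinct. *)
have H0 p : H p <> 0.
  apply: sub2_neq0 => /iG e; have {e} [e1 e2] := e (dX p) (dY p).
  have /andP[c0 c1] := clamp01 p.2; have := a0 p.2.
  have q : 0 < 1 + clamp p.2 by rewrite ltr_wpDr.
  have : (1 + clamp p.2) * a p.2 = 1 by rewrite mulfV// lt0r_neq0.
  move=> h _; apply: (@expi_neq0 (T * p.1)); rewrite /expi.
  rewrite -[cos _]mul1r -[sin _]mul1r -h !mulrDl !mul1r e1 e2.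
  by congr pair; ring.
have ET t : expi (T * 1 + t) = expi t :> P2 by rewrite mulr1 addrC expiDT.
have loop l : 0 <= l <= 1 -> H (0, l) = H (1, l).
  move=> _; rewrite /H; suff [-> ->] : X (0, l) = X (1, l) /\ Y (0, l) = Y (1, l) by [].
  have [e1 e2] : expi (T * 0) = expi (T * 1) :> P2 by rewrite mulr0 -(ET 0) addr0.
  by rewrite /X /Y /= e1 e2.
have wH : wind (fun t => H (t, 0)) w.
  apply: wind_ext w0 => t _; rewrite /H /X /Y /= /a clampK ?lexx ?ler01// addr0 invr1 !mul0r oppr0.
  by rewrite !mul1r.
move: (wind_homotopy cH (fun p _ => H0 p) loop wH).
apply: antipodal_wind; first by move=> t; cont.
move=> t _; rewrite /H /X /Y /= /a clampK ?lexx ?ler01// !mul1r.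
rewrite [T * (t + _)]mulrDr tau_half cosDpi sinDpi !mulrN !opprK /sub2 /=.
by rewrite !opprB.
Qed.

End Plane.

(** * Invariance of domain and crossing paths *)

Section PlaneTopology.
Variable R : realType.
Notation P2 := (R * R)%type.
Notation T := (tau R).

Lemma compact_S1 : compact (@S1 R).
Proof.
apply: (@subclosed_compact _ _ (@cdisk R)); last by move=> x; rewrite /cdisk /S1 /= => ->.
  by apply: closed_eq_cont => p; rewrite /sq2; cont.
exact: cdisk_compact.
Qed.

Lemma S1_expi t : S1 (expi t : P2). Proof. exact: sq2_expi. Qed.

(** The image of the circle winds about [y], closer to [G 0] than that image, as often as about
    [G 0], which is not 0 times. If [G] omitted [y], the argument of [G x - y] would exist on the
    whole disk and the winding number would be 0. *)
Lemma invariance_of_domain0 (G : P2 -> P2) : continuous G ->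
  (forall x y, cdisk x -> cdisk y -> G x = G y -> x = y) ->
  nbhs (G 0) (G @` @cdisk R).
Proof.
move=> cG iG.
have S1n0 : @S1 R !=set0 by exists (expi 0); exact: S1_expi.
have cn : continuous (fun x => `|G x - G 0|).
  by move=> x; apply: cvg_norm; apply: cvgB; [exact: cG|exact: cvg_cst].
have [x0 /set_mem Sx0 hx0] := compact_EVT_min S1n0 compact_S1 (continuous_subspaceT cn).
set m := `|G x0 - G 0| in hx0.
have S1d (x : P2) : S1 x -> cdisk x by rewrite /S1 /cdisk /= => ->.
have d0 : cdisk (0 : P2) by rewrite /cdisk /sq2 /= expr0n /= addr0 ler01.
have m0 : 0 < m.
  rewrite normr_gt0 subr_eq0; apply/eqP => /iG e; have {}e := e (S1d _ Sx0) d0.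
  by move: Sx0; rewrite e /S1 /sq2 /= expr0n /= addr0 => /esym/eqP; rewrite oner_eq0.
have : nbhs (G 0) (ball (G 0) m) by exact: nbhsx_ballx.
apply: filterS => y; rewrite -ball_normE /= => ym.
have [//|ny] := pselect ((G @` @cdisk R) y); exfalso.
have Gy x : cdisk x -> G x <> y by move=> dx e; apply: ny; exists x.
pose c (p : P2) : P2 := ((G 0).1 + p.2 * (y.1 - (G 0).1), (G 0).2 + p.2 * (y.2 - (G 0).2)).
pose H p := sub2 (G (expi (T * p.1))) (c p).
have ce := @continuous_expi R.
have cH : continuous H by move=> p; rewrite /H /c /sub2; cont.
have H0 p : usq p -> H p <> 0.
  move=> [_ /andP[l0 l1]]; apply: sub2_neq0 => e.
  have := hx0 (expi (T * p.1)) (mem_set (S1_expi _)); rewrite e.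
  have -> : c p - G 0 = p.2 *: (y - G 0).
    by rewrite /c [LHS]surjective_pairing /=; congr pair => /=; rewrite addrAC subrr add0r.
  rewrite normrZ ger0_norm// leNgt => /negP; apply.
  by rewrite (le_lt_trans _ ym)// distrC ler_piMl.
have e01 : expi (T * 0) = expi (T * 1) :> P2 by have := expiDT (0 : R); rewrite add0r mulr0 mulr1 => ->.
have i0 : 0 <= (0 : R) <= 1 by rewrite lexx ler01.
have i1 : 0 <= (1 : R) <= 1 by rewrite lexx ler01.
have loop l : 0 <= l <= 1 -> H (0, l) = H (1, l) by move=> _; rewrite /H /= e01.
have [w hw] : exists w, wind (fun t => H (t, 0)) w.
  by apply: wind_exists => [t|t ht]; [cont|apply: H0].
have w0 : w <> 0.
  apply: (injective_wind_neq0 cG iG); apply: wind_ext hw => t _.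
  by rewrite /H /c /= !mul0r !addr0 -surjective_pairing.
have hw1 := wind_homotopy cH H0 loop hw.
have [th cth hth] : exists2 th : P2 -> R, continuous th & forall x, cdisk x -> ang (sub2 (G x) y) (th x).
  apply: lift_disk => [x|x dx]; first by rewrite /sub2; cont.
  exact/sub2_neq0/Gy.
apply: w0; apply: (wind_uniq hw1); exists (fun t => th (expi (T * t))); split.
- by move=> t; cont.
- move=> t _; have := hth _ (S1d _ (S1_expi (T * t))).
  by rewrite /H; have -> : c (t, 1) = y by rewrite /c [RHS]surjective_pairing /=; congr pair; ring.
- by rewrite e01 subrr.
Qed.

Lemma invariance_of_domain (G : P2 -> P2) (x0 : P2) (r : R) : 0 < r -> continuous G ->
  (forall x y, sq2 (sub2 x x0) <= r ^+ 2 -> sq2 (sub2 y x0) <= r ^+ 2 -> G x = G y -> x = y) ->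
  nbhs (G x0) (G @` [set x | sq2 (sub2 x x0) <= r ^+ 2]).
Proof.
move=> r0 cG iG.
pose A (x : P2) : P2 := (x0.1 + r * x.1, x0.2 + r * x.2).
have dA x : sq2 (sub2 (A x) x0) = r ^+ 2 * sq2 x by rewrite /sq2 /A /=; ring.
have hA x : cdisk x -> sq2 (sub2 (A x) x0) <= r ^+ 2.
  by move=> dx; rewrite dA ler_piMr// sqr_ge0.
have A0 : A 0 = x0 by rewrite /A /= !mulr0 !addr0; case: (x0).
have := @invariance_of_domain0 (G \o A); rewrite /= A0 => H.
have {}H := H _ _; apply: filterS (H _ _).
- by move=> _ [x dx <-]; exists (A x) => //; exact: hA.
- by move=> x; rewrite /comp /A; cont.
move=> x y dx dy /iG e; have {e} := e (hA _ dx) (hA _ dy); rewrite /A => -[].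
move=> /addrI/(mulfI (lt0r_neq0 r0)) e1 /addrI/(mulfI (lt0r_neq0 r0)) e2.
by case: x y e1 e2 {dx dy} => [? ?] [? ?] /= -> ->.
Qed.

(** To leave the window the angle would have to take the value [psi + pi / 2] or [psi - pi / 2],
    where the cosine vanishes. *)
Lemma half_plane_window (th : R -> R) (psi : R) : continuous th ->
  (forall t, 0 <= t <= 1 -> 0 < cos (th t - psi)) ->
  `|th 0 - psi| < pi / 2 -> `|th 1 - psi| < pi / 2.
Proof.
move=> cth hc; rewrite !ltr_norml => /andP[h1 h2]; apply/andP.
have p0 := @pi_gt0 R.
split; rewrite ltNge; apply/negP => h.
  have [|c /[!in_itv]/= hc01 hv] := @IVT _ th 0 1 (psi - pi / 2) ler01 (continuous_subspaceT cth).
    by rewrite ge_min le_max; apply/andP; split; apply/orP; [right|left]; lra.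
  by have := hc c hc01; rewrite hv addrAC subrr add0r cosN cos_pihalf ltxx.
have [|c /[!in_itv]/= hc01 hv] := @IVT _ th 0 1 (psi + pi / 2) ler01 (continuous_subspaceT cth).
  by rewrite ge_min le_max; apply/andP; split; apply/orP; [left|right]; lra.
by have := hc c hc01; rewrite hv addrAC subrr add0r cos_pihalf ltxx.
Qed.

Lemma congruent_window (x y psi : R) (k : int) : x - y = T * k%:~R ->
  `|x - psi| < pi / 2 -> `|y - psi| < pi / 2 -> x = y.
Proof.
move=> e; rewrite !ltr_norml => /andP[h1 h2] /andP[h3 h4].
have p0 := @pi_gt0 R; have T0 := tau_gt0 R.
have k1 : (k < 1)%R.
  rewrite -(ltr_int R) -(ltr_pM2l T0) -e mulr1; rewrite /tau; lra.
have k2 : (- 1 < k)%R.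
  rewrite -(ltr_int R) -(ltr_pM2l T0) -e mulrNz mulrN mulr1; rewrite /tau; lra.
have k0 : k = 0 by lia.
by move: e; rewrite k0 mulr0 => /eqP; rewrite subr_eq0 => /eqP.
Qed.

(** A chord is perpendicular to the bisector of its endpoints. As [ang] excludes the vector 0, this
    also serves to show that [expi x] and [expi y] are distinct. *)
Lemma ang_chord (x y : R) : x < y < x + T ->
  ang (sub2 (expi x) (expi y)) ((x + y) / 2 - pi / 2).
Proof.
move=> /andP[xy yx]; exists (2 * sin ((y - x) / 2)).
  rewrite mulr_gt0// sin_gt0_pi//; apply/andP; split; first by lra.
  by move: yx; rewrite /tau; lra.
rewrite cosBpihalf sinBpihalf /sub2 /=.
have -> : cos x = cos ((x + y) / 2 - (y - x) / 2) by congr cos; lra.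
have -> : cos y = cos ((x + y) / 2 + (y - x) / 2) by congr cos; lra.
have -> : sin x = sin ((x + y) / 2 - (y - x) / 2) by congr sin; lra.
have -> : sin y = sin ((x + y) / 2 + (y - x) / 2) by congr sin; lra.
by rewrite cosB cosD sinB sinD; congr pair; ring.
Qed.

Lemma sub2_opp (v w : P2) : (- (sub2 v w).1, - (sub2 v w).2) = sub2 w v.
Proof. by rewrite /sub2 /= !opprB. Qed.

(** The tangent at [expi x] touches the disk only there: expand [sq2 (sub2 v (expi x)) > 0]. *)
Lemma disk_half_plane (v : P2) (x : R) : cdisk v -> v <> expi x -> dot2 v (expi x) < 1.
Proof.
move=> dv ne.
have h : 0 < sq2 (sub2 v (expi x)).
  by rewrite lt_neqAle sq2_ge0 andbT; apply/eqP => /esym/sq2_eq0; exact: sub2_neq0.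
have e : sq2 (sub2 v (expi x)) = sq2 v + 1 - 2 * dot2 v (expi x).
  by rewrite -[X in _ + X - _](cos2sin2 x) /sq2 /dot2 /=; ring.
by move: dv h; rewrite e /cdisk /=; lra.
Qed.

Lemma cos_of_ang (v : P2) a x : ang v a -> 0 < dot2 v (expi x) -> 0 < cos (a - x).
Proof.
move=> [r r0 ->]; rewrite /dot2 /= cosB.
have -> : r * cos a * cos x + r * sin a * sin x = r * (cos a * cos x + sin a * sin x) by ring.
by rewrite pmulr_rgt0.
Qed.

Lemma crossing_paths (al be : R -> P2) (a b c d : R) :
  continuous al -> continuous be ->
  (forall t, 0 <= t <= 1 -> cdisk (al t)) -> (forall t, 0 <= t <= 1 -> cdisk (be t)) ->
  al 0 = expi a -> be 0 = expi b -> al 1 = expi c -> be 1 = expi d ->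
  a < b -> b < c -> c < d -> d < a + T ->
  exists s t, [/\ 0 <= s <= 1, 0 <= t <= 1 & al s = be t].
Proof.
move=> cal cbe dal dbe al0 be0 al1 be1 ab bc cd da.
have [//|ne] := pselect (exists s t, [/\ 0 <= s <= 1, 0 <= t <= 1 & al s = be t]); exfalso.
have {}ne s t : 0 <= s <= 1 -> 0 <= t <= 1 -> al s <> be t by move=> hs ht e; apply: ne; exists s, t.
have [] := @lift_square _ (fun p => sub2 (al p.1) (be p.2)).
- by move=> p; rewrite /sub2; cont.
- by move=> [s t] [/= hs ht]; apply/sub2_neq0/ne.
move=> th0 cth0 hth0.
have i0 : 0 <= (0 : R) <= 1 by rewrite lexx ler01.
have i1 : 0 <= (1 : R) <= 1 by rewrite lexx ler01.
have c00 : ang (sub2 (al 0) (be 0)) ((a + b) / 2 - pi / 2).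
  by rewrite al0 be0; apply: ang_chord; rewrite ab/= (lt_trans bc)// (lt_trans cd).
have [k hk] := ang_uniq c00 (hth0 (0, 0) (conj i0 i0)).
(* Normalised at the corner [(0, 0)] to the value of [ang_chord], so that the angles at the other
   corners become numbers. *)
pose th p := th0 p + T * k%:~R.
have cth : continuous th by move=> p; rewrite /th; cont.
have hth s t : 0 <= s <= 1 -> 0 <= t <= 1 -> ang (sub2 (al s) (be t)) (th (s, t)).
  by move=> hs ht; apply/ang_shift; exact: (hth0 (s, t)).
have t00 : th (0, 0) = (a + b) / 2 - pi / 2 by rewrite /th -hk; ring.
have p0 := @pi_gt0 R; have TE : T = 2 * pi by [].
have nrm (x : R) : - (pi / 2) < x -> x < pi / 2 -> `|x| < pi / 2 by move=> ? ?; rewrite ltr_norml; apply/andP; split.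
(* Along each side of the square one of the two points is fixed on the unit
   circle, so the difference stays in an open half plane; hence the two routes
   to the corner [(1, 1)] give angles differing by a full turn. *)
have w01 : `|th (0, 1) - a| < pi / 2.
  apply: (@half_plane_window (fun t => th (0, t)) a).
  - by move=> t; cont.
  - move=> t ht; apply: cos_of_ang (hth 0 t i0 ht) _.
    have h := disk_half_plane (dbe t ht) (fun e => ne 0 t i0 ht (etrans al0 (esym e))).
    have -> : dot2 (sub2 (al 0) (be t)) (expi a) = 1 - dot2 (be t) (expi a).
      by rewrite -(cos2sin2 a) al0 /dot2 /=; ring.
    by rewrite subr_gt0.
  - by rewrite t00; apply: nrm; lra.
have t01 : th (0, 1) = (a + d) / 2 - pi / 2.
  have h := hth 0 1 i0 i1; rewrite al0 be1 in h.
  have [|l hl] := @ang_uniq _ _ _ ((a + d) / 2 - pi / 2) h.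
    by apply: ang_chord; rewrite da andbT (lt_trans ab)// (lt_trans bc).
  by apply: (congruent_window hl w01); apply: nrm; lra.
have w10 : `|th (1, 0) - (b - pi)| < pi / 2.
  apply: (@half_plane_window (fun s => th (s, 0)) (b - pi)).
  - by move=> t; cont.
  - move=> t ht; apply: cos_of_ang (hth t 0 ht i0) _.
    have h := disk_half_plane (dal t ht) (fun e => ne t 0 ht i0 (etrans e (esym be0))).
    have -> : dot2 (sub2 (al t) (be 0)) (expi (b - pi)) = 1 - dot2 (al t) (expi b).
      by rewrite -(cos2sin2 b) be0 /dot2 /= cosB sinB cospi sinpi; ring.
    by rewrite subr_gt0.
  - by rewrite t00; apply: nrm; lra.
have t10 : th (1, 0) = (b + c) / 2 - 3 * pi / 2.
  have h := hth 1 0 i1 i0; rewrite al1 be0 in h.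
  have [|l hl] := @ang_uniq _ _ _ ((b + c) / 2 - 3 * pi / 2) h.
    rewrite -sub2_opp; have -> : (b + c) / 2 - 3 * pi / 2 = (b + c) / 2 - pi / 2 + pi + T * (-1)%:~R.
      by rewrite /tau mulrN1z; lra.
    by apply/ang_shift/ang_opp/ang_chord; rewrite bc /=; lra.
  by apply: (congruent_window hl w10); apply: nrm; lra.
have w11 : `|th (1, 1) - (d - pi)| < pi / 2.
  apply: (@half_plane_window (fun s => th (s, 1)) (d - pi)).
  - by move=> t; cont.
  - move=> t ht; apply: cos_of_ang (hth t 1 ht i1) _.
    have h := disk_half_plane (dal t ht) (fun e => ne t 1 ht i1 (etrans e (esym be1))).
    have -> : dot2 (sub2 (al t) (be 1)) (expi (d - pi)) = 1 - dot2 (al t) (expi d).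
      by rewrite be1 -(cos2sin2 d) /dot2 /= cosB sinB cospi sinpi; ring.
    by rewrite subr_gt0.
  - by rewrite t01; apply: nrm; lra.
have t11 : th (1, 1) = (c + d) / 2 - pi / 2.
  have h := hth 1 1 i1 i1; rewrite al1 be1 in h.
  have [|l hl] := @ang_uniq _ _ _ ((c + d) / 2 - pi / 2) h.
    by apply: ang_chord; rewrite cd /=; lra.
  by apply: (congruent_window hl w11); apply: nrm; lra.
have : `|th (1, 1) - (c - T)| < pi / 2.
  apply: (@half_plane_window (fun t => th (1, t)) (c - T)).
  - by move=> t; cont.
  - move=> t ht; apply: cos_of_ang (hth 1 t i1 ht) _.
    have h := disk_half_plane (dbe t ht) (fun e => ne 1 t i1 ht (etrans al1 (esym e))).
    have -> : expi (c - T) = expi c :> P2 by rewrite -expiDT subrK.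
    have -> : dot2 (sub2 (al 1) (be t)) (expi c) = 1 - dot2 (be t) (expi c).
      by rewrite al1 -(cos2sin2 c) /dot2 /=; ring.
    by rewrite subr_gt0.
  - by rewrite t10 TE; apply: nrm; lra.
by rewrite t11 ltr_norml TE => /andP[_]; lra.
Qed.

End PlaneTopology.

(** * The degree of a disk embedding on the boundary circle *)

Section DiskDegree.
Variable R : realType.
Notation P2 := (R * R)%type.
Notation T := (tau R).

Lemma wind_circle (v : P2) (e : R) : 0 < e ->
  wind (fun t => sub2 (v.1 + e * cos (T * t), v.2 + e * sin (T * t)) v) T.
Proof.
move=> e0; exists (fun t => T * t); split; first by move=> t; cont.
  by move=> t _; exists e => //; rewrite /sub2 /=; congr pair; ring.
by rewrite mulr0 mulr1 subr0.
Qed.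

Lemma lift_periods (ps : R -> R) (w M : R) n : 0 < M -> continuous ps ->
  (forall y, - M <= y -> y + T <= M -> ps (y + T) - ps y = w) ->
  forall y, - M <= y -> y + n%:R * T <= M -> ps (y + n%:R * T) - ps y = n%:R * w.
Proof.
move=> M0 cps hw; have T0 := tau_gt0 R; elim: n => [|n IH] y y1.
  by rewrite !mul0r addr0 subrr.
have -> : n.+1%:R = n%:R + 1 :> R by rewrite natr1.
rewrite !mulrDl !mul1r addrA => y2.
have nT : 0 <= n%:R * T by rewrite mulr_ge0// ltW.
have h1 : ps (y + n%:R * T) - ps y = n%:R * w by apply: IH => //; lra.
have h2 : ps (y + n%:R * T + T) - ps (y + n%:R * T) = w by apply: hw => //; lra.
by rewrite -h1 -h2; ring.
Qed.

(* A small circle around [G 0] pulls back to a loop of degree [k] in the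
   punctured disk, so that [1 = k * k'], where [k'] is the degree of [G] on
   the unit circle. *)
Lemma disk_degree (G hinv : P2 -> P2) (w : R) : continuous G ->
  {within G @` @cdisk R, continuous hinv} -> (forall x, cdisk x -> hinv (G x) = x) ->
  wind (fun t => sub2 (G (expi (T * t))) (G 0)) w -> w = T \/ w = - T.
Proof.
move=> cG ch hG hw.
have iG x y : cdisk x -> cdisk y -> G x = G y -> x = y.
  by move=> dx dy e; rewrite -(hG x)// e hG.
have [e /= e0 he] : exists2 e, 0 < e & forall t, (G @` @cdisk R)
    ((G 0).1 + e * cos (T * t), (G 0).2 + e * sin (T * t)).
  have /nbhs_ballP[d /= d0 hd] := invariance_of_domain0 cG iG.
  exists (d / 2); first by rewrite divr_gt0.
  have small x : `|x| <= 1 -> `|d / 2 * x| < d.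
    move=> x1; rewrite normrM ger0_norm ?divr_ge0 ?(ltW d0)//.
    apply: (@le_lt_trans _ _ (d / 2)); last by rewrite ltr_pdivrMr// ltr_pMr// ltr1n.
    by rewrite ler_piMr// divr_ge0// ltW.
  have cs := cos2sin2; move=> t; apply: hd; split; rewrite -ball_normE /= opprD addrA subrr add0r normrN.
    by apply: small; rewrite ler_norml; apply/andP; split; have := cs R (T * t); nra.
  by apply: small; rewrite ler_norml; apply/andP; split; have := cs R (T * t); nra.
pose c t : P2 := ((G 0).1 + e * cos (T * t), (G 0).2 + e * sin (T * t)).
have cc : continuous c by move=> t; rewrite /c; cont.
pose x t := hinv (c t).
have cx : continuous x by apply: (continuous_comp_within ch) cc he.
have [dx Gx] : (forall t, cdisk (x t)) /\ forall t, G (x t) = c t.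
  by split=> t; rewrite /x /c; have [y dy <-] := he t; rewrite hG.
have expi01 : expi (T * 0) = expi (T * 1) :> P2.
  by have := expiDT (0 : R); rewrite add0r mulr0 mulr1 => ->.
have c01 : c 0 = c 1 by case: expi01 => e1 e2; rewrite /c e1 e2.
have d0 : cdisk (0 : P2) by rewrite /cdisk /sq2 /= expr0n /= addr0 ler01.
have cG0 t : c t <> G 0.
  move=> E; apply: (@expi_neq0 _ (T * t)).
  have e1 := congr1 fst E; have e2 := congr1 snd E; rewrite /c /= in e1 e2.
  have /eqP : e * cos (T * t) = 0 by lra.
  have /eqP : e * sin (T * t) = 0 by lra.
  by rewrite !mulf_eq0 (gt_eqF e0)/= => /eqP s0 /eqP c0; rewrite /expi c0 s0.
have x0 t : x t <> 0 by move=> E; apply: (cG0 t); rewrite -Gx E.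
have [th cth hth] := lift_path ler01 cx (fun t _ => x0 t).
have [k hk] : exists k : int, th 1 - th 0 = T * k%:~R.
  apply: (@ang_uniq _ (x 0)); last by apply: hth; rewrite lexx ler01.
  by rewrite /x c01; apply: hth; rewrite lexx ler01.
pose r t := Num.sqrt (sq2 (x t)).
have cr : continuous r by move=> t; rewrite /r /sq2; cont.
have r2 t : r t ^+ 2 = sq2 (x t) by rewrite sqr_sqrtr// sq2_ge0.
have r0 t : 0 < r t.
  rewrite sqrtr_gt0 lt_neqAle sq2_ge0 andbT; apply/eqP => /esym/sq2_eq0; exact: x0.
have r1 t : r t <= 1.
  by rewrite -(@ler_pXn2r _ 2)// ?nnegrE ?(ltW (r0 t))// r2 expr1n; exact: dx.
have xE t : 0 <= t <= 1 -> x t = (r t * cos (th t), r t * sin (th t)).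
  move=> ht; have [s s0 xs] := hth t ht; rewrite xs; suff -> : r t = s by [].
  have E : sq2 (x t) = s ^+ 2 by rewrite xs (sq2Z s (expi _)) sq2_expi mulr1.
  by rewrite /r E sqrtr_sqr gtr0_norm.
(* In polar coordinates the pulled back loop is deformed linearly to the unit circle run through [k]
   times; the radius stays in [(0, 1]], so that [G] keeps away from [G 0]. *)
pose rho (p : P2) := (1 - p.2) * r p.1 + p.2.
pose al (p : P2) := (1 - p.2) * th p.1 + p.2 * (th 0 + T * k%:~R * p.1).
pose H (p : P2) := sub2 (G (rho p * cos (al p), rho p * sin (al p))) (G 0).
have cH : continuous H by move=> p; rewrite /H /rho /al /sub2; cont.
have H0 p : usq p -> H p <> 0.
  move=> [_ /andP[l0 l1]]; have rho0 : 0 < rho p by have := r0 p.1; rewrite /rho; nra.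
  have rho1 : rho p <= 1 by have := r1 p.1; rewrite /rho; nra.
  apply: sub2_neq0 => /iG E.
  have {E} := E _ d0; rewrite /cdisk /mkset (sq2Z (rho p) (expi (al p))) sq2_expi mulr1.
  rewrite expr_le1 ?(ltW rho0)// rho1 => /(_ isT) [] /eqP; rewrite mulf_eq0 (gt_eqF rho0)/= => /eqP e1.
  move=> /eqP; rewrite mulf_eq0 (gt_eqF rho0)/= => /eqP e2.
  by apply: (@expi_neq0 _ (al p)); rewrite /expi e1 e2.
have loop l : 0 <= l <= 1 -> H (0, l) = H (1, l).
  move=> _; have rE : rho (0, l) = rho (1, l) by rewrite /rho /r /= /x c01.
  have aE : al (1, l) = al (0, l) + T * k%:~R.
    by rewrite /al /= -(subrK (th 0) (th 1)) hk; ring.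
  by rewrite /H aE (cosDTz _ k).1 (cosDTz _ k).2 rE.
have wH0 : wind (fun t => H (t, 0)) T.
  apply: wind_ext (wind_circle (G 0) e0) => t ht.
  rewrite /H /rho /al /= subr0 !mul1r mul0r !addr0 -xE// Gx//.
have wH1 := wind_homotopy cH H0 loop wH0.
have {}wH1 : wind (fun t => sub2 (G (expi (th 0 + T * k%:~R * t))) (G 0)) T.
  apply: wind_ext wH1 => t _.
  by rewrite /H /rho /al /= subrr !mul0r !add0r !mul1r.
(* Room for [th 0 + T * k%:~R * t] with [t] in [[0, 1]], and for one more period. *)
pose n := `|k|%N; pose M := `|th 0| + T * (n.+1)%:R.
have T0 := tau_gt0 R.
have M0 : 0 < M by rewrite ltr_wpDl// mulr_gt0// ltr0n.
have [] := @lift_path _ (fun y => sub2 (G (expi y)) (G 0)) (- M) M.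
- by rewrite ge0_cp ?ltW.
- by have cE := @continuous_expi R; move=> t; rewrite /sub2; cont.
- move=> t _; apply: sub2_neq0 => /iG E; apply: (@expi_neq0 _ t); apply: E => //.
  by rewrite /cdisk /= sq2_expi.
move=> ps cps hps.
have [j hj] : exists j : int, w = T * j%:~R.
  by apply: wind_loop hw; rewrite /= expi01.
have per y : - M <= y -> y + T <= M -> ps (y + T) - ps y = w.
  have q0 : ps (0 + T) - ps 0 = w.
    apply: (wind_uniq _ hw); exists (fun t => ps (T * t)); split.
    + by move=> t; cont.
    + move=> t /andP[t0 t1]; apply: hps; apply/andP; split.
        by rewrite (@le_trans _ _ 0) ?oppr_le0 ?(ltW M0)// mulr_ge0// ltW.
      apply: (@le_trans _ _ T); first by rewrite ler_piMr// ltW.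
      by rewrite /M -natr1 mulrDr mulr1 addrA lerDr addr_ge0// mulr_ge0// ltW.
    + by rewrite mulr0 mulr1 add0r.
  have MT : T <= M by rewrite /M -natr1 mulrDr mulr1 addrA lerDr addr_ge0// mulr_ge0// ltW.
  have const u v : - M <= u -> u <= v -> v + T <= M -> ps (u + T) - ps u = ps (v + T) - ps v.
    move=> h1 h2 h3; apply: (@discrete_const _ (fun y => ps (y + T) - ps y) 0) => //.
      by move=> t; cont.
    move=> t /andP[t1 t2]; have [||i hi] := @ang_uniq _ (sub2 (G (expi t)) (G 0)) (ps (t + T)) (ps t).
    + by rewrite -expiDT; apply: hps; apply/andP; split; lra.
    + by apply: hps; apply/andP; split; lra.
    + by exists i; rewrite add0r.
  move=> y1 y2; rewrite -q0; have [h|/ltW h] := leP y 0.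
    by apply: const => //; rewrite add0r.
  by apply/esym/const => //; lra.
(* The loop with total change [T] runs through [k] periods of [ps], and each of them contributes
   [w = T * j%:~R]. *)
have main : T = T * k%:~R * j%:~R.
  have h0 := ler_norm (th 0); have h0' := ler_norm (- th 0); rewrite normrN in h0'.
  have kn : T * n%:R = T * `|k%:~R|.
    by rewrite -intr_norm.
  have nT : 0 <= T * n%:R by rewrite mulr_ge0// ltW.
  have ME : M = `|th 0| + T * n%:R + T by rewrite /M -natr1 mulrDr mulr1 addrA.
  have kn1 := ler_norm (T * k%:~R); have kn2 := ler_norm (- (T * k%:~R)).
  rewrite normrN in kn2; rewrite normrM gtr0_norm// -kn in kn1 kn2.
  have tot : T = ps (th 0 + T * k%:~R) - ps (th 0).
    apply: (wind_uniq wH1); exists (fun t => ps (th 0 + T * k%:~R * t)); split.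
    + by move=> t; cont.
    + move=> t /andP[t0 t1]; apply: hps.
      have : `|T * k%:~R * t| <= T * n%:R.
        rewrite normrM (ger0_norm t0) normrM gtr0_norm// -kn; exact: ler_piMr.
      rewrite ler_norml => /andP[h1 h2]; apply/andP; split; lra.
    + by rewrite mulr0 mulr1 addr0.
  rewrite {1}tot; have [k0|k0] := leP 0 k.
    have kE : k%:~R = n%:R :> R by rewrite -[k in LHS](gez0_abs k0).
    rewrite kE in kn1 kn2 *; rewrite mulrC (lift_periods M0 cps per); [|lra|lra].
    by rewrite hj; ring.
  have kE : k%:~R = - n%:R :> R by rewrite -[k in LHS]opprK -(ltz0_abs k0) mulrNz.
  rewrite kE in kn1 kn2 *.
  have := lift_periods M0 cps per (y := th 0 + T * - n%:R) (n := n).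
  have -> : th 0 + T * - n%:R + n%:R * T = th 0 by ring.
  by rewrite hj => h; rewrite -opprB h; [ring|lra|lra].
have kj : (k * j = 1)%R.
  apply: (@intr_inj R); rewrite intrM; apply: (mulfI (lt0r_neq0 T0)).
  by rewrite mulr1 {2}main mulrA.
have /eqP := congr1 absz kj; rewrite abszM muln_eq1 => /andP[_ /eqP aj].
have [j1|j1] : j = 1 \/ j = -1 by lia.
  by left; rewrite hj j1 mulr1.
by right; rewrite hj j1 mulrN1.
Qed.

End DiskDegree.

(** * Loops in the sphere *)

Section Sphere.
Variable R : realType.
Notation P2 := (R * R)%type.
Notation P3 := (R * R * R)%type.
Notation T := (tau R).

(** A diagonal entry of the matrix identity that expresses completeness of an orthonormal frame:
    [(a, b, c)], [(x, y, z)] and their cross product. [lagrange_off] is an off-diagonal entry;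
    cyclic permutation of the coordinates gives the others. *)
Lemma lagrange_diag (a b c x y z : R) : a ^+ 2 + b ^+ 2 + c ^+ 2 = 1 ->
  x ^+ 2 + y ^+ 2 + z ^+ 2 = 1 -> x * a + y * b + z * c = 0 ->
  (b * z - c * y) ^+ 2 + x ^+ 2 + a ^+ 2 = 1.
Proof.
move=> h1 h2 h3.
have -> : (b * z - c * y) ^+ 2 = (b ^+ 2 + c ^+ 2) * (y ^+ 2 + z ^+ 2) - (y * b + z * c) ^+ 2 by ring.
have -> : b ^+ 2 + c ^+ 2 = 1 - a ^+ 2 by rewrite -h1; ring.
have -> : y ^+ 2 + z ^+ 2 = 1 - x ^+ 2 by rewrite -h2; ring.
have -> : y * b + z * c = - (x * a) by lra.
ring.
Qed.

Lemma lagrange_off (a b c x y z : R) : a ^+ 2 + b ^+ 2 + c ^+ 2 = 1 ->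
  x ^+ 2 + y ^+ 2 + z ^+ 2 = 1 -> x * a + y * b + z * c = 0 ->
  (b * z - c * y) * (c * x - a * z) + x * y + a * b = 0.
Proof.
move=> h1 h2 h3.
have -> : (b * z - c * y) * (c * x - a * z) =
  (z * c) * (b * x + a * y) - a * b * z ^+ 2 - c ^+ 2 * x * y by ring.
have -> : z * c = - (x * a) - y * b by lra.
have -> : z ^+ 2 = 1 - x ^+ 2 - y ^+ 2 by rewrite -h2; ring.
have -> : c ^+ 2 = 1 - a ^+ 2 - b ^+ 2 by rewrite -h1; ring.
ring.
Qed.

Definition frame (N u : P3) := [/\ dot3 N N = 1, dot3 u u = 1 & dot3 u N = 0].
(** Quarter turn of the plane orthogonal to [N], in the orientation with normal [-N] that
    [winds_once_pos] prescribes. *)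
Definition turn (N u : P3) : P3 := cross3 (scale3 (-1) N) u.

Lemma frame_exists N : S2 N -> exists u, frame N u.
Proof.
case: N => [[a b] c]; rewrite /S2 /dot3 /= => h.
have [e|ne] := eqVneq (a ^+ 2 + b ^+ 2) 0.
  have ha := sqr_ge0 a; have hb := sqr_ge0 b.
  have /eqP : a ^+ 2 = 0 by lra.
  rewrite sqrf_eq0 => /eqP a0.
  by exists ((1, 0), 0); rewrite /frame /dot3 /= a0; split; [rewrite -a0|ring|ring].
pose s := Num.sqrt (a ^+ 2 + b ^+ 2).
have p0 : 0 <= a ^+ 2 + b ^+ 2 by rewrite addr_ge0 ?sqr_ge0.
have s2 : s ^+ 2 = a ^+ 2 + b ^+ 2 by rewrite sqr_sqrtr.
have s0 : s != 0 by apply: contraNneq ne => e; rewrite -s2 e expr0n.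
exists ((- b / s, a / s), 0); rewrite /frame /dot3 /=; split=> //; last by ring.
have -> : - b / s * (- b / s) + a / s * (a / s) + 0 * 0 = (a ^+ 2 + b ^+ 2) / s ^+ 2.
  by field.
by rewrite -s2 divff// expf_neq0.
Qed.

Lemma frame_complete N u (x : P3) : frame N u ->
  x = add3 (add3 (scale3 (dot3 x u) u) (scale3 (dot3 x (turn N u)) (turn N u))) (scale3 (dot3 x N) N).
Proof.
case: N u x => [[a b] c] [[p q] r] [[x y] z]; rewrite /frame /turn /dot3 /cross3 /scale3 /add3 /=.
case=> h1 h2 h3.
have k1 : a ^+ 2 + b ^+ 2 + c ^+ 2 = 1 by rewrite -h1; ring.
have k2 : p ^+ 2 + q ^+ 2 + r ^+ 2 = 1 by rewrite -h2; ring.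
have d1 := lagrange_diag k1 k2 h3.
have d2 : (c * p - a * r) ^+ 2 + q ^+ 2 + b ^+ 2 = 1.
  by apply: lagrange_diag; [rewrite -k1|rewrite -k2|rewrite -h3]; ring.
have d3 : (a * q - b * p) ^+ 2 + r ^+ 2 + c ^+ 2 = 1.
  by apply: lagrange_diag; [rewrite -k1|rewrite -k2|rewrite -h3]; ring.
have o1 := lagrange_off k1 k2 h3.
have o2 : (c * p - a * r) * (a * q - b * p) + q * r + b * c = 0.
  by apply: lagrange_off; [rewrite -k1|rewrite -k2|rewrite -h3]; ring.
have o3 : (a * q - b * p) * (b * r - c * q) + r * p + c * a = 0.
  by apply: lagrange_off; [rewrite -k1|rewrite -k2|rewrite -h3]; ring.
congr ((_, _), _).
- transitivity (x * ((b * r - c * q) ^+ 2 + p ^+ 2 + a ^+ 2) + y * ((b * r - c * q) * (c * p - a * r) + p * q + a * b)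
    + z * ((a * q - b * p) * (b * r - c * q) + r * p + c * a)); last by ring.
  by rewrite d1 o1 o3; ring.
- transitivity (x * ((b * r - c * q) * (c * p - a * r) + p * q + a * b) + y * ((c * p - a * r) ^+ 2 + q ^+ 2 + b ^+ 2)
    + z * ((c * p - a * r) * (a * q - b * p) + q * r + b * c)); last by ring.
  by rewrite d2 o1 o2; ring.
- transitivity (x * ((a * q - b * p) * (b * r - c * q) + r * p + c * a) + y * ((c * p - a * r) * (a * q - b * p) + q * r + b * c)
    + z * ((a * q - b * p) ^+ 2 + r ^+ 2 + c ^+ 2)); last by ring.
  by rewrite d3 o2 o3; ring.
Qed.

Lemma dot3C (x y : P3) : dot3 x y = dot3 y x. Proof. by rewrite /dot3; ring. Qed.
Lemma dot3D (x y z : P3) : dot3 (add3 x y) z = dot3 x z + dot3 y z.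
Proof. by rewrite /dot3 /add3 /=; ring. Qed.
Lemma dot3Dr (x y z : P3) : dot3 z (add3 x y) = dot3 z x + dot3 z y.
Proof. by rewrite /dot3 /add3 /=; ring. Qed.
Lemma dot3B (x y z : P3) : dot3 (sub3 x y) z = dot3 x z - dot3 y z.
Proof. by rewrite /dot3 /sub3 /=; ring. Qed.
Lemma dot3Z c (x z : P3) : dot3 (scale3 c x) z = c * dot3 x z.
Proof. by rewrite /dot3 /scale3 /=; ring. Qed.
Lemma dot3Zr c (x z : P3) : dot3 z (scale3 c x) = c * dot3 z x.
Proof. by rewrite /dot3 /scale3 /=; ring. Qed.

Lemma frame_turn N u : frame N u ->
  [/\ dot3 (turn N u) (turn N u) = 1, dot3 (turn N u) N = 0 & dot3 (turn N u) u = 0].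
Proof.
move=> [h1 h2 h3]; split.
- have -> : dot3 (turn N u) (turn N u) = dot3 N N * dot3 u u - dot3 u N ^+ 2.
    by rewrite /turn /dot3 /cross3 /scale3 /=; ring.
  by rewrite h1 h2 h3; ring.
- by rewrite /turn /dot3 /cross3 /scale3 /=; ring.
- by rewrite /turn /dot3 /cross3 /scale3 /=; ring.
Qed.

Lemma frame_dot N u x y : frame N u ->
  dot3 x y = dot3 x u * dot3 y u + dot3 x (turn N u) * dot3 y (turn N u) + dot3 x N * dot3 y N.
Proof.
by move=> fr; rewrite {1}(frame_complete y fr) !dot3Dr !dot3Zr; ring.
Qed.

(** Stereographic projection from [N] in the coordinates of [u] and [turn N u]; [chi] is its
    inverse. *)
Definition psi (N u x : P3) : P2 :=
  (dot3 x u / (1 - dot3 x N), dot3 x (turn N u) / (1 - dot3 x N)).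

Definition chi (N u : P3) (y : P2) : P3 :=
  scale3 (sq2 y + 1)^-1
    (add3 (add3 (scale3 (2 * y.1) u) (scale3 (2 * y.2) (turn N u))) (scale3 (sq2 y - 1) N)).

Lemma dot3_neq1 (N x : P3) : S2 N -> S2 x -> x <> N -> 1 - dot3 x N != 0.
Proof.
rewrite /S2 /= => hN hx ne; apply/eqP => e; apply: ne.
have : dot3 (sub3 x N) (sub3 x N) = 0.
  have -> : dot3 (sub3 x N) (sub3 x N) = dot3 x x + dot3 N N - 2 * dot3 x N.
    by rewrite /dot3 /sub3 /=; ring.
  by rewrite hN hx; lra.
case: x N {hN hx e} => [[x y] z] [[a b] c]; rewrite /dot3 /sub3 /= -!expr2 => e.
have h1 := sqr_ge0 (x - a); have h2 := sqr_ge0 (y - b); have h3 := sqr_ge0 (z - c).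
have [e1 e2 e3] : [/\ (x - a) ^+ 2 = 0, (y - b) ^+ 2 = 0 & (z - c) ^+ 2 = 0] by split; lra.
by move/eqP: e1; move/eqP: e2; move/eqP: e3; rewrite !sqrf_eq0 !subr_eq0 => /eqP-> /eqP-> /eqP->.
Qed.

Lemma chiK N u y : frame N u -> psi N u (chi N u y) = y.
Proof.
move=> fr; have [t1 t2 t3] := frame_turn fr; case: (fr) => f1 f2 f3.
have q0 : sq2 y + 1 != 0 by rewrite lt0r_neq0// ltr_wpDl// sq2_ge0.
rewrite /psi /chi !dot3Z !dot3D !dot3Z f1 f2 f3 t1 t2 t3 (dot3C u) t3 (dot3C N) f3 (dot3C N) t2.
rewrite [RHS]surjective_pairing; congr pair.
  by field; rewrite q0 /= (_ : _ - _ = 2) ?pnatr_eq0//; ring.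
by field; rewrite q0 /= (_ : _ - _ = 2) ?pnatr_eq0//; ring.
Qed.

Lemma psiK N u x : frame N u -> S2 x -> x <> N -> chi N u (psi N u x) = x.
Proof.
move=> fr hx xN; have d0 := dot3_neq1 (let: And3 h _ _ := fr in h) hx xN.
have e := frame_dot x x fr; rewrite hx in e.
rewrite {2}(frame_complete x fr) /chi /psi /sq2 /=.
set al := dot3 x u in e *; set be := dot3 x (turn N u) in e *; set nu := dot3 x N in e d0 *.
have E : (al / (1 - nu)) ^+ 2 + (be / (1 - nu)) ^+ 2 = (1 + nu) / (1 - nu).
  have -> : (al / (1 - nu)) ^+ 2 + (be / (1 - nu)) ^+ 2 = (al * al + be * be) / (1 - nu) ^+ 2 by field.
  have -> : al * al + be * be = (1 - nu) * (1 + nu) by lra.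
  by field.
rewrite E.
have -> : (1 + nu) / (1 - nu) + 1 = 2 / (1 - nu) by field.
have -> : (1 + nu) / (1 - nu) - 1 = 2 * nu / (1 - nu) by field.
by rewrite /scale3 /add3 /=; congr ((_, _), _); field; rewrite d0.
Qed.

Lemma chiS2 N u y : frame N u -> S2 (chi N u y).
Proof.
move=> fr; have [t1 t2 t3] := frame_turn fr; case: (fr) => f1 f2 f3.
have q0 : sq2 y + 1 != 0 by rewrite lt0r_neq0// ltr_wpDl// sq2_ge0.
rewrite /S2 /= (frame_dot _ _ fr) /chi !dot3Z !dot3D !dot3Z f1 f2 f3 t1 t2 t3 (dot3C u) t3 (dot3C N) f3 (dot3C N) t2.
have e : sq2 y = y.1 ^+ 2 + y.2 ^+ 2 by [].
by move: q0; rewrite e => q0; field.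
Qed.

Lemma continuous_chi N u : continuous (chi N u).
Proof.
move=> y; rewrite /chi /scale3 /add3 /sq2 /=.
have q0 : y.1 ^+ 2 + y.2 ^+ 2 + 1 != 0 by rewrite lt0r_neq0// ltr_wpDl// addr_ge0 ?sqr_ge0.
by cont.
Qed.

Lemma psi_inj N u x y : frame N u -> S2 x -> S2 y -> x <> N -> y <> N ->
  psi N u x = psi N u y -> x = y.
Proof. by move=> fr hx hy xN yN e; rewrite -(psiK fr hx xN) e psiK. Qed.

Lemma continuous_psi N u x : S2 N -> S2 x -> x <> N -> continuous_at x (psi N u).
Proof.
move=> hN hx xN; have := dot3_neq1 hN hx xN; rewrite /psi /dot3 => d0; by cont.
Qed.

(** With [v0] and [v] the vectors from [z] to [x0] and to [x] in the chart, this is [v] times the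
    conjugate of [v0] in complex notation. No frame enters, so it stays continuous when the pole [N]
    moves. *)
Definition Zc (N z x0 x : P3) : P2 :=
  (dot3 (sub3 (stereo N x0) (stereo N z)) (sub3 (stereo N x) (stereo N z)),
   dot3 (turn N (sub3 (stereo N x0) (stereo N z))) (sub3 (stereo N x) (stereo N z))).

Lemma stereo_psi N u x : frame N u ->
  [/\ dot3 (stereo N x) u = (psi N u x).1, dot3 (stereo N x) (turn N u) = (psi N u x).2 &
     dot3 (stereo N x) N = 0].
Proof.
move=> fr; have [t1 t2 t3] := frame_turn fr; case: (fr) => f1 f2 f3.
rewrite /stereo /psi !dot3Z !dot3B !dot3Z f1 (dot3C N u) f3 (dot3C N (turn N u)) t2.
by rewrite !mulr0 !subr0 mulr1 subrr mulr0 ![_^-1 * _]mulrC.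
Qed.

Lemma turn_turn N u v : frame N u -> dot3 v N = 0 ->
  dot3 (turn N v) u = - dot3 v (turn N u) /\ dot3 (turn N v) (turn N u) = dot3 v u.
Proof.
move=> [f1 f2 f3] h; split; first by rewrite /turn /dot3 /cross3 /scale3 /=; ring.
have -> : dot3 (turn N v) (turn N u) = dot3 N N * dot3 v u - dot3 v N * dot3 u N.
  by rewrite /turn /dot3 /cross3 /scale3 /=; ring.
by rewrite f1 h; ring.
Qed.

Lemma ZcE N u z x0 x : frame N u -> Zc N z x0 x =
  (dot2 (sub2 (psi N u x0) (psi N u z)) (sub2 (psi N u x) (psi N u z)),
   cross2 (sub2 (psi N u x0) (psi N u z)) (sub2 (psi N u x) (psi N u z))).
Proof.
move=> fr; have [a1 a2 a3] := stereo_psi x0 fr; have [b1 b2 b3] := stereo_psi x fr.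
have [c1 c2 c3] := stereo_psi z fr.
have h : dot3 (sub3 (stereo N x0) (stereo N z)) N = 0 by rewrite dot3B a3 c3 subrr.
have [t1 t2] := turn_turn fr h.
rewrite /Zc; congr pair.
  by rewrite (frame_dot _ _ fr) !dot3B a1 a2 a3 b1 b2 b3 c1 c2 c3 subrr mulr0 addr0.
rewrite (frame_dot _ _ fr) t1 t2 !dot3B a1 a2 b1 b2 b3 c1 c2 c3 subrr mulr0 addr0.
by rewrite /cross2 /=; ring.
Qed.

(** The angle is measured from the direction of [gam 0]; by [wnumE] this gives the winding number in
    the chart of any frame. *)
Definition wnum (N z : P3) (gam : R -> P3) (w : R) :=
  wind (fun t => Zc N z (gam 0) (gam t)) w.

Lemma wnumE N u z gam w : frame N u -> psi N u (gam 0) <> psi N u z ->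
  wnum N z gam w <-> wind (fun t => sub2 (psi N u (gam t)) (psi N u z)) w.
Proof.
move=> fr ne; have [a ha] := ang_exists (sub2_neq0 ne); rewrite /wnum.
split=> -[th [cth hth e]].
  exists (fun t => a + th t); split; first by move=> t; cont.
    move=> t ht; apply: ang_rot ha _; rewrite -ZcE//; exact: hth.
  by rewrite -e; ring.
exists (fun t => th t - a); split; first by move=> t; cont.
  move=> t ht; rewrite (ZcE _ _ _ fr); apply: ang_angle => //; exact: hth.
by rewrite -e; ring.
Qed.

End Sphere.

(** * Parametrised closed disks in the sphere *)

Section Disks.
Variable R : realType.
Notation P2 := (R * R)%type.
Notation P3 := (R * R * R)%type.
Notation T := (tau R).

(** [g] is defined on the whole plane with values in [D], by composition with [retr], so its
    continuity needs no subspace; the inverse [h] is continuous only on [D]. *)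
Definition dparam (D : set P3) (g : P2 -> P3) (h : P3 -> P2) :=
  [/\ continuous g, (forall x, D (g x)), {within D, continuous h},
      (forall x, cdisk x -> h (g x) = x) & (forall y, D y -> cdisk (h y) /\ g (h y) = y)].

Lemma closed_disk_param D : is_closed_disk D -> D `<=` @S2 R /\ exists g h, dparam D g h.
Proof.
move=> [DS [g [h [cg ch gK hK]]]]; split => //; exists (g \o @retr R), h; split => //.
- by apply: (continuous_comp_within cg) (@continuous_retr R) (@retr_cdisk R).
- by move=> x; have [] := gK _ (retr_cdisk x).
- by move=> x dx; rewrite /= retrK//; have [] := gK _ dx.
- by move=> y Dy; have [d1 d2] := hK _ Dy; rewrite /= retrK.
Qed.

Lemma within_comp (S U V : topologicalType) (A : set S) (B : set U) (F : S -> U) (h : U -> V) :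
  {within A, continuous F} -> {within B, continuous h} -> (forall x, A x -> B (F x)) ->
  {within A, continuous (h \o F)}.
Proof.
move=> /subspace_continuousP cF /subspace_continuousP ch AB; apply/subspace_continuousP => x Ax.
have H : F @ within A (nbhs x) --> within B (nbhs (F x)).
  move=> W hW; have {}hW : nbhs (F x) (fun u => B u -> W u) by exact: hW.
  have {}hW : nbhs x (fun z => A z -> B (F z) -> W (F z)) := cF x Ax _ hW.
  have : nbhs x (fun z => A z -> W (F z)).
    by apply: filterS hW => z K Az; apply: K => //; exact: AB.
  exact.
exact: (cvg_comp _ _ H (ch _ (AB _ Ax))).
Qed.

Lemma dparam_compact D g h : dparam D g h -> compact D.
Proof.
move=> [cg Dg _ _ gK]; have -> : D = g @` @cdisk R.
  by apply/seteqP; split=> [y Dy|_ [x _ <-] //]; have [] := gK y Dy; exists (h y).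
by apply: continuous_compact; [exact: continuous_subspaceT|exact: cdisk_compact].
Qed.

Lemma dparam_closed D g h : dparam D g h -> closed D.
Proof. by move=> /dparam_compact; apply: compact_closed; exact: norm_hausdorff. Qed.

Lemma continuous_chart_param D g h N u : D `<=` @S2 R -> dparam D g h -> frame N u -> S2 N -> ~ D N ->
  continuous (fun x => psi N u (g x)).
Proof.
move=> DS [cg Dg _ _ _] fr hN nD x.
have h1 : S2 (g x) := DS _ (Dg x).
have h2 : g x <> N by move=> e; apply: nD; rewrite -e.
by apply: (@continuous_at_comp _ _ _ _ (psi N u) g); [exact: continuous_psi|exact: cg].
Qed.

Lemma chart_param_inj D g h N u x y : D `<=` @S2 R -> dparam D g h -> frame N u -> ~ D N ->
  cdisk x -> cdisk y -> psi N u (g x) = psi N u (g y) -> x = y.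
Proof.
move=> DS [cg Dg _ hg _] fr nD dx dy e.
have DN x' : g x' <> N by move=> e'; apply: nD; rewrite -e'.
by rewrite -(hg x)// (psi_inj fr _ _ _ _ e) ?hg//; exact: DS.
Qed.

(** Invariance of domain, read in the chart whose pole [N] lies outside the disk. *)
Lemma param_open_sint D g h N x : D `<=` @S2 R -> dparam D g h -> S2 N -> ~ D N ->
  sq2 x < 1 -> sint D (g x).
Proof.
move=> DS dp hN nD x1; have [u fr] := frame_exists hN; case: (dp) => cg Dg ch hg gh.
split; first exact: Dg.
have cG := continuous_chart_param DS dp fr hN nD.
(* Then [2 * r + r ^+ 2 <= 1 - sq2 x], so the ball of radius [r] about [x] stays in the unit
   disk. *)
pose r := (1 - sq2 x) / 4.
have r0 : 0 < r by rewrite divr_gt0// subr_gt0.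
have sx := sq2_ge0 x.
have sub y : sq2 (sub2 y x) <= r ^+ 2 -> cdisk y.
  move=> hy; rewrite /cdisk /=.
  pose d := dot2 x (sub2 y x).
  have e : sq2 y = sq2 x + 2 * d + sq2 (sub2 y x) by rewrite /d /sq2 /dot2 /=; ring.
  have cs : d ^+ 2 <= sq2 x * sq2 (sub2 y x).
    rewrite -subr_ge0; have -> : sq2 x * sq2 (sub2 y x) - d ^+ 2 = (cross2 x (sub2 y x)) ^+ 2.
      by rewrite /d /sq2 /dot2 /cross2 /=; ring.
    exact: sqr_ge0.
  have dr : d <= r.
    have s0 := sq2_ge0 (sub2 y x).
    have : d ^+ 2 <= r ^+ 2 by apply: (le_trans cs); nra.
    by move=> ?; nra.
  rewrite e; move: hy; rewrite /r in r0 dr *; nra.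
have inj y z : sq2 (sub2 y x) <= r ^+ 2 -> sq2 (sub2 z x) <= r ^+ 2 ->
    psi N u (g y) = psi N u (g z) -> y = z.
  by move=> /sub dy /sub dz; exact: (chart_param_inj DS dp fr nD).
have := invariance_of_domain r0 cG inj.
have gN y : g y <> N by move=> e'; apply: nD; rewrite -e'.
move=> /(@continuous_psi R N u _ hN (DS _ (Dg x)) (gN x)) hU.
(* The pole is removed from the neighbourhood: there [psi] takes the default value of a division by
   0, which may well be a value of the chart. *)
exists (psi N u @^-1` ((fun x0 => psi N u (g x0)) @` [set x0 | sq2 (sub2 x0 x) <= r ^+ 2]) `&` [set y | y <> N]); split.
  apply: filterI => //; apply: open_nbhs_nbhs; split; last exact: gN.
  have -> : [set y : P3 | y <> N] = ~` [set N] by [].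
  by rewrite openC; apply: accessible_closed_set1; apply: hausdorff_accessible; exact: norm_hausdorff.
move=> y [[z /= _ e] yN] hy.
have <- : g z = y by apply: (psi_inj fr _ hy _ yN e); [exact: DS|exact: gN].
exact: Dg.
Qed.

(** If [g x] were interior, a small disk of the chart about it would lie in [D] and be mapped
    injectively by [h] into the unit disk. By invariance of domain its image would be a
    neighbourhood of [x], but points [s * x] with [s > 1] are outside the disk. *)
Lemma param_circle_sbd D g h N x : D `<=` @S2 R -> dparam D g h -> S2 N -> ~ D N ->
  sq2 x = 1 -> ~ sint D (g x).
Proof.
move=> DS dp hN nD x1 [_ [U [nU hU]]]; have [u fr] := frame_exists hN; case: (dp) => cg Dg ch hg gh.
have gN : g x <> N by move=> e'; apply: nD; rewrite -e'.
have dx : cdisk x by rewrite /cdisk /= x1.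
pose y0 := psi N u (g x).
have e0 : chi N u y0 = g x by rewrite psiK//; exact: DS.
have : nbhs y0 (chi N u @^-1` U) by apply: (@continuous_chi _ N u); rewrite e0.
move=> /nbhs_ballP[r /= r0 hr].
pose q (y : P2) : P2 := (y0.1 + r / 2 * (retr y).1, y0.2 + r / 2 * (retr y).2).
have r20 : 0 < r / 2 by rewrite divr_gt0.
have hb (v : P2) : cdisk v -> ball y0 r (y0.1 + r / 2 * v.1, y0.2 + r / 2 * v.2).
  rewrite /cdisk /sq2 /= => hv.
  have h1 := sqr_ge0 v.1; have h2 := sqr_ge0 v.2.
  have ab (a b : R) : a - (a + b) = - b by ring.
  have [b1 b2] : -1 <= v.1 /\ v.1 <= 1 by split; nra.
  have [b3 b4] : -1 <= v.2 /\ v.2 <= 1 by split; nra.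
  have [p1 p2] : 0 <= r / 2 * (1 + v.1) /\ 0 <= r / 2 * (1 - v.1) by split; apply: mulr_ge0; lra.
  have [p3 p4] : 0 <= r / 2 * (1 + v.2) /\ 0 <= r / 2 * (1 - v.2) by split; apply: mulr_ge0; lra.
  split; rewrite -ball_normE /= ab normrN ltr_norml; apply/andP; split; lra.
have cr := @continuous_retr R.
have cq : continuous q by move=> y; rewrite /q; cont.
have Dq y : D (chi N u (q y)).
  apply: hU; last exact: chiS2.
  apply: hr; apply: hb; exact: retr_cdisk.
have cX : continuous (chi N u \o q).
  by have cc := @continuous_chi _ N u; move=> y; rewrite /comp; cont.
have cF : continuous (fun y => h (chi N u (q y))) by exact: (continuous_comp_within ch cX Dq).
have iF y z : cdisk y -> cdisk z -> h (chi N u (q y)) = h (chi N u (q z)) -> y = z.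
  move=> dy dz e; have [_ ey] := gh _ (Dq y); have [_ ez] := gh _ (Dq z).
  have : q y = q z by rewrite -(chiK (q y) fr) -(chiK (q z) fr) -ey -ez e.
  rewrite /q !retrK// => -[] /addrI/(mulfI (lt0r_neq0 r20)) e1 /addrI/(mulfI (lt0r_neq0 r20)) e2.
  by case: y z e1 e2 {dy dz e ey ez} => [? ?] [? ?] /= -> ->.
have := invariance_of_domain0 cF iF.
have -> : h (chi N u (q 0)) = x.
  rewrite -[RHS]hg// -e0; congr (h (chi N u _)).
  rewrite /q retrK; last by rewrite /cdisk /sq2 /= expr0n /= addr0 ler01.
  by rewrite /= !mulr0 !addr0.
move=> /nbhs_ballP[e /= e00 he].
pose s := 1 + e / 2.
have [] := he ((s * x.1), (s * x.2)).
  have h1 := sqr_ge0 x.1; have h2 := sqr_ge0 x.2; rewrite /sq2 in x1.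
  split; rewrite -ball_normE /= /s ltr_norml; apply/andP; split; nra.
move=> y _ ey; have [+ _] := gh _ (Dq y); rewrite ey /cdisk /= sq2Z x1 mulr1 /s.
have : 0 < e / 2 by rewrite divr_gt0.
by move: (e / 2) => d; nra.
Qed.

End Disks.

(** * Winding numbers and the winding condition of the statement *)

Section LoopsOnSphere.
Variable R : realType.
Notation P2 := (R * R)%type.
Notation P3 := (R * R * R)%type.
Notation T := (tau R).

Lemma norm3_sqr (v : P3) : norm3 v ^+ 2 = dot3 v v.
Proof. by rewrite sqr_sqrtr// /dot3 -!expr2 !addr_ge0 ?sqr_ge0. Qed.

Lemma psi_neq N u (x y : P3) : frame N u -> S2 x -> S2 y -> x <> N -> y <> N -> x <> y ->
  psi N u x <> psi N u y.
Proof. by move=> fr hx hy xN yN xy /(psi_inj fr hx hy xN yN). Qed.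

Lemma stereo_sub_dot N (x z : P3) : S2 N -> S2 x -> S2 z -> x <> N -> z <> N -> x <> z ->
  0 < norm3 (sub3 (stereo N x) (stereo N z)).
Proof.
move=> hN hx hz xN zN xz; have [u fr] := frame_exists hN.
have [a1 a2 a3] := stereo_psi x fr; have [b1 b2 b3] := stereo_psi z fr.
rewrite sqrtr_gt0 (frame_dot _ _ fr) !dot3B a1 a2 a3 b1 b2 b3 subrr mulr0 addr0.
exact: (dot2_gt0 (sub2_neq0 (psi_neq fr hx hz xN zN xz))).
Qed.

Lemma scale3K c (v : P3) : c != 0 -> scale3 c (scale3 c^-1 v) = v.
Proof.
case: v => -[a b] d c0; rewrite /scale3 /= !mulrA divff// !mul1r//.
Qed.

(** With [n0] the length of [v 0] and [u0] its direction, [Zc] is [n0] times the coordinates of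
    [v t] in the frame [u0], [turn N u0], which is the frame of [winds_once_pos]. *)
Lemma winds_once_posE N z (gam : R -> P3) : S2 N -> S2 z -> z <> N ->
  (forall t, 0 <= t <= 1 -> [/\ S2 (gam t), gam t <> N & gam t <> z]) ->
  winds_once_pos N z gam <-> wnum N z gam T.
Proof.
move=> hN hz zN hg.
have i0 : 0 <= (0 : R) <= 1 by rewrite lexx ler01.
pose v t := sub3 (stereo N (gam t)) (stereo N z).
have vp t : 0 <= t <= 1 -> 0 < norm3 (v t).
  by move=> /hg[h1 h2 h3]; exact: stereo_sub_dot.
have [u1 fr1] := frame_exists hN.
have vN t : dot3 (v t) N = 0.
  have [_ _ a3] := stereo_psi (gam t) fr1; have [_ _ b3] := stereo_psi z fr1.
  by rewrite dot3B a3 b3 subrr.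
pose n0 := norm3 (v 0); have n00 : 0 < n0 := vp 0 i0.
pose u0 := scale3 n0^-1 (v 0).
have v0E : v 0 = scale3 n0 u0.
  by rewrite /u0 scale3K// lt0r_neq0.
have fr : frame N u0.
  split=> //; last by rewrite /u0 dot3Z vN mulr0.
  by rewrite /u0 dot3Z dot3Zr -norm3_sqr -/n0; field; rewrite lt0r_neq0.
have [t1 t2 t3] := frame_turn fr; case: (fr) => f1 f2 f3.
have tZ c x : turn N (scale3 c x) = scale3 c (turn N x).
  by rewrite /turn /cross3 /scale3 /=; congr ((_, _), _); ring.
have ZE t : Zc N z (gam 0) (gam t) = (n0 * dot3 u0 (v t), n0 * dot3 (turn N u0) (v t)).
  by rewrite /Zc -/(v t) -/(v 0) v0E tZ !dot3Z.
split=> [[th [cth hth tot]]|[th [cth hth tot]]].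
- exists (fun t => th (clamp t) - th (clamp 0)); split.
  + have cc : continuous (fun t => th (clamp t)).
      by apply: (continuous_comp_within cth (@continuous_clamp R)) => y; exact: clamp01.
    by move=> t; cont.
  + move=> t ht; rewrite !clampK// ZE.
    have E : v t = scale3 (norm3 (v t)) (add3 (scale3 (cos (th t - th 0)) u0)
      (scale3 (sin (th t - th 0)) (turn N u0))) := hth t ht.
    move: (norm3 (v t)) (vp t ht) E => m mp ->.
    exists (n0 * m); first by rewrite mulr_gt0.
    have dd x y y' (c s : R) : dot3 x (scale3 m (add3 (scale3 c y) (scale3 s y'))) =
      m * (c * dot3 x y + s * dot3 x y') by rewrite /dot3 /scale3 /add3 /=; ring.
    rewrite !dd t1 t3 f2 (dot3C u0 (turn N u0)) t3.
    by congr pair; ring.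
  + by rewrite !clampK ?lexx ?ler01//; rewrite subrr subr0.
- have a0 : ang (Zc N z (gam 0) (gam 0)) 0.
    rewrite ZE v0E (dot3Zr n0 u0 u0) (dot3Zr n0 u0 (turn N u0)) f2 t3; exists (n0 * n0); first by rewrite mulr_gt0.
    by rewrite cos0 sin0 !mulr1 !mulr0.
  have [k hk] := ang_uniq (hth 0 i0) a0; rewrite subr0 in hk.
  (* [th 0] is a multiple of [T], so subtracting it changes neither the cosine nor the sine. *)
  exists th; split=> //; first exact: continuous_subspaceT.
  move=> t ht; rewrite -/(v t) -/(v 0) -/n0 -/u0 -/(turn N u0).
  have [r r0] := hth t ht; rewrite ZE => -[e1 e2].
  have d1 : dot3 (v t) u0 = r / n0 * cos (th t).
    by rewrite dot3C mulrAC -e1 mulrAC divff ?mul1r// lt0r_neq0.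
  have d2 : dot3 (v t) (turn N u0) = r / n0 * sin (th t).
    by rewrite dot3C mulrAC -e2 mulrAC divff ?mul1r// lt0r_neq0.
  have rn : 0 < r / n0 by rewrite divr_gt0.
  have nE : norm3 (v t) = r / n0.
    rewrite /norm3 (frame_dot _ _ fr) d1 d2 vN mulr0 addr0.
    have -> : r / n0 * cos (th t) * (r / n0 * cos (th t)) + r / n0 * sin (th t) * (r / n0 * sin (th t))
      = (r / n0) ^+ 2 * (cos (th t) ^+ 2 + sin (th t) ^+ 2) by ring.
    by rewrite cos2sin2 mulr1 sqrtr_sqr gtr0_norm.
  have -> : th t - th 0 = th t + T * (- k)%:~R by rewrite hk mulrNz mulrN.
  rewrite (cosDTz _ (- k)).1 (cosDTz _ (- k)).2 nE.
  rewrite [LHS](frame_complete (v t) fr) d1 d2 vN.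
  by rewrite /scale3 /add3 /=; congr ((_, _), _); ring.
Qed.

End LoopsOnSphere.

(** * Boundary loops and angle functions of disks *)

Section DiskLoops.
Variable R : realType.
Notation P2 := (R * R)%type.
Notation P3 := (R * R * R)%type.
Notation T := (tau R).

Lemma sint_sub (D : set P3) : sint D `<=` D. Proof. by move=> x []. Qed.

Lemma param_sint D g h N y : D `<=` @S2 R -> dparam D g h -> S2 N -> ~ D N ->
  sint D y <-> D y /\ sq2 (h y) < 1.
Proof.
move=> DS dp hN nD; case: (dp) => cg Dg ch hg gh; split.
  move=> sy; have Dy := sint_sub sy; split => //; have [d e] := gh _ Dy.
  rewrite lt_neqAle d andbT; apply/eqP => s1.
  by apply: (param_circle_sbd DS dp hN nD s1); rewrite e.
by move=> [Dy s1]; have [d <-] := gh _ Dy; exact: param_open_sint hN nD s1.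
Qed.

Lemma sbdE (D : set P3) y : sbd D y <-> D y /\ ~ sint D y.
Proof.
split.
  move=> [Dy H]; split=> // -[_ [U [nU hU]]]; have [z [Uz Sz nD]] := H U nU.
  by apply: nD; exact: hU.
move=> [Dy H]; split=> // U nU; apply: contrapT => K; apply: H; split=> //.
exists U; split=> // z Uz Sz; apply: contrapT => nD; apply: K; by exists z.
Qed.

Lemma param_sbd D g h N y : D `<=` @S2 R -> dparam D g h -> S2 N -> ~ D N ->
  sbd D y <-> D y /\ sq2 (h y) = 1.
Proof.
move=> DS dp hN nD; case: (dp) => cg Dg ch hg gh; rewrite sbdE (param_sint _ DS dp hN nD).
split=> -[Dy H]; split=> //; last by move=> [_]; rewrite H ltxx.
have [d _] := gh _ Dy; apply/eqP; rewrite eq_le d leNgt; apply/negP => H1; exact: H.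
Qed.

Section ContinuousVectors.
Variables (S : topologicalType) (s : S).
Implicit Types x y N z : S -> P3.

Lemma continuous_sub3 x y :
  continuous_at s x -> continuous_at s y -> continuous_at s (fun t => sub3 (x t) (y t)).
Proof. by move=> cx cy; rewrite /sub3; cont. Qed.

Lemma continuous_scale3 (c : S -> R) x :
  continuous_at s c -> continuous_at s x -> continuous_at s (fun t => scale3 (c t) (x t)).
Proof. by move=> cx cy; rewrite /scale3; cont. Qed.

Lemma continuous_dot3 x y :
  continuous_at s x -> continuous_at s y -> continuous_at s (fun t => dot3 (x t) (y t)).
Proof. by move=> cx cy; rewrite /dot3; cont. Qed.

Lemma continuous_cross3 x y :
  continuous_at s x -> continuous_at s y -> continuous_at s (fun t => cross3 (x t) (y t)).
Proof. by move=> cx cy; rewrite /cross3; cont. Qed.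

Lemma continuous_stereo N x :
  continuous_at s x -> continuous_at s N -> S2 (N s) -> S2 (x s) -> x s <> N s ->
  continuous_at s (fun t => stereo (N t) (x t)).
Proof.
move=> cx cN hN hx ne; have d0 := dot3_neq1 hN hx ne.
have cd := continuous_dot3 cx cN.
apply: continuous_scale3; last by apply: continuous_sub3 => //; exact: continuous_scale3.
apply: continuous_at_inv => //; apply: continuous_at_add; first exact: continuous_at_cst.
exact: continuous_at_opp.
Qed.

Lemma continuous_Zc N z x0 x :
  continuous_at s N -> continuous_at s z -> continuous_at s x0 -> continuous_at s x ->
  S2 (N s) -> S2 (z s) -> S2 (x0 s) -> S2 (x s) ->
  z s <> N s -> x0 s <> N s -> x s <> N s ->
  continuous_at s (fun t => Zc (N t) (z t) (x0 t) (x t)).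
Proof.
move=> cN cz cx0 cx hN hz hx0 hx zN x0N xN.
have c1 := continuous_stereo cz cN hN hz zN.
have c2 := continuous_stereo cx0 cN hN hx0 x0N.
have c3 := continuous_stereo cx cN hN hx xN.
have c4 := continuous_sub3 c2 c1; have c5 := continuous_sub3 c3 c1.
apply: continuous_at_pair; first exact: continuous_dot3.
apply: continuous_dot3 => //; apply: continuous_cross3 => //.
by apply: continuous_scale3 => //; exact: continuous_at_cst.
Qed.

End ContinuousVectors.

Lemma Zc_neq0 N z x0 x : S2 N -> S2 z -> S2 x0 -> S2 x -> z <> N -> x0 <> N -> x <> N ->
  x0 <> z -> x <> z -> Zc N z x0 x <> 0 :> P2.
Proof.
move=> hN hz hx0 hx zN x0N xN x0z xz; have [u fr] := frame_exists hN.
have h1 := sub2_neq0 (psi_neq fr hx0 hz x0N zN x0z).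
have h2 := sub2_neq0 (psi_neq fr hx hz xN zN xz).
rewrite (ZcE _ _ _ fr); have [a ha] := ang_exists h1; have [b hb] := ang_exists h2.
exact: (ang_neq0 (ang_angle ha hb)).
Qed.

Lemma sint_path D g h N z z' : D `<=` @S2 R -> dparam D g h -> S2 N -> ~ D N ->
  sint D z -> sint D z' -> exists pth : R -> P3,
    [/\ continuous pth, pth 0 = z, pth 1 = z' & forall t, sint D (pth t)].
Proof.
move=> DS dp hN nD; rewrite !(param_sint _ DS dp hN nD) => -[Dz sz] [Dz' sz'].
case: (dp) => cg Dg ch hg gh.
pose a := h z; pose b := h z'.
have cc := @continuous_clamp R.
exists (fun t => g ((1 - clamp t) * a.1 + clamp t * b.1, (1 - clamp t) * a.2 + clamp t * b.2)).
split.
- by move=> t; cont.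
- rewrite clampK ?lexx ?ler01// subr0 !mul1r !mul0r !addr0 -surjective_pairing.
  by have [] := gh _ Dz.
- rewrite clampK ?lexx ?ler01// subrr !mul1r !mul0r !add0r -surjective_pairing.
  by have [] := gh _ Dz'.
- move=> t; apply: (param_open_sint DS dp hN nD).
  have c0 := clamp_ge0 t; have c1 := clamp_le1 t; move: sz sz'; rewrite -/a -/b /sq2 /=.
  move: (clamp t) c0 c1 => c c0 c1 ha hb.
  have : ((1 - c) * a.1 + c * b.1) ^+ 2 + ((1 - c) * a.2 + c * b.2) ^+ 2 =
    (1 - c) * (a.1 ^+ 2 + a.2 ^+ 2) + c * (b.1 ^+ 2 + b.2 ^+ 2)
     - c * (1 - c) * ((a.1 - b.1) ^+ 2 + (a.2 - b.2) ^+ 2) by ring.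
  have : 0 <= c * (1 - c) * ((a.1 - b.1) ^+ 2 + (a.2 - b.2) ^+ 2).
    by apply: mulr_ge0; [apply: mulr_ge0 => //; rewrite subr_ge0|rewrite addr_ge0 ?sqr_ge0].
  have [->|c0'] := eqVneq c 0; first by rewrite subr0 !mul1r !mul0r !addr0.
  have cp : 0 < c by rewrite lt_neqAle eq_sym c0'.
  have : 0 < c * (1 - (b.1 ^+ 2 + b.2 ^+ 2)) by rewrite mulr_gt0// subr_gt0.
  have : 0 <= (1 - c) * (1 - (a.1 ^+ 2 + a.2 ^+ 2)) by rewrite mulr_ge0// subr_ge0// ltW.
  lra.
Qed.

(** Pole and centre move simultaneously, off the loop and off each other, and [Zc] is then a
    homotopy of loops in the punctured plane. *)
Lemma wnum_move (N0 N1 z0 z1 : P3) (gam nn zz : R -> P3) w :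
  continuous gam -> gam 0 = gam 1 -> (forall t, S2 (gam t)) ->
  continuous nn -> nn 0 = N0 -> nn 1 = N1 -> continuous zz -> zz 0 = z0 -> zz 1 = z1 ->
  (forall l, [/\ S2 (nn l), S2 (zz l) & zz l <> nn l]) ->
  (forall t l, gam t <> nn l /\ gam t <> zz l) ->
  wnum N0 z0 gam w -> wnum N1 z1 gam w.
Proof.
move=> cg loop hg cn n0 n1 cz e0 e1 hl hgl; rewrite -n0 -n1 -e0 -e1.
apply: (@wind_homotopy _ (fun p => Zc (nn p.2) (zz p.2) (gam 0) (gam p.1))).
- move=> p; have [h1 h2 h3] := hl p.2; have [h4 h5] := hgl p.1 p.2; have [h6 h7] := hgl 0 p.2.
  have c1 : continuous_at p (fun q : P2 => q.1) by cont.
  have c2 : continuous_at p (fun q : P2 => q.2) by cont.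
  apply: (@continuous_Zc _ _ (fun p => nn p.2) (fun p => zz p.2) (fun _ => gam 0) (fun p => gam p.1)) => //.
  - exact: (continuous_at_compT cn c2).
  - exact: (continuous_at_compT cz c2).
  - exact: continuous_at_cst.
  - exact: (continuous_at_compT cg c1).
- move=> p _; have [h1 h2 h3] := hl p.2; have [h4 h5] := hgl p.1 p.2; have [h6 h7] := hgl 0 p.2.
  exact: Zc_neq0.
- by move=> l _ /=; rewrite loop.
Qed.

(** In the chart this is [disk_degree]; a rotation of the circle first brings the starting angle
    [th0] to 0. *)
Lemma disk_wnum D g h N th0 w : D `<=` @S2 R -> dparam D g h -> S2 N -> ~ D N ->
  wnum N (g 0) (fun t => g (expi (th0 + T * t))) w -> w = T \/ w = - T.
Proof.
move=> DS dp hN nD; have [u fr] := frame_exists hN; case: (dp) => cg Dg ch hg gh.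
have gN x : g x <> N by move=> e; apply: nD; rewrite -e.
have d0 : cdisk (0 : P2) by rewrite /cdisk /sq2 /= expr0n /= addr0 ler01.
have de t : cdisk (expi t : P2) by rewrite /cdisk /= sq2_expi.
have ne t : psi N u (g (expi t)) <> psi N u (g 0).
  move=> e; apply: (@expi_neq0 R t); exact: (chart_param_inj DS dp fr nD (de t) d0 e).
have cG := continuous_chart_param DS dp fr hN nD.
rewrite (wnumE _ fr)//.
pose H (p : P2) := sub2 (psi N u (g (expi ((1 - p.2) * th0 + T * p.1)))) (psi N u (g 0)).
have cH : continuous H.
  have cGe : continuous (fun y => psi N u (g (expi y))).
    by have ce := @continuous_expi R; move=> y; apply: (@continuous_at_comp _ _ _ _ (fun x => psi N u (g x)) (@expi R)); [exact: cG|exact: ce].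
  move: cGe; rewrite /H; move: (fun y => psi N u (g (expi y))) => F cF p; rewrite /sub2.
  have c1 : continuous_at p (fun x : P2 => psi N u (g (expi ((1 - x.2) * th0 + T * x.1)))).
    apply: (@continuous_at_comp _ _ _ _ (fun x => psi N u (g x)) (fun x : P2 => expi ((1 - x.2) * th0 + T * x.1))); first exact: cG.
    by have ce := @continuous_expi R; cont.
  by cont.
move=> w0.
have {}w0 : wind (fun t => H (t, 0)) w.
  by apply: wind_ext w0 => t _; rewrite /H /= subr0 mul1r.
have {}w0 : wind (fun t => H (t, 1)) w.
  apply: (wind_homotopy cH) w0; first by move=> p _; exact: sub2_neq0.
  by move=> l _; rewrite /H /= mulr0 mulr1 addr0 expiDT.
apply: (@disk_degree _ (fun x => psi N u (g x)) (h \o chi N u)) => //.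
- apply: (@within_comp _ _ _ _ D); first exact/continuous_subspaceT/continuous_chi.
    by [].
  by move=> _ [x dx <-]; rewrite psiK//; exact: DS.
- by move=> x dx /=; rewrite psiK ?hg//; exact: DS.
- by apply: wind_ext w0 => t _; rewrite /H /= subrr mul0r add0r.
Qed.

(** A path inside such a disk changes its angle about [z] by the difference of [ta] at its ends
    ([region_angle_change]). This evaluates winding numbers without knowing the path. *)
Lemma region_angle D g h N z u : D `<=` @S2 R -> dparam D g h -> S2 N -> S2 z -> frame N u ->
  ~ D N -> ~ D z -> z <> N ->
  exists2 ta : P3 -> R, {within D, continuous ta} &
    forall x, D x -> ang (sub2 (psi N u x) (psi N u z)) (ta x).
Proof.
move=> DS dp hN hz fr nN nz zN; case: (dp) => cg Dg ch hg gh.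
have cG := continuous_chart_param DS dp fr hN nN.
have [] := @lift_disk _ (fun x => sub2 (psi N u (g x)) (psi N u z)).
- by move=> x; have c := cG x; rewrite /sub2; cont.
- move=> x dx; apply/sub2_neq0/(psi_neq fr) => //; first exact: DS.
    by move=> e; apply: nN; rewrite -e.
  by move=> e; apply: nz; rewrite -e.
move=> th cth hth; exists (th \o h).
  apply: (@within_comp _ _ _ _ setT) => //; exact: continuous_subspaceT.
by move=> x Dx; have [d e] := gh _ Dx; have := hth _ d; rewrite e.
Qed.

Lemma region_angle_change (D : set P3) N z u (ta : P3 -> R) (gam : R -> P3) (th : R -> R) a b :
  {within D, continuous ta} ->
  (forall x, D x -> ang (sub2 (psi N u x) (psi N u z)) (ta x)) ->
  a <= b -> continuous gam -> (forall t, a <= t <= b -> D (gam t)) -> continuous th ->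
  (forall t, a <= t <= b -> ang (sub2 (psi N u (gam t)) (psi N u z)) (th t)) ->
  th b - th a = ta (gam b) - ta (gam a).
Proof.
move=> cta hta ab cg Dg cth hth.
pose c t := Num.max a (Num.min t b).
have cab t : a <= c t <= b by rewrite /c le_max lexx /= ge_max ab ge_min lexx orbT.
have cK t : a <= t <= b -> c t = t.
  by move=> /andP[h1 h2]; rewrite /c (min_idPl h2) (max_idPr h1).
have [ha hb] : a <= a <= b /\ a <= b <= b by rewrite !lexx ab.
have := @lift_unique _ (fun t => sub2 (psi N u (gam t)) (psi N u z)) a b th (fun t => ta (gam (c t))).
rewrite !cK//; apply=> //.
  apply: (continuous_comp_within cta) => [|t]; last exact: Dg.
  by move=> t; rewrite /c; cont.
by move=> t ht; rewrite cK//; apply/hta/Dg.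
Qed.

End DiskLoops.

(** * Disks swept by arcs *)

Section CircleMap.
Variable R : realType.
Notation P2 := (R * R)%type.
Notation P3 := (R * R * R)%type.
Notation T := (tau R).

Definition arcim (phi : R -> P3) (a b : R) : set P3 := phi @` [set t | a <= t <= b].

Definition catherine_line (phi : R -> P3) :=
  [/\ continuous phi, (forall t, phi (t + T) = phi t), (forall y, S2 y <-> exists t, phi t = y) &
    forall a b, a < b -> b < a + T ->
      [/\ is_closed_disk (arcim phi a b), sbd (arcim phi a b) (phi a) & sbd (arcim phi a b) (phi b)]].

Lemma two_closed (gam : R -> P3) (E E' : set P3) s t : s <= t -> continuous gam ->
  closed E -> closed E' -> (forall x, s <= x <= t -> E (gam x) \/ E' (gam x)) ->
  (forall x, s <= x <= t -> ~ (E (gam x) /\ E' (gam x))) -> E (gam s) <-> E (gam t).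
Proof.
move=> st cg cE cE' cov dis.
have key F F' : closed F -> closed F' -> (forall x, s <= x <= t -> F (gam x) \/ F' (gam x)) ->
    (forall x, s <= x <= t -> ~ (F (gam x) /\ F' (gam x))) -> F (gam s) -> F (gam t).
  move=> cF cF' covF disF Fs.
  have := @segment_connected R s t; set A := [set` _].
  have AE x : A x <-> s <= x <= t by rewrite /A /= in_itv.
  move=> /(_ (A `&` gam @^-1` F)) H.
  suff : (A `&` gam @^-1` F) t by case.
  rewrite H; first by apply/AE; rewrite st lexx.
  - by exists s; split=> //; apply/AE; rewrite st lexx.
  - exists (~` (gam @^-1` F')); first by rewrite openC; apply: preimage_closed => // x _; exact: cg.
    apply/seteqP; split=> x [Ax Fx]; split=> //.
      by move=> F'x; apply: (disF x) => //; exact/AE.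
    by have [|//|//] := covF x; exact/AE.
  - by exists (gam @^-1` F) => //; apply: preimage_closed => // x _; exact: cg.
split; first exact: (key E E').
move=> Et; have [|//|E's] := cov s; first by rewrite lexx.
case: (dis t); rewrite ?lexx ?st//; split=> //.
apply: (key E' E) => // x hx; first by have [] := cov x hx; [right|left].
by move=> [h1 h2]; apply: (dis x hx).
Qed.

Lemma expi_surj_from (al : R) (v : P2) : sq2 v = 1 -> exists2 b, al <= b < al + T & v = expi b.
Proof.
move=> /expi_surj[t ->]; have T0 := tau_gt0 R.
have := floor_itv ((t - al) / T); set k := Num.floor _ => /andP[].
rewrite ler_pdivlMr// ltr_pdivrMr// => h1 h2.
exists (t + T * (- k)%:~R); last by rewrite expiDTz.
by rewrite mulrNz mulrN; move: h2; rewrite intrD mulrDl mul1r => h2; apply/andP; split; lra.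
Qed.

Section Map.
Variable phi : R -> P3.
Hypothesis Hphi : catherine_line phi.
Notation D := (arcim phi).

Lemma phi_continuous : continuous phi. Proof. by case: Hphi. Qed.
Lemma phiT t : phi (t + T) = phi t. Proof. by case: Hphi => _ ->. Qed.
Lemma phi_S2 t : S2 (phi t). Proof. by case: Hphi => _ _ h _; apply/h; exists t. Qed.

Lemma phiTz t (k : int) : phi (t + T * k%:~R) = phi t.
Proof.
have hn (n : nat) s : phi (s + T * n%:R) = phi s.
  elim: n s => [|n IH] s; first by rewrite mulr0 addr0.
  have -> : n.+1%:R = n%:R + 1 :> R by rewrite -natr1.
  by rewrite mulrDr mulr1 addrA phiT IH.
case: k => n; first by rewrite -pmulrn.
by rewrite NegzE mulrNz -pmulrn -(hn n.+1 (t + _)) -addrA -mulrDr addNr mulr0 addr0.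
Qed.

Lemma phi_surj_from al y : S2 y -> exists2 t, al <= t < al + T & phi t = y.
Proof.
move=> Sy; have [t <-] : exists t, phi t = y by case: Hphi => _ _ h _; apply/h.
have T0 := tau_gt0 R.
have := floor_itv ((t - al) / T); set k := Num.floor _ => /andP[].
rewrite ler_pdivlMr// ltr_pdivrMr// => h1 h2.
exists (t + T * (- k)%:~R); last exact: phiTz.
by rewrite mulrNz mulrN; move: h2; rewrite intrD mulrDl mul1r => h2; apply/andP; split; lra.
Qed.

Lemma arcimT a b : D (a + T) (b + T) = D a b.
Proof.
apply/seteqP; split=> _ [t /= /andP[h1 h2] <-].
  by exists (t - T); [apply/andP; split; lra|rewrite -[in RHS](subrK T t) phiT].
by exists (t + T); [apply/andP; split; lra|rewrite phiT].
Qed.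

Lemma arcim_sub a b c d : c <= a -> b <= d -> D a b `<=` D c d.
Proof. by move=> ca bd _ [t /= /andP[h1 h2] <-]; exists t => //=; apply/andP; split; lra. Qed.

Lemma arcim_mem a b t : a <= t -> t <= b -> D a b (phi t).
Proof. by move=> h1 h2; exists t => //=; rewrite h1 h2. Qed.

Lemma arcim_split a b c y : D a c y -> D a b y \/ D b c y.
Proof.
move=> [t /= /andP[h1 h2] <-]; have [h|/ltW h] := leP t b; first by left; exists t => //=; rewrite h1 h.
by right; exists t => //=; rewrite h2 h.
Qed.

Lemma arcim_S2 a b : D a b `<=` @S2 R. Proof. by move=> _ [t _ <-]; exact: phi_S2. Qed.

Lemma arcim_cover a b y : S2 y -> D a b y \/ D b (a + T) y.
Proof.
move=> /(phi_surj_from a)[t /andP[h1 h2] <-]; apply: arcim_split.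
by apply: arcim_mem => //; exact: ltW.
Qed.

Lemma arcim_disk a b : a < b -> b < a + T ->
  exists g h N, [/\ dparam (D a b) g h, S2 N & ~ D a b N].
Proof.
case: Hphi => _ _ _ H ab ba; have [h1 [h2 h2'] h3] := H a b ab ba.
have [_ [g [h dp]]] := closed_disk_param h1.
by have [N [_ SN nD]] := h2' setT filterT; exists g, h, N.
Qed.

Lemma arcim_closed a b : a < b -> b < a + T -> closed (D a b).
Proof. by move=> ab ba; have [g [h [N [dp _ _]]]] := arcim_disk ab ba; exact: dparam_closed dp. Qed.

Lemma sint_mono (A B : set P3) : A `<=` B -> sint A `<=` sint B.
Proof.
move=> AB y [Ay [U [nU hU]]]; split; first exact: AB.
by exists U; split=> // z Uz Sz; apply/AB/hU.
Qed.

(** If an interior point of [D a b] were [phi s] with [b <= s <= a + T], it would be interior to the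
    larger [D a s] as well, of which [phi s] is a boundary point by hypothesis. The ends [s = b] and
    [s = a + T] are boundary points of [D a b] itself. *)
Lemma sint_arcim a b y : a < b -> b < a + T -> sint (D a b) y <-> S2 y /\ ~ D b (a + T) y.
Proof.
move=> ab ba; split.
  move=> sy; split; first exact/arcim_S2/(sint_sub sy).
  move=> [s /= /andP[bs sa] e].
  have H := let: And4 _ _ _ H := Hphi in H.
  have [sb|sb] := eqVneq s b.
    have [_ _ /sbdE[_]] := H a b ab ba; apply; by rewrite sb in e; rewrite e.
  have [sT|sT] := eqVneq s (a + T).
    have [_ /sbdE[_ K] _] := H a b ab ba; apply: K; by rewrite sT phiT in e; rewrite e.
  have bs' : b < s by rewrite lt_neqAle eq_sym sb.
  have sa' : s < a + T by rewrite lt_neqAle sT.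
  have [_ _ /sbdE[_]] := H a s (lt_trans ab bs') sa'; apply; rewrite e.
  by apply: sint_mono sy; exact: arcim_sub.
move=> [Sy nD]; have [Dy|//] := arcim_cover a b Sy.
split=> //; exists (~` D b (a + T)); split.
  apply: open_nbhs_nbhs; split=> //; rewrite openC; apply: arcim_closed => //.
  by rewrite ltrD2r.
by move=> z nz Sz; have [] := arcim_cover a b Sz.
Qed.

Lemma sbd_arcim a b y : a < b -> b < a + T -> sbd (D a b) y <-> D a b y /\ D b (a + T) y.
Proof.
move=> ab ba; rewrite sbdE sint_arcim//; split=> -[Dy H]; split=> //.
  by apply: contrapT => K; apply: H; split=> //; exact: arcim_S2 Dy.
by move=> [_]; exact.
Qed.

Lemma sint_arcim_neq0 a b : a < b -> b < a + T -> exists z, sint (D a b) z.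
Proof.
move=> ab ba; have [g [h [N [dp SN nD]]]] := arcim_disk ab ba.
exists (g 0); apply: (param_open_sint (@arcim_S2 a b) dp SN nD).
by rewrite /sq2 /= expr0n /= addr0 ltr01.
Qed.

Lemma sint_arcim_path a b z z' : a < b -> b < a + T -> sint (D a b) z -> sint (D a b) z' ->
  exists pth : R -> P3, [/\ continuous pth, pth 0 = z, pth 1 = z' & forall t, sint (D a b) (pth t)].
Proof.
move=> ab ba; have [g [h [N [dp SN nD]]]] := arcim_disk ab ba.
exact: (sint_path (@arcim_S2 a b) dp SN nD).
Qed.

(** The image of a straight chord of the unit disk, whose open part is in the open disk by strict
    convexity. *)
Lemma arcim_chord a b y y' : a < b -> b < a + T -> sbd (D a b) y -> sbd (D a b) y' -> y <> y' ->
  exists pth : R -> P3, [/\ continuous pth, pth 0 = y, pth 1 = y',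
    forall t, D a b (pth t) & forall t, 0 < t < 1 -> sint (D a b) (pth t)].
Proof.
move=> ab ba; have [g [h [N [dp SN nD]]]] := arcim_disk ab ba.
have DS := @arcim_S2 a b; rewrite !(param_sbd _ DS dp SN nD) => -[Dy s1] [Dy' s1'] ne.
case: (dp) => cg Dg ch hg gh; set v := h y in s1; set w := h y' in s1'.
have vw : v <> w.
  by move=> e; apply: ne; have [_ <-] := gh _ Dy; have [_ <-] := gh _ Dy'; rewrite -/v e.
have cc := @continuous_clamp R.
exists (fun t => g ((1 - clamp t) * v.1 + clamp t * w.1, (1 - clamp t) * v.2 + clamp t * w.2)).
split=> //.
- by move=> t; cont.
- rewrite clampK ?lexx ?ler01// subr0 !mul1r !mul0r !addr0 -surjective_pairing.
  by have [] := gh _ Dy.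
- rewrite clampK ?lexx ?ler01// subrr !mul1r !mul0r !add0r -surjective_pairing.
  by have [] := gh _ Dy'.
move=> t /andP[t0 t1]; apply: (param_open_sint DS dp SN nD); rewrite clampK ?ltW ?t0//=.
have E : sq2 ((1 - t) * v.1 + t * w.1, (1 - t) * v.2 + t * w.2) =
    (1 - t) * sq2 v + t * sq2 w - t * (1 - t) * sq2 (sub2 v w) by rewrite /sq2 /=; ring.
rewrite E s1 s1'.
have : 0 < t * (1 - t) * sq2 (sub2 v w).
  rewrite !mulr_gt0 ?subr_gt0// lt_neqAle sq2_ge0 andbT; apply/eqP => /esym/sq2_eq0.
  exact: sub2_neq0.
lra.
Qed.

(* [e] and [e'] cannot both join opposite sides of the disk [D a c]: chords of
   [e] and [e'] with linked endpoints would be disjoint. *)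
Lemma no_linked_disks a c g h (i j i' j' : R) (al s be t : R) :
  a < c -> c < a + T -> dparam (D a c) g h ->
  i < j -> j < i + T -> i' < j' -> j' < i' + T ->
  D i j `<=` D a c -> D i' j' `<=` D a c ->
  (forall y, sint (D i j) y -> ~ D i' j' y) -> (forall y, sint (D i' j') y -> ~ D i j y) ->
  al < s -> s < be -> be < t -> t < al + T ->
  sbd (D i' j') (g (expi al)) -> sbd (D i' j') (g (expi be)) ->
  sbd (D i j) (g (expi s)) -> sbd (D i j) (g (expi t)) -> False.
Proof.
move=> ac ca dp ij ji ij' ji' sub sub' dis dis' als sbe bet tal sA sB sy sy'.
case: (dp) => cg Dg ch hg gh.
have ce x : cdisk (expi x : P2) by rewrite /cdisk /= sq2_expi.
have inj x y : x < y -> y < x + T -> g (expi x) <> g (expi y).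
  move=> xy yx e; have : ang (sub2 (expi x) (expi y)) ((x + y) / 2 - pi / 2).
    by apply: ang_chord; rewrite xy yx.
  by move/ang_neq0; apply; rewrite -(hg (expi x))// e hg// /sub2 !subrr.
have [pa [cpa pa0 pa1 pai pas]] := arcim_chord ij' ji' sA sB (inj al be (lt_trans als sbe) (lt_trans bet tal)).
have st : t < s + T by rewrite (lt_trans tal)// ltrD2r.
have [pb [cpb pb0 pb1 pbi pbs]] := arcim_chord ij ji sy sy' (inj s t (lt_trans sbe bet) st).
have [] := @crossing_paths _ (fun x => h (pa x)) (fun x => h (pb x)) al s be t.
- by apply: (continuous_comp_within ch) => // x; exact/sub'.
- by apply: (continuous_comp_within ch) => // x; exact/sub.
- by move=> x _; have [] := gh _ (sub' _ (pai x)).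
- by move=> x _; have [] := gh _ (sub _ (pbi x)).
- by rewrite pa0 hg.
- by rewrite pb0 hg.
- by rewrite pa1 hg.
- by rewrite pb1 hg.
- by [].
- by [].
- by [].
- by [].
move=> x [y [hx hy e]].
have {}e : pa x = pb y.
  by have [_ <-] := gh _ (sub' _ (pai x)); have [_ <-] := gh _ (sub _ (pbi y)); rewrite e.
have ends (z : R) : 0 <= z <= 1 -> [\/ z = 0, z = 1 | 0 < z < 1].
  move=> /andP[z0 z1]; have [->|z0'] := eqVneq z 0; first by constructor 1.
  have [->|z1'] := eqVneq z 1; first by constructor 2.
  by constructor 3; rewrite !lt_neqAle eq_sym z0' z0 z1' z1.
case: (ends x hx) => [x0|x1|xi]; last first.
- by apply: (dis' _ (pas _ xi)); rewrite e.
- case: (ends y hy) => [y0|y1|yi]; last by apply: (dis _ (pbs _ yi)); rewrite -e.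
    by move: e; rewrite x1 y0 pa1 pb0 => /esym; apply: inj => //; lra.
  by move: e; rewrite x1 y1 pa1 pb1; apply: inj => //; lra.
- case: (ends y hy) => [y0|y1|yi]; last by apply: (dis _ (pbs _ yi)); rewrite -e.
    by move: e; rewrite x0 y0 pa0 pb0; apply: inj => //; lra.
  by move: e; rewrite x0 y1 pa0 pb1; apply: inj => //; lra.
Qed.

(** [D a b] and [D b c] have disjoint interiors and both have [phi a] and [phi b] on their boundary.
    If one of them reached both open arcs between these points, a chord of it would have to cross a
    chord of the other from [phi a] to [phi b], against [no_linked_disks]. *)
Lemma arcs_split a b c g h al be : a < b -> b < c -> c < a + T ->
  phi a = phi c -> D c (a + T) (phi b) -> dparam (D a c) g h ->
  al < be -> be < al + T -> g (expi al) = phi a -> g (expi be) = phi b ->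
  let P1 t := D a b (g (expi t)) in let P2 t := D b c (g (expi t)) in
  ((forall t, al < t < be -> P1 t /\ ~ P2 t) /\ (forall t, be < t < al + T -> P2 t /\ ~ P1 t)) \/
  ((forall t, al < t < be -> P2 t /\ ~ P1 t) /\ (forall t, be < t < al + T -> P1 t /\ ~ P2 t)).
Proof.
move=> ab bc ca eA DB dp albe beal gA gB P1 P2.
have ac := lt_trans ab bc; have ba : b < a + T := lt_trans bc ca.
have cb : c < b + T by rewrite (lt_trans ca)// ltrD2r.
have H := let: And4 _ _ _ H := Hphi in H.
case: (dp) => cg Dg ch hg gh.
have [_ [_ [N [_ SN nD]]]] := arcim_disk ac ca.
have sb t : sbd (D a c) (g (expi t)).
  by rewrite (param_sbd _ (@arcim_S2 a c) dp SN nD) hg ?/cdisk /= ?sq2_expi.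
have P12 t : P1 t \/ P2 t by apply: arcim_split; exact: Dg.
have sb1 t : P1 t -> sbd (D a b) (g (expi t)).
  move=> h1; apply/sbdE; split=> // h2.
  have /sbdE[_] := sb t; apply; apply: sint_mono h2; apply: arcim_sub => //; exact: ltW.
have sb2 t : P2 t -> sbd (D b c) (g (expi t)).
  move=> h1; apply/sbdE; split=> // h2.
  have /sbdE[_] := sb t; apply; apply: sint_mono h2; apply: arcim_sub => //; exact: ltW.
have d1 y : sint (D a b) y -> ~ D b c y.
  rewrite sint_arcim// => -[_ K] K'; apply: K; apply: arcim_sub K' => //; exact: ltW.
have d2 y : sint (D b c) y -> ~ D a b y.
  rewrite sint_arcim// => -[_ K] K'; apply: K; rewrite -arcimT in K'.
  by apply: arcim_sub K' => //; exact: ltW.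
have [_ s1a s1b] := H a b ab ba; have [_ s2b s2c] := H b c bc cb.
have s12 : D a b `<=` D a c by apply: arcim_sub => //; exact: ltW.
have s22 : D b c `<=` D a c by apply: arcim_sub => //; exact: ltW.
have x1 s t : al < s < be -> be < t < al + T -> P1 s -> P1 t -> False.
  move=> /andP[h1 h2] /andP[h3 h4] ps pt.
  apply: (@no_linked_disks a c g h a b b c al s be t) => //.
  - by rewrite gA eA.
  - by rewrite gB.
  - exact: sb1.
  - exact: sb1.
have x2 s t : al < s < be -> be < t < al + T -> P2 s -> P2 t -> False.
  move=> /andP[h1 h2] /andP[h3 h4] ps pt.
  apply: (@no_linked_disks a c g h b c a b al s be t) => //.
  - by rewrite gA.
  - by rewrite gB.
  - exact: sb2.
  - exact: sb2.
have m1 : al < (al + be) / 2 < be by apply/andP; split; lra.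
have m2 : be < (be + (al + T)) / 2 < al + T by apply/andP; split; lra.
have [p1|p2] := P12 ((al + be) / 2).
  left; have q t : be < t < al + T -> P2 t /\ ~ P1 t.
    move=> ht; have n1 : ~ P1 t by move=> pt; exact: (x1 _ t m1 ht).
    by have [] := P12 t.
  split=> // t ht; have [p _] := q _ m2.
  have n2 : ~ P2 t by move=> pt; exact: (x2 t _ ht m2).
  by have [] := P12 t.
right; have q t : be < t < al + T -> P1 t /\ ~ P2 t.
  move=> ht; have n1 : ~ P2 t by move=> pt; exact: (x2 _ t m1 ht).
  by have [] := P12 t.
split=> // t ht; have [p _] := q _ m2.
have n2 : ~ P1 t by move=> pt; exact: (x1 t _ ht m2).
by have [] := P12 t.
Qed.

End Map.
End CircleMap.

(** * Linked pairs have opposite signs *)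

Section LinkedPairs.
Variable R : realType.
Notation P2 := (R * R)%type.
Notation P3 := (R * R * R)%type.
Notation T := (tau R).
Variable phi : R -> P3.
Hypothesis Hphi : catherine_line phi.
Notation D := (arcim phi).

Definition linked (a b c d : R) :=
  [/\ a < b, b < c, c < d, d < a + T & [/\ phi a = phi c, phi b = phi d & phi a <> phi b]].

Lemma linked_rot a b c d : linked a b c d -> linked b c d (a + T).
Proof.
move=> [ab bc cd da [e1 e2 ne]]; split=> //; first by rewrite ltrD2r.
by split=> //; [rewrite phiT// e1|rewrite -e1; exact: nesym].
Qed.

Lemma boundary_param a c g h (A B : P3) : a < c -> c < a + T -> dparam (D a c) g h ->
  sbd (D a c) A -> sbd (D a c) B -> A <> B ->
  exists al be, [/\ al < be, be < al + T, g (expi al) = A & g (expi be) = B].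
Proof.
move=> ac ca dp; have [_ [_ [N [_ SN nD]]]] := arcim_disk Hphi ac ca.
have DS := @arcim_S2 _ _ Hphi a c; rewrite !(param_sbd _ DS dp SN nD) => -[DA sA] [DB sB] ne.
case: (dp) => cg Dg ch hg gh.
have [al hal] := expi_surj sA; have [be /andP[b1 b2] hbe] := expi_surj_from al sB.
have [_ eA] := gh _ DA; have [_ eB] := gh _ DB.
exists al, be; rewrite -hal -hbe eA eB; split=> //.
rewrite lt_neqAle b1 andbT; apply/eqP => e; apply: ne.
by rewrite -eA -eB hal hbe e.
Qed.

Lemma boundary_cover a c g h al y : a < c -> c < a + T -> dparam (D a c) g h ->
  sbd (D a c) y -> exists2 t, al <= t < al + T & y = g (expi t).
Proof.
move=> ac ca dp; have [_ [_ [N [_ SN nD]]]] := arcim_disk Hphi ac ca.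
have DS := @arcim_S2 _ _ Hphi a c; rewrite (param_sbd _ DS dp SN nD) => -[Dy sy].
case: (dp) => cg Dg ch hg gh; have [_ ey] := gh _ Dy.
by have [t ht e] := expi_surj_from al sy; exists t => //; rewrite -e ey.
Qed.

Lemma boundary_point a c g h t : a < c -> c < a + T -> dparam (D a c) g h ->
  sbd (D a c) (g (expi t)).
Proof.
move=> ac ca dp; have [_ [_ [N [_ SN nD]]]] := arcim_disk Hphi ac ca.
have DS := @arcim_S2 _ _ Hphi a c; case: (dp) => cg Dg ch hg gh.
by rewrite (param_sbd _ DS dp SN nD) hg ?/cdisk /= ?sq2_expi.
Qed.

Lemma boundary_inj a c g h s t : dparam (D a c) g h -> s < t -> t < s + T ->
  g (expi s) <> g (expi t).
Proof.
move=> [cg Dg ch hg gh] st ts e.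
have ce x : cdisk (expi x : P2) by rewrite /cdisk /= sq2_expi.
have : ang (sub2 (expi s) (expi t)) ((s + t) / 2 - pi / 2) by apply: ang_chord; rewrite st ts.
by move/ang_neq0; apply; rewrite -(hg (expi s))// e hg// /sub2 !subrr.
Qed.

Lemma boundary_arcs a c g h (A B : P3) : a < c -> c < a + T -> dparam (D a c) g h ->
  sbd (D a c) A -> sbd (D a c) B -> A <> B ->
  let good t := [/\ sbd (D a c) (g (expi t)), g (expi t) <> A & g (expi t) <> B] in
  exists al be, [/\ al < be, be < al + T, g (expi al) = A, g (expi be) = B &
    [/\ forall t, al < t < be -> good t, forall t, be < t < al + T -> good t &
      forall z, sbd (D a c) z -> z <> A -> z <> B ->
        exists2 t, al < t < be \/ be < t < al + T & z = g (expi t)]].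
Proof.
move=> ac ca dp sA sB ne good.
have [al [be [ab' ba' gA gB]]] := boundary_param ac ca dp sA sB ne.
have T0 := tau_gt0 R.
have bp t := boundary_point t ac ca dp.
have nA t : al < t -> t < al + T -> g (expi t) <> A.
  by move=> h1 h2; rewrite -gA; apply: nesym; apply: (boundary_inj dp).
exists al, be; split=> //; split.
- move=> t /andP[h1 h2]; split=> //; first by apply: nA => //; lra.
  by rewrite -gB; apply: (boundary_inj dp) => //; lra.
- move=> t /andP[h1 h2]; split=> //; first by apply: nA => //; lra.
  by rewrite -gB; apply: nesym; apply: (boundary_inj dp) => //; lra.
move=> z sz zA zB; have [t /andP[h1 h2] zt] := boundary_cover al ac ca dp sz.
exists t => //; have tal : t != al by apply: contra_notN zA => /eqP e; rewrite zt e gA.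
have tbe : t != be by apply: contra_notN zB => /eqP e; rewrite zt e gB.
have h1' : al < t by rewrite lt_neqAle eq_sym tal.
by have [k|k|k] := ltgtP t be; [left; apply/andP|right; apply/andP|rewrite k eqxx in tbe].
Qed.

Lemma linked_sbd a b c d : linked a b c d ->
  [/\ a < c, c < a + T, D c (a + T) (phi b), sbd (D a c) (phi a) & sbd (D a c) (phi b)].
Proof.
move=> [ab bc cd da [e1 e2 ne]].
have ac := lt_trans ab bc; have ca := lt_trans cd da.
have DB : D c (a + T) (phi b) by rewrite e2; apply: arcim_mem; exact: ltW.
split=> //; apply/(sbd_arcim Hphi) => //; split=> //.
- by apply: arcim_mem; rewrite ?lexx ?ltW.
- by rewrite -(phiT Hphi); apply: arcim_mem; rewrite ?lexx ?ltW.
- by apply: arcim_mem; exact: ltW.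
Qed.

Lemma linked_split a b c d : linked a b c d ->
  [/\ forall y, sbd (D a c) y -> y <> phi a -> y <> phi b ->
        (D a b y /\ ~ D b c y) \/ (D b c y /\ ~ D a b y),
      exists2 y, sbd (D a c) y & [/\ y <> phi a, y <> phi b & D a b y] &
      exists2 y, sbd (D a c) y & [/\ y <> phi a, y <> phi b & D b c y]].
Proof.
move=> L; have [ab bc cd da [e1 e2 ne]] := L; have [ac ca DB sA sB] := linked_sbd L.
have [g [h [N [dp SN nD]]]] := arcim_disk Hphi ac ca.
have [al [be [ab' ba' gA gB [gd1 gd2 cov]]]] := boundary_arcs ac ca dp sA sB ne.
have m1 : al < (al + be) / 2 < be by apply/andP; split; lra.
have m2 : be < (be + (al + T)) / 2 < al + T by apply/andP; split; lra.
have [q1 q2 q3] := gd1 _ m1; have [r1 r2 r3] := gd2 _ m2.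
have [[H1 H2]|[H1 H2]] := arcs_split Hphi ab bc ca e1 DB dp ab' ba' gA gB;
  have [p1 p1'] := H1 _ m1; have [p2 p2'] := H2 _ m2; split.
- move=> y sy yA yB; have [t [ht|ht] ->] := cov y sy yA yB; [left; exact: H1|right; exact: H2].
- by exists (g (expi ((al + be) / 2))).
- by exists (g (expi ((be + (al + T)) / 2))).
- move=> y sy yA yB; have [t [ht|ht] ->] := cov y sy yA yB; [right; exact: H1|left; exact: H2].
- by exists (g (expi ((be + (al + T)) / 2))).
- by exists (g (expi ((al + be) / 2))).
Qed.

Lemma sbd_compl a c y : a < c -> c < a + T -> sbd (D a c) y <-> sbd (D c (a + T)) y.
Proof.
move=> ac ca; rewrite !(sbd_arcim Hphi)//; last by rewrite ltrD2r.
by rewrite (arcimT Hphi); split=> -[].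
Qed.

(** Variant of [two_closed] for open intervals: the ends of a boundary arc lie in both closed
    sets. *)
Lemma itv_open_sub (gam : R -> P3) (E E' : set P3) u v : continuous gam -> closed E -> closed E' ->
  (forall x, u < x < v -> E (gam x) \/ E' (gam x)) ->
  (forall x, u < x < v -> ~ (E (gam x) /\ E' (gam x))) ->
  (forall x, u < x < v -> E (gam x)) \/ (forall x, u < x < v -> E' (gam x)).
Proof.
move=> cg cE cE' cov dis.
have [uv|uv] := ltP u v; last by left => x /andP[h1 h2]; have := lt_le_trans (lt_trans h1 h2) uv; rewrite ltxx.
pose m := (u + v) / 2; have hm : u < m < v by rewrite /m; apply/andP; split; lra.
have tc F F' : closed F -> closed F' -> (forall x, u < x < v -> F (gam x) \/ F' (gam x)) ->
  (forall x, u < x < v -> ~ (F (gam x) /\ F' (gam x))) -> F (gam m) -> forall x, u < x < v -> F (gam x).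
  move=> cF cF' covF disF Fm x /andP[h1 h2]; case/andP: hm => h3 h4.
  have sub y p q : u < p -> q < v -> p <= y <= q -> u < y < v.
    by move=> k1 k2 /andP[k3 k4]; rewrite (lt_le_trans k1)//= (le_lt_trans k4).
  have [h|/ltW h] := leP x m.
    have [_ K] := two_closed h cg cF cF' (fun y hy => covF y (sub y _ _ h1 h4 hy))
      (fun y hy => disF y (sub y _ _ h1 h4 hy)).
    exact: K.
  have [K _] := two_closed h cg cF cF' (fun y hy => covF y (sub y _ _ h3 h2 hy))
    (fun y hy => disF y (sub y _ _ h3 h2 hy)).
  exact: K.
have [Em|Em] := cov _ hm; first by left; apply: (tc E E').
right; apply: (tc E' E) => // x hx; first by have [] := cov x hx; [right|left].
by move=> [k1 k2]; apply: (dis x hx).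
Qed.

(** From one side each open arc of the common boundary lies in [D a b] or in [D b c], from the other
    in [D c d] or in [D d (a + T)]. This leaves two ways of matching the sides, and [crux] excludes
    one. *)
Lemma linked_quad a b c d y : linked a b c d -> sbd (D a c) y -> y <> phi a -> y <> phi b ->
  [/\ D a b y, D d (a + T) y, ~ D b c y & ~ D c d y] \/
  [/\ D b c y, D c d y, ~ D a b y & ~ D d (a + T) y].
Proof.
move=> L sy yA yB; have [ab bc cd da [e1 e2 ne]] := L; have [ac ca DB sA sB] := linked_sbd L.
have bd := lt_trans bc cd; have db : d < b + T by rewrite (lt_trans da)// ltrD2r.
have L2 := linked_rot (linked_rot L).
have [S12 [y1 sy1 [y1A y1B e1y]] [y2 sy2 [y2A y2B e2y]]] := linked_split L.
have [S34 [y3 sy3 [y3A y3B e3y]] [y4 sy4 [y4A y4B e4y]]] := linked_split L2.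
have sbE z : sbd (D a c) z <-> sbd (D c (a + T)) z := sbd_compl z ac ca.
have {}S34 z : sbd (D a c) z -> z <> phi a -> z <> phi b ->
    D c d z /\ ~ D d (a + T) z \/ D d (a + T) z /\ ~ D c d z.
  by move=> sz zA zB; apply: S34; rewrite -?sbE// -?e1 -?e2.
move: sy3 sy4; rewrite -!sbE => sy3 sy4; rewrite -e1 -e2 in y3A y3B y4A y4B.
have [g [h [N [dp SN nD]]]] := arcim_disk Hphi ac ca.
have [al [be [ab' ba' gA gB [gd1 gd2 cov]]]] := boundary_arcs ac ca dp sA sB ne.
have cgam : continuous (fun t => g (expi t)).
  by have ce := @continuous_expi R; case: (dp) => cg _ _ _ _ t; cont.
have cl1 : closed (D a b) by apply: (arcim_closed Hphi) => //; exact: lt_trans ca.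
have cl2 : closed (D b c) by apply: (arcim_closed Hphi) => //; rewrite (lt_trans cd).
have cl3 : closed (D c d) by apply: (arcim_closed Hphi) => //; rewrite (lt_trans da)// ltrD2r.
have cl4 : closed (D d (a + T)) by apply: (arcim_closed Hphi) => //; rewrite ltrD2r (lt_trans ac).
have n12 z : sbd (D a c) z -> z <> phi a -> z <> phi b -> D a b z -> D b c z -> False.
  by move=> q1 q2 q3 k1 k2; have [[]|[]] := S12 _ q1 q2 q3.
have n34 z : sbd (D a c) z -> z <> phi a -> z <> phi b -> D c d z -> D d (a + T) z -> False.
  by move=> q1 q2 q3 k1 k2; have [[]|[]] := S34 _ q1 q2 q3.
have h12 u v : (forall t, u < t < v -> [/\ sbd (D a c) (g (expi t)), g (expi t) <> phi a & g (expi t) <> phi b]) ->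
    (forall x, u < x < v -> D a b (g (expi x))) \/ (forall x, u < x < v -> D b c (g (expi x))).
  move=> hyp; apply: (itv_open_sub cgam) => // x /hyp[q1 q2 q3]; last by case; exact: n12.
  by have [[]|[]] := S12 _ q1 q2 q3; [left|right].
have h34 u v : (forall t, u < t < v -> [/\ sbd (D a c) (g (expi t)), g (expi t) <> phi a & g (expi t) <> phi b]) ->
    (forall x, u < x < v -> D c d (g (expi x))) \/ (forall x, u < x < v -> D d (a + T) (g (expi x))).
  move=> hyp; apply: (itv_open_sub cgam) => // x /hyp[q1 q2 q3]; last by case; exact: n34.
  by have [[]|[]] := S34 _ q1 q2 q3; [left|right].
(* Otherwise a path joining the interiors of [D a b] and [D d (a + T)] outside
   [D b d] would leave [D a c] without meeting its boundary. *)
have crux : ~ (forall z, sbd (D a c) z -> z <> phi a -> z <> phi b -> D a b z -> D c d z).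
  move=> K.
  have dT : d < a + T := da; have aTd : a + T < d + T by rewrite ltrD2r (lt_trans ac).
  have bTd : b + T < d + T by rewrite ltrD2r.
  have dbT : d < b + T := db.
  have [z1 sz1] := sint_arcim_neq0 Hphi ab (lt_trans bc ca).
  have [z4 sz4] := sint_arcim_neq0 Hphi dT aTd.
  have D14 : D a b `<=` D d (b + T) by rewrite -(arcimT Hphi a b); apply: arcim_sub; rewrite ?lexx ?ltW.
  have D44 : D d (a + T) `<=` D d (b + T) by apply: arcim_sub; rewrite ?lexx ?lerD2r ?ltW.
  have [pth [cp p0 p1 ps]] := sint_arcim_path Hphi dbT bTd (sint_mono D14 sz1) (sint_mono D44 sz4).
  have ps' t : S2 (pth t) /\ ~ D b d (pth t).
    by have := ps t; rewrite (sint_arcim Hphi)// (arcimT Hphi).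
  have nJ t : ~ (D a c (pth t) /\ D c (a + T) (pth t)).
    move=> h'; have sJ : sbd (D a c) (pth t) by apply/(sbd_arcim Hphi).
    have [_ nb] := ps' t.
    have qA : pth t <> phi a by move=> e; apply: nb; rewrite e e1; apply: arcim_mem; exact: ltW.
    have qB : pth t <> phi b by move=> e; apply: nb; rewrite e; apply: arcim_mem; rewrite ?lexx ?ltW.
    have [[k1 k2]|[k1 k2]] := S12 _ sJ qA qB.
      by apply: nb; apply: (arcim_sub _ _ (K _ sJ qA qB k1)); rewrite ?lexx ?ltW.
    by apply: nb; apply: (arcim_sub _ _ k1); rewrite ?lexx ?ltW.
  have cla : closed (D a c) by exact: (arcim_closed Hphi).
  have clc : closed (D c (a + T)) by apply: (arcim_closed Hphi) => //; rewrite ltrD2r.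
  have := two_closed ler01 cp cla clc (fun x _ => arcim_cover Hphi a c (ps' x).1) (fun x _ => @nJ x).
  rewrite p0 p1 => -[k _].
  have {}k : D a c z4 by apply: k; apply: (arcim_sub _ _ (sint_sub sz1)); rewrite ?lexx ?ltW.
  apply: (nJ 1); rewrite p1; split=> //.
  by apply: (arcim_sub _ _ (sint_sub sz4)); rewrite ?lexx ?ltW.
have all (E : set P3) z : (forall x, al < x < be -> E (g (expi x))) ->
    (forall x, be < x < al + T -> E (g (expi x))) ->
    sbd (D a c) z -> z <> phi a -> z <> phi b -> E z.
  by move=> k1 k2 q1 q2 q3; have [t [ht|ht] ->] := cov _ q1 q2 q3; [exact: k1|exact: k2].
(* The arc where [E] and [G] hold and the arc where [F] holds are different, since [E] and [F]
   exclude each other; so [E] forces [G]. *)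
have imp (E F G : set P3) : (forall z, sbd (D a c) z -> z <> phi a -> z <> phi b -> E z -> F z -> False) ->
    (forall x, al < x < be -> E (g (expi x)) /\ G (g (expi x))) \/
    (forall x, be < x < al + T -> E (g (expi x)) /\ G (g (expi x))) ->
    (forall x, al < x < be -> F (g (expi x))) \/ (forall x, be < x < al + T -> F (g (expi x))) ->
    forall z, sbd (D a c) z -> z <> phi a -> z <> phi b -> E z -> G z.
  move=> nEF; have m1 : al < (al + be) / 2 < be by apply/andP; split; lra.
  have m2 : be < (be + (al + T)) / 2 < al + T by apply/andP; split; lra.
  have [r1 r2 r3] := gd1 _ m1; have [s1 s2 s3] := gd2 _ m2.
  move=> [H1|H1] [H2|H2] z q1 q2 q3 Ez.
  - by case: (nEF _ r1 r2 r3 (H1 _ m1).1 (H2 _ m1)).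
  - have [t [ht|ht] zt] := cov _ q1 q2 q3; rewrite zt; first exact: (H1 _ ht).2.
    by case: (nEF z) => //; rewrite zt; exact: H2.
  - have [t [ht|ht] zt] := cov _ q1 q2 q3; rewrite zt; last exact: (H1 _ ht).2.
    by case: (nEF z) => //; rewrite zt; exact: H2.
  - by case: (nEF _ s1 s2 s3 (H1 _ m2).1 (H2 _ m2)).
have n21 z : sbd (D a c) z -> z <> phi a -> z <> phi b -> D b c z -> D a b z -> False.
  by move=> q1 q2 q3 k1 k2; apply: (n12 z).
(* Each alternative is constant on each open arc. The same choice on both arcs contradicts one of
   [y1] to [y4]; [D a b] matched with [D c d] contradicts [crux]. *)
have [K14 K23] : (forall z, sbd (D a c) z -> z <> phi a -> z <> phi b -> D a b z -> D d (a + T) z) /\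
             (forall z, sbd (D a c) z -> z <> phi a -> z <> phi b -> D b c z -> D c d z).
  case: (h12 _ _ gd1) => U12; case: (h12 _ _ gd2) => V12;
    [by case: (n12 y2) => //; exact: (all (D a b)) | | | by case: (n12 y1) => //; exact: (all (D b c))];
  case: (h34 _ _ gd1) => U34; case: (h34 _ _ gd2) => V34;
    [by case: (n34 y4) => //; exact: (all (D c d)) | | | by case: (n34 y3) => //; exact: (all (D d (a + T)))
    |by case: (n34 y4) => //; exact: (all (D c d)) | | | by case: (n34 y3) => //; exact: (all (D d (a + T)))].
  - by case: crux; apply: (imp _ _ _ n12); [left=> x hx; split; [exact: U12|exact: U34]|right].
  - split; first by apply: (imp _ _ _ n12); [left=> x hx; split; [exact: U12|exact: U34]|right].
    by apply: (imp _ _ _ n21); [right=> x hx; split; [exact: V12|exact: V34]|left].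
  - split; first by apply: (imp _ _ _ n12); [right=> x hx; split; [exact: V12|exact: V34]|left].
    by apply: (imp _ _ _ n21); [left=> x hx; split; [exact: U12|exact: U34]|right].
  - by case: crux; apply: (imp _ _ _ n12); [right=> x hx; split; [exact: V12|exact: V34]|left].
have [[k1 k2]|[k1 k2]] := S12 _ sy yA yB.
  left; have k4 := K14 _ sy yA yB k1; split=> // k3; exact: (n34 y).
right; have k3 := K23 _ sy yA yB k1; split=> // k4; exact: (n34 y).
Qed.

End LinkedPairs.

(** * Boundary loops of a pair and their direction *)

Section Signs.
Variable R : realType.
Notation P2 := (R * R)%type.
Notation P3 := (R * R * R)%type.
Notation T := (tau R).
Variable phi : R -> P3.
Hypothesis Hphi : catherine_line phi.
Notation D := (arcim phi).
Notation linked := (linked phi).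

Definition Zpos a c := exists Y, is_component (sbd (D a c) `\` [set phi a; phi c]) Y /\
  exists gam, [/\ posloop (D a c) gam, gam 0 = phi a &
    forall s t x y, a <= s <= c -> a <= t <= c -> Y (phi s) -> Y (phi t) -> s <= t ->
      0 < x < 1 -> 0 < y < 1 -> gam x = phi s -> gam y = phi t -> x <= y].

(** A simple boundary loop based at [phi a], in either orientation. In contrast to [posloop] it is
    continuous on the whole line and stays on the boundary for all parameters. *)
Definition jloop a c (gam : R -> P3) :=
  [/\ continuous gam, gam 0 = phi a, gam 1 = phi a,
      (forall s t, 0 <= s < 1 -> 0 <= t < 1 -> gam s = gam t -> s = t) &
      (forall t, sbd (D a c) (gam t)) /\
      (forall y, sbd (D a c) y -> exists2 t, 0 <= t <= 1 & gam t = y)].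

(** The canonical direction of the loop, tested at the single value [phi b]; [jloop_monotone] shows
    that this one test suffices. *)
Definition visits_first a b c (gam : R -> P3) (u : R) :=
  [/\ 0 < u < 1, gam u = phi b,
     (forall t, 0 < t < u -> D a b (gam t) /\ ~ D b c (gam t)) &
     (forall t, u < t < 1 -> D b c (gam t) /\ ~ D a b (gam t))].

Definition visits_last a b c (gam : R -> P3) (u : R) :=
  [/\ 0 < u < 1, gam u = phi b,
     (forall t, 0 < t < u -> D b c (gam t) /\ ~ D a b (gam t)) &
     (forall t, u < t < 1 -> D a b (gam t) /\ ~ D b c (gam t))].

Lemma jloop_neq a c gam s t : jloop a c gam -> 0 <= s -> s < t -> t <= 1 -> gam s = gam t -> s = 0 /\ t = 1.
Proof.
move=> [_ g0 g1 inj _] s0 st t1 e.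
have s1 : s < 1 := lt_le_trans st t1.
have [t1'|t1'] := eqVneq t 1.
  split=> //; apply: inj; rewrite ?lexx ?ltr01 ?s0 ?s1//.
  by rewrite e t1' g0 g1.
have tl : t < 1 by rewrite lt_neqAle t1'.
have e' : s = t by apply: inj; rewrite ?s0 ?s1 ?tl ?(ltW (le_lt_trans s0 st)).
by move: st; rewrite e' ltxx.
Qed.

(** Each of the two open arcs of the loop lies in one of the disks [D a b], [D b c], and by
    [linked_split] they do not both lie in the same one. *)
Lemma jloop_order a b c d gam u : linked a b c d -> jloop a c gam -> 0 < u < 1 -> gam u = phi b ->
  visits_first a b c gam u \/ visits_last a b c gam u.
Proof.
move=> L J /andP[u0 u1] gu; have [ab bc cd da [e1 e2 ne]] := L; have [ac ca DB sA sB] := linked_sbd Hphi L.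
have [cg g0 g1 inj [gs gi]] := J.
have [S12 [y1 sy1 [y1A y1B e1y]] [y2 sy2 [y2A y2B e2y]]] := linked_split Hphi L.
have cl1 : closed (D a b) by apply: (arcim_closed Hphi) => //; exact: lt_trans ca.
have cl2 : closed (D b c) by apply: (arcim_closed Hphi) => //; rewrite (lt_trans ca)// ltrD2r.
have gd t : 0 < t < 1 -> t != u -> gam t <> phi a /\ gam t <> phi b.
  move=> /andP[t0 t1] tu; split.
    by rewrite -g0 => e; have [_ e'] := jloop_neq J (lexx 0) t0 (ltW t1) (esym e); move: t1; rewrite e' ltxx.
  rewrite -gu; have [h|h] := ltP t u.
    by move=> e; have [e' _] := jloop_neq J (ltW t0) h (ltW u1) e; move: t0; rewrite e' ltxx.
  have h' : u < t by rewrite lt_neqAle eq_sym tu.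
  by move=> e; have [e' _] := jloop_neq J (ltW u0) h' (ltW t1) (esym e); move: u0; rewrite e' ltxx.
have h12 v w : (forall t, v < t < w -> 0 < t < 1 /\ t != u) ->
    (forall x, v < x < w -> D a b (gam x) /\ ~ D b c (gam x)) \/
    (forall x, v < x < w -> D b c (gam x) /\ ~ D a b (gam x)).
  move=> hyp; have hyp2 x : v < x < w -> (D a b (gam x) /\ ~ D b c (gam x)) \/ (D b c (gam x) /\ ~ D a b (gam x)).
    by move=> /hyp[h1 h2]; have [q1 q2] := gd _ h1 h2; exact: S12.
  have [] := @itv_open_sub _ gam (D a b) (D b c) v w cg cl1 cl2.
  - by move=> x /hyp2[[]|[]]; [left|right].
  - by move=> x /hyp2[[h1 h2]|[h1 h2]] [].
  - by move=> h; left=> x hx; have [//|[_ []]] := hyp2 x hx; exact: h.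
  - by move=> h; right=> x hx; have [[_ []]|//] := hyp2 x hx; exact: h.
have loc y : sbd (D a c) y -> y <> phi a -> y <> phi b -> exists2 t, (0 < t < u \/ u < t < 1) & gam t = y.
  move=> sy yA yB; have [t /andP[t0 t1] et] := gi _ sy; exists t => //.
  have n0 : t != 0 by apply: contra_notN yA => /eqP e; rewrite -et e.
  have n1 : t != 1 by apply: contra_notN yA => /eqP e; rewrite -et e.
  have tp : 0 < t by rewrite lt_neqAle eq_sym n0.
  have tl : t < 1 by rewrite lt_neqAle n1.
  have [k|k|k] := ltgtP t u; [by left; rewrite tp|by right|].
  by case: yB; rewrite -et k.
have [] := h12 0 u; first by move=> t /andP[t0 tu]; rewrite t0 (lt_trans tu)// lt_eqF.
  move=> H1; have [] := h12 u 1; first by move=> t /andP[t0 tu]; rewrite tu (lt_trans u0)// gt_eqF.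
    move=> H2; have [t [ht|ht] et] := loc _ sy2 y2A y2B.
      by have [_ []] := H1 t ht; rewrite et.
    by have [_ []] := H2 t ht; rewrite et.
  by move=> H2; left; split=> //; rewrite u0.
move=> H1; have [] := h12 u 1; first by move=> t /andP[t0 tu]; rewrite tu (lt_trans u0)// gt_eqF.
  by move=> H2; right; split=> //; rewrite u0.
move=> H2; have [t [ht|ht] et] := loc _ sy1 y1A y1B.
  by have [_ []] := H1 t ht; rewrite et.
by have [_ []] := H2 t ht; rewrite et.
Qed.

Lemma jloop_visit a b c d gam : linked a b c d -> jloop a c gam ->
  exists2 u, 0 < u < 1 & gam u = phi b.
Proof.
move=> L [cg g0 g1 inj [gs gi]]; have [ab bc cd da [e1 e2 ne]] := L.
have [ac ca DB sA sB] := linked_sbd Hphi L.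
have [u /andP[u0 u1] gu] := gi _ sB; exists u => //; rewrite !lt_neqAle u0 u1 !andbT.
by apply/andP; split; apply/eqP => e; apply: ne; rewrite -gu; [rewrite -e g0|rewrite e g1].
Qed.

(** The boundary point [phi s] is also some [phi s'] on the complementary arc, so [s] can replace
    [b] in [jloop_order]. Visiting [D a s] first gives the claim. Visiting it last is impossible:
    near the end of the loop if [s <= b], as [D a s] is inside [D a b], and near its start if
    [b <= s], as [D s c] is inside [D b c]. *)
Lemma jloop_monotone a b c d gam u s t x y : linked a b c d -> jloop a c gam ->
  visits_first a b c gam u -> a <= s <= c -> a <= t <= c -> s <= t ->
  0 < x < 1 -> 0 < y < 1 -> gam x = phi s -> gam y = phi t -> x <= y.
Proof.
move=> L J [/andP[u0 u1] gu F1 F2] /andP[as_ sc] /andP[at_ tc] st /andP[x0 x1] /andP[y0 y1] gx gy.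
have [ab bc cd da [e1 e2 ne]] := L; have [ac ca DB sA sB] := linked_sbd Hphi L.
have [cg g0 g1 inj [gs gi]] := J.
have nA w : 0 < w -> w < 1 -> gam w <> phi a.
  move=> w0 w1; rewrite -g0 => e; have [_ e'] := jloop_neq J (lexx 0) w0 (ltW w1) (esym e).
  by move: w1; rewrite e' ltxx.
have sA' : s != a by apply/eqP => e; apply: (nA x) => //; rewrite gx e.
have sC' : s != c by apply/eqP => e; apply: (nA x) => //; rewrite gx e -e1.
have a_s : a < s by rewrite lt_neqAle eq_sym sA'.
have s_c : s < c by rewrite lt_neqAle sC'.
have := gs x; rewrite (sbd_arcim Hphi) // => -[_ [s' /= /andP[cs' s'a] es']].
have n1 : s' != c by apply/eqP => e; apply: (nA x) => //; rewrite -es' e e1.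
have n2 : s' != a + T by apply/eqP => e; apply: (nA x) => //; rewrite -es' e (phiT Hphi).
have Ls : linked a s c s'.
  split=> //; [by rewrite lt_neqAle eq_sym n1|by rewrite lt_neqAle n2|split=> //].
    by rewrite -gx.
  by rewrite -gx; apply: nesym; exact: nA.
have x01 : 0 < x < 1 by rewrite x0.
have [[_ _ G1 G2]|[_ _ G1 G2]] := jloop_order Ls J x01 gx.
  rewrite leNgt; apply/negP => yx; have [_] := G1 y (introT andP (conj y0 yx)).
  by apply; rewrite gy; apply: arcim_mem.
exfalso; have [sb|/ltW sb] := leP s b.
  pose w := (Num.max x u + 1) / 2.
  have [hx hu] : x <= Num.max x u /\ u <= Num.max x u by rewrite !le_max !lexx orbT.
  have m1 : Num.max x u < 1 by rewrite gt_max x1.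
  have [k1 _] := G2 w (introT andP (conj (ltac:(rewrite /w; lra) : x < w) (ltac:(rewrite /w; lra) : w < 1))).
  have [_ k2] := F2 w (introT andP (conj (ltac:(rewrite /w; lra) : u < w) (ltac:(rewrite /w; lra) : w < 1))).
  by apply: k2; apply: arcim_sub k1.
pose w := (Num.min x u) / 2.
have [hx hu] : Num.min x u <= x /\ Num.min x u <= u by rewrite !ge_min !lexx orbT.
have m1 : 0 < Num.min x u by rewrite lt_min x0.
have [k1 _] := G1 w (introT andP (conj (ltac:(rewrite /w; lra) : 0 < w) (ltac:(rewrite /w; lra) : w < x))).
have [_ k2] := F1 w (introT andP (conj (ltac:(rewrite /w; lra) : 0 < w) (ltac:(rewrite /w; lra) : w < u))).
by apply: k2; apply: arcim_sub k1.
Qed.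

(** For a degenerate pair only one point is removed from the boundary curve, so [Zpos] has a single
    component to choose from. *)
Lemma jloop_component a c gam y0 y : jloop a c gam -> phi c = phi a ->
  let B := sbd (D a c) `\` [set phi a; phi c] in B y0 -> B y -> connected_component B y0 y.
Proof.
move=> J ec B; have [cg g0 g1 inj [gs gi]] := J.
have par z : B z -> exists2 t, 0 < t < 1 & gam t = z.
  move=> [sz nz]; have [t /andP[t0 t1] et] := gi _ sz; exists t => //.
  rewrite !lt_neqAle t0 t1 !andbT; apply/andP; split; apply/eqP => e; apply: nz; left; rewrite -et.
    by rewrite -e g0.
  by rewrite e g1.
have nA w : 0 < w -> w < 1 -> B (gam w).
  move=> w0 w1; split=> //; rewrite ec => -[] /= ; rewrite -g0 => e.
    by have [_ e'] := jloop_neq J (lexx 0) w0 (ltW w1) (esym e); move: w1; rewrite e' ltxx.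
  by have [_ e'] := jloop_neq J (lexx 0) w0 (ltW w1) (esym e); move: w1; rewrite e' ltxx.
move=> /par[s /andP[s0 s1] <-] /par[t /andP[t0 t1] <-].
pose m := Num.min s t; pose M := Num.max s t.
exists (gam @` `[m, M]%classic).
  split.
  - by exists s => //=; rewrite in_itv /= /m /M ge_min le_max !lexx.
  - move=> _ [w hw <-]; move: hw; rewrite /= in_itv /= => /andP[h1 h2]; apply: nA.
      by apply: lt_le_trans h1; rewrite /m lt_min s0.
    by apply: le_lt_trans h2 _; rewrite /M gt_max s1.
  - apply: connected_continuous_connected; last exact: continuous_subspaceT.
    exact: segment_connected.
by exists t => //=; rewrite in_itv /= /m /M ge_min le_max !lexx !orbT.
Qed.

Lemma two_region_wind N z u0 (D1 D3 : set P3) (ta1 ta3 : P3 -> R) (gam : R -> P3) (u w : R) : frame N u0 ->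
  psi N u0 (gam 0) <> psi N u0 z ->
  {within D1, continuous ta1} ->
  (forall x, D1 x -> ang (sub2 (psi N u0 x) (psi N u0 z)) (ta1 x)) ->
  {within D3, continuous ta3} ->
  (forall x, D3 x -> ang (sub2 (psi N u0 x) (psi N u0 z)) (ta3 x)) ->
  continuous gam -> 0 <= u <= 1 -> (forall t, 0 <= t <= u -> D1 (gam t)) ->
  (forall t, u <= t <= 1 -> D3 (gam t)) -> wnum N z gam w ->
  w = (ta1 (gam u) - ta1 (gam 0)) + (ta3 (gam 1) - ta3 (gam u)).
Proof.
move=> fr ne c1 a1 c3 a3 cg /andP[h0 h1] g1 g3; rewrite (wnumE _ fr ne) => -[th [cth hth <-]].
rewrite -(region_angle_change c1 a1 h0 cg g1 cth) -?(region_angle_change c3 a3 h1 cg g3 cth); first ring.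
  by move=> t /andP[t0 t1]; apply: hth; rewrite t1 (le_trans h0).
by move=> t /andP[t0 t1]; apply: hth; rewrite t0 (le_trans t1).
Qed.

End Signs.

(** * The sign of a pair as a winding number *)

Section LinkedSigns.
Variable R : realType.
Notation P2 := (R * R)%type.
Notation P3 := (R * R * R)%type.
Notation T := (tau R).
Variable phi : R -> P3.
Hypothesis Hphi : catherine_line phi.
Notation D := (arcim phi).
Notation linked := (linked phi).
Notation Zpos := (Zpos phi).
Notation jloop := (jloop phi).
Notation visits_first := (visits_first phi).

Lemma wnum_ext N z (gam gam' : R -> P3) w : (forall t, 0 <= t <= 1 -> gam t = gam' t) ->
  wnum N z gam w -> wnum N z gam' w.
Proof.
move=> e; apply: wind_ext => t ht.
by rewrite (e t ht) (e 0)// lexx ler01.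
Qed.

Lemma jloop_wnum_move a c gam N0 z0 N z w : a < c -> c < a + T -> jloop a c gam ->
  sint (D c (a + T)) N0 -> sint (D a c) z0 -> sint (D c (a + T)) N -> sint (D a c) z ->
  wnum N0 z0 gam w -> wnum N z gam w.
Proof.
move=> ac ca [cg g0 g1 _ [gs _]] sN0 sz0 sN sz.
have caT : a + T < c + T by rewrite ltrD2r.
have [nn [cn n0 n1 ns]] := sint_arcim_path Hphi ca caT sN0 sN.
have [zz [cz e0 e1 zs]] := sint_arcim_path Hphi ac ca sz0 sz.
apply: (wnum_move cg _ _ cn n0 n1 cz e0 e1) => //.
- by rewrite g0 g1.
- by move=> t; have /sbdE[h _] := gs t; exact: (arcim_S2 Hphi h).
- move=> l; have := ns l; rewrite (sint_arcim Hphi) // (arcimT Hphi) => -[S1 n1'].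
  have := zs l; have h := sint_sub (zs l); rewrite (sint_arcim Hphi) // => -[S2' n2].
  by split=> // e; apply: n1'; rewrite -e.
- move=> t l; have := gs t; rewrite (sbd_arcim Hphi) // => -[h1 h2]; split=> e.
    by have := ns l; rewrite (sint_arcim Hphi) // (arcimT Hphi) => -[_]; rewrite -e.
  by have := zs l; rewrite (sint_arcim Hphi) // => -[_]; rewrite -e.
Qed.

(** [posloop] asks for some pole and some centre; by [jloop_wnum_move] every other choice gives the
    same winding number. *)
Lemma posloopE a c gam N z : a < c -> c < a + T -> jloop a c gam ->
  sint (D c (a + T)) N -> sint (D a c) z -> posloop (D a c) gam <-> wnum N z gam T.
Proof.
move=> ac ca J sN sz; have [cg g0 g1 inj [gs gi]] := J.
have caT : a + T < c + T by rewrite ltrD2r.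
have hgam N1 z1 : S2 N1 -> ~ D a c N1 -> sint (D a c) z1 -> winds_once_pos N1 z1 gam <-> wnum N1 z1 gam T.
  move=> SN nN sz1; apply: winds_once_posE => //.
  - exact: (arcim_S2 Hphi (sint_sub sz1)).
  - by move=> e; apply: nN; rewrite -e; exact: sint_sub.
  - move=> t _; have /sbdE[h1 h2] := gs t; split; first exact: (arcim_S2 Hphi h1).
      by move=> e; apply: nN; rewrite -e.
    by move=> e; apply: h2; rewrite e.
have hN N1 : sint (D c (a + T)) N1 <-> S2 N1 /\ ~ D a c N1.
  by rewrite (sint_arcim Hphi) // (arcimT Hphi).
split.
  move=> [_ _ _ _ [N1 [z1 [SN1 nN1 sz1]]]] /(hgam _ _ SN1 nN1 sz1).
  exact: (jloop_wnum_move ac ca J ((hN N1).2 (conj SN1 nN1)) sz1 sN sz).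
move=> w; split.
- exact: continuous_subspaceT.
- by rewrite g0 g1.
- exact: inj.
- apply/seteqP; split=> [_ [t _ <-] //|y /gi[t ht <-]]; by exists t.
- by have [SN nN] := (hN N).1 sN; exists N, z; split=> //; apply/hgam.
Qed.

Lemma jloop_of_posloop a c gam : a < c -> c < a + T -> posloop (D a c) gam -> gam 0 = phi a ->
  jloop a c (fun t => gam (clamp t)).
Proof.
move=> ac ca [cg g01 inj im _] g0; split.
- by apply: (continuous_comp_within cg (@continuous_clamp R)) => t; exact: clamp01.
- by rewrite clampK ?lexx ?ler01.
- by rewrite clampK ?lexx ?ler01// -g01.
- move=> s t /andP[s0 s1] /andP[t0 t1]; rewrite !clampK ?s0 ?t0 ?(ltW s1) ?(ltW t1)//.
  by apply: inj; rewrite ?s0 ?t0.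
- split; first by move=> t; rewrite -im; exists (clamp t) => //; exact: clamp01.
  by move=> y; rewrite -im => -[t ht <-]; exists t => //; rewrite clampK.
Qed.

(** The quantifiers of [Zpos] become finite: the component is the whole punctured boundary,
    monotonicity is tested at [phi b] alone, and the orientation by one winding number. *)
Lemma Zpos_linked a b c d N z : linked a b c d -> sint (D c (a + T)) N -> sint (D a c) z ->
  Zpos a c <-> exists gam u, [/\ jloop a c gam, visits_first a b c gam u & wnum N z gam T].
Proof.
move=> L sN sz; have [ab bc cd da [e1 e2 ne]] := L; have [ac ca DB sA sB] := linked_sbd Hphi L.
have inB : (sbd (D a c) `\` [set phi a; phi c]) (phi b).
  by split=> //; rewrite -e1 => -[] /=; exact: nesym.
split.
  move=> [Y [[y0 [By0 YE]] [gam [pl g0 mono]]]].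
  have J := jloop_of_posloop ac ca pl g0; set gam' := fun t => gam (clamp t) in J.
  have gE t : 0 <= t <= 1 -> gam t = gam' t by move=> ht; rewrite /gam' clampK.
  have [u u01 gu] := jloop_visit Hphi L J.
  have YB y : (sbd (D a c) `\` [set phi a; phi c]) y -> Y y.
    by rewrite YE; apply: (jloop_component J).
  exists gam', u; split=> //.
    have [//|[_ _ G1 _]] := jloop_order Hphi L J u01 gu.
    (* If [D b c] came first, the point at parameter [u / 2] would be [phi t] with [b <= t],
       although [phi b] is reached only at [u]; this contradicts monotonicity. *)
    exfalso; case/andP: (u01) => u0 u1.
    have h1 : 0 < u / 2 < u by apply/andP; split; lra.
    have [[t /= /andP[bt tc] et] nt] := G1 _ h1.
    have nA : gam' (u / 2) <> phi a.
      have [_ g0' _ _ _] := J; rewrite -g0' => e; case/andP: h1 => h1 h2.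
      have h3 : u / 2 <= 1 by lra.
      by have [_ k] := jloop_neq J (lexx 0) h1 h3 (esym e); lra.
    have : u <= u / 2.
      apply: (mono b t u (u / 2)) => //.
      - by rewrite !ltW.
      - by rewrite tc (le_trans (ltW ab)).
      - exact: YB.
      - apply: YB; split; first by rewrite et; case: J => _ _ _ _ [].
        by rewrite -e1 et => -[].
      - by apply/andP; split; lra.
      - by rewrite gE// !ltW.
      - by rewrite gE ?et//; apply/andP; split; lra.
    by lra.
  have plw : posloop (D a c) gam'.
    case: pl => _ g01 inj im [N1 [z1 [SN1 nN1 sz1 w1]]]; case: (J) => cg' g0' g1' inj' [gs' gi'].
    have hg t : 0 <= t <= 1 -> [/\ S2 (gam t), gam t <> N1 & gam t <> z1].
      move=> ht; have /sbdE[k1 k2] := gs' t; rewrite -gE// in k1 k2; split; first exact: (arcim_S2 Hphi k1).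
        by move=> e; apply: nN1; rewrite -e.
      by move=> e; apply: k2; rewrite e.
    have Sz1 : S2 z1 := arcim_S2 Hphi (sint_sub sz1).
    have zN1 : z1 <> N1 by move=> e; apply: nN1; rewrite -e; exact: sint_sub.
    apply/(posloopE ac ca J sN sz).
    have caT : a + T < c + T by rewrite ltrD2r.
    have sN1 : sint (D c (a + T)) N1 by rewrite (sint_arcim Hphi) // (arcimT Hphi).
    apply: (jloop_wnum_move ac ca J sN1 sz1 sN sz).
    by apply: (wnum_ext gE); apply/winds_once_posE.
  exact/(posloopE ac ca J sN sz).
move=> [gam [u [J F w]]]; exists (connected_component (sbd (D a c) `\` [set phi a; phi c]) (phi b)).
split; first by exists (phi b).
exists gam; split; [exact/(posloopE ac ca J sN sz)|by case: J|].
move=> s t x y hs ht _ _; exact: (jloop_monotone Hphi L J F hs ht).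
Qed.

Lemma wnum_rev N z (gam : R -> P3) w : S2 N -> S2 z -> z <> N ->
  gam 0 = gam 1 -> S2 (gam 0) -> gam 0 <> N -> gam 0 <> z ->
  wnum N z (fun t => gam (1 - t)) w -> wnum N z gam (- w).
Proof.
move=> SN Sz zN loop Sg gN gz; have [u fr] := frame_exists SN.
have ne : psi N u (gam 0) <> psi N u z by apply: psi_neq.
have ne' : psi N u (gam (1 - 0)) <> psi N u z by rewrite subr0 -loop.
rewrite (wnumE (gam := gam) _ fr ne) (wnumE (gam := fun t => gam (1 - t)) _ fr ne').
move=> [th [cth hth <-]]; exists (fun t => th (1 - t)); split.
- by move=> t; cont.
- move=> t /andP[h1 h2]; have := hth (1 - t); rewrite subKr; apply.
  by apply/andP; split; lra.
- by rewrite subrr subr0 opprB.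
Qed.

(** The boundary circle of a parametrisation is a loop of degree 1 or -1; if it runs in the wrong
    direction it is reversed, which only changes the sign. *)
Lemma jloop_first_exists a b c d : linked a b c d ->
  exists gam u, [/\ jloop a c gam, visits_first a b c gam u &
    forall N z w, sint (D c (a + T)) N -> sint (D a c) z -> wnum N z gam w -> w = T \/ w = - T].
Proof.
move=> L; have [ab bc cd da [e1 e2 ne]] := L; have [ac ca DB sA sB] := linked_sbd Hphi L.
have [g [h [N [dp SN nD]]]] := arcim_disk Hphi ac ca.
have [al [be [ab' ba' gA gB]]] := boundary_param Hphi ac ca dp sA sB ne.
have T0 := tau_gt0 R.
have ce := @continuous_expi R; case: (dp) => cg Dg ch hg gh.
have eT x : expi (x + T * 1) = expi x :> P2 by rewrite mulr1 expiDT.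
pose gam t := g (expi (al + T * t)).
have J : jloop a c gam.
  split.
  - by move=> t; rewrite /gam; cont.
  - by rewrite /gam mulr0 addr0.
  - by rewrite /gam eT.
  - have key s t : 0 <= s -> s < t -> t < 1 -> gam s <> gam t.
      move=> s0 st t1; apply: (boundary_inj dp); first by rewrite ltrD2l ltr_pM2l.
      have : T * (t - s) < T * 1 by rewrite ltr_pM2l//; lra.
      by rewrite mulrBr mulr1; lra.
    move=> s t /andP[s0 s1] /andP[t0 t1] e.
    by have [k|k|//] := ltgtP s t; [case: (key s t)|case: (key t s)].
  - split; first by move=> t; exact: (boundary_point Hphi).
    move=> y /(boundary_cover Hphi al ac ca dp)[t /andP[h1 h2] ->].
    exists ((t - al) / T); first by rewrite divr_ge0 ?subr_ge0 ?(ltW T0)//= ler_pdivrMr// mul1r; lra.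
    by rewrite /gam mulrC divfK ?lt0r_neq0// addrC subrK.
have [u u01 gu] := jloop_visit Hphi L J.
have caT : a + T < c + T by rewrite ltrD2r.
have pm M z w : sint (D c (a + T)) M -> sint (D a c) z -> wnum M z gam w -> w = T \/ w = - T.
  move=> sM sz w1; apply: (disk_wnum (@arcim_S2 _ _ Hphi a c) dp SN nD (th0 := al)).
  have sN : sint (D c (a + T)) N by rewrite (sint_arcim Hphi) // (arcimT Hphi).
  apply: (jloop_wnum_move ac ca J sM sz sN _ w1).
  apply: (param_open_sint (@arcim_S2 _ _ Hphi a c) dp SN nD).
  by rewrite /sq2 /= expr0n /= addr0 ltr01.
have [F|[_ _ G1 G2]] := jloop_order Hphi L J u01 gu; first by exists gam, u.
exists (fun t => gam (1 - t)), (1 - u); split; last first.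
- move=> M z w sM sz w1; have [cgm g0 g1 inj [gs gi]] := J.
  have [SM nM] : S2 M /\ ~ D a c M by move: sM; rewrite (sint_arcim Hphi) // (arcimT Hphi).
  have /sbdE[k1 k2] := gs 0.
  have zM : z <> M by move=> e; apply: nM; rewrite -e; exact: sint_sub.
  have gM : gam 0 <> M by move=> e; apply: nM; rewrite -e.
  have gz : gam 0 <> z by move=> e; apply: k2; rewrite e.
  have g01 : gam 0 = gam 1 by rewrite g0 g1.
  have [e|e] := pm M z (- w) sM sz
    (wnum_rev SM (arcim_S2 Hphi (sint_sub sz)) zM g01 (arcim_S2 Hphi k1) gM gz w1).
    by right; rewrite -e opprK.
  by left; apply: oppr_inj.
- split.
  + by case/andP: u01 => *; apply/andP; split; lra.
  + by rewrite -gu; congr gam; ring.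
  + by move=> t /andP[h1 h2]; apply: G2; apply/andP; split; lra.
  + by move=> t /andP[h1 h2]; apply: G1; apply/andP; split; lra.
- have [cgm g0 g1 inj [gs gi]] := J; split.
  + by move=> t; cont.
  + by rewrite subr0.
  + by rewrite subrr.
  + have key s t : 0 <= s -> s < t -> t < 1 -> gam (1 - s) <> gam (1 - t).
      move=> s0 st t1 e.
      have [h1 h2 h3] : [/\ 0 <= 1 - t, 1 - t < 1 - s & 1 - s <= 1] by split; lra.
      by have [k1 k2] := jloop_neq J h1 h2 h3 (esym e); lra.
    move=> s t /andP[s0 s1] /andP[t0 t1] e.
    by have [k|k|//] := ltgtP s t; [case: (key s t)|case: (key t s)].
  + split=> // y /gi[t /andP[h1 h2] <-]; exists (1 - t); first by apply/andP; split; lra.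
    by congr gam; ring.
Qed.

End LinkedSigns.

(** * Comparison of the loops of two linked pairs *)

Section SignAlternation.
Variable R : realType.
Notation P2 := (R * R)%type.
Notation P3 := (R * R * R)%type.
Notation T := (tau R).
Variable phi : R -> P3.
Hypothesis Hphi : catherine_line phi.
Notation D := (arcim phi).
Notation linked := (linked phi).
Notation Zpos := (Zpos phi).
Notation jloop := (jloop phi).
Notation visits_first := (visits_first phi).

(* Both boundary loops stay in the two disks [D a b] and [D c d], which avoid
   [N] and [z] and hence carry angle functions; in each of them the two loops
   join [phi a] and [phi b] in opposite directions. *)
Lemma linked_wnum_opp a b c d gam u gam' u' N z w w' : linked a b c d ->
  jloop a c gam -> visits_first a b c gam u -> jloop b d gam' -> visits_first b c d gam' u' ->
  sint (D d (a + T)) N -> sint (D b c) z -> wnum N z gam w -> wnum N z gam' w' -> w' = - w.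
Proof.
move=> L J [u01 gu F1 F2] J' [u01' gu' F1' F2'] sN sz hw hw'.
have [ab bc cd da [e1 e2 ne]] := L; have [ac ca DB sA sB] := linked_sbd Hphi L.
have L' := linked_rot Hphi L.
have ba := lt_trans bc ca; have cb : c < b + T by rewrite (lt_trans ca)// ltrD2r.
have ad := lt_trans ac cd; have dc : d < c + T by rewrite (lt_trans da)// ltrD2r.
have aTd : a + T < d + T by rewrite ltrD2r.
have [SN nN] : S2 N /\ ~ D a d N by move: sN; rewrite (sint_arcim Hphi) // (arcimT Hphi).
have [Sz nz] : S2 z /\ ~ D c (b + T) z by move: sz; rewrite (sint_arcim Hphi).
have N1 : ~ D a b N by move=> h; apply: nN; apply: arcim_sub h; rewrite ?lexx ?ltW// (lt_trans bc).
have N3 : ~ D c d N by move=> h; apply: nN; apply: arcim_sub h; rewrite ?lexx ?ltW.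
have N2 : ~ D b c N by move=> h; apply: nN; apply: arcim_sub h; rewrite ?lexx ?ltW.
have z1 : ~ D a b z.
  by rewrite -(arcimT Hphi) => h; apply: nz; apply: arcim_sub h; rewrite ?lexx ?ltW.
have z3 : ~ D c d z.
  by move=> h; apply: nz; apply: arcim_sub h; rewrite ?lexx ?ltW// (lt_trans da)// ltrD2r.
have zN : z <> N by move=> e; apply: N2; rewrite -e; exact: sint_sub.
have [f fr] := frame_exists SN.
have [g1 [h1 [_ [dp1 _ _]]]] := arcim_disk Hphi ab ba.
have [g3 [h3 [_ [dp3 _ _]]]] := arcim_disk Hphi cd dc.
have [ta1 c1 a1] := region_angle (@arcim_S2 _ _ Hphi a b) dp1 SN Sz fr N1 z1 zN.
have [ta3 c3 a3] := region_angle (@arcim_S2 _ _ Hphi c d) dp3 SN Sz fr N3 z3 zN.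
have D1A : D a b (phi a) by apply: arcim_mem; rewrite ?lexx ?ltW.
have D1B : D a b (phi b) by apply: arcim_mem; rewrite ?lexx ?ltW.
have D3A : D c d (phi c) by apply: arcim_mem; rewrite ?lexx ?ltW.
have D3B : D c d (phi d) by apply: arcim_mem; rewrite ?lexx ?ltW.
have psne x : D a b x -> psi N f x <> psi N f z.
  move=> hx; apply: (psi_neq fr) => //; first exact: (arcim_S2 Hphi hx).
    by move=> e; apply: N1; rewrite -e.
  by move=> e; apply: z1; rewrite -e.
have ends (lo hi t : R) : lo <= t <= hi -> [\/ t = lo, t = hi | lo < t < hi].
  move=> /andP[t0 t1]; have [->|n0] := eqVneq t lo; first by constructor 1.
  have [->|n1] := eqVneq t hi; first by constructor 2.
  by constructor 3; rewrite !lt_neqAle eq_sym n0 t0 n1 t1.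
have [cg gam0 gam1 inj [gs gi]] := J; have [cg' gam0' gam1' inj' [gs' gi']] := J'.
case/andP: (u01) => u0 u1; case/andP: (u01') => u0' u1'.
have uI : 0 <= u <= 1 by rewrite !ltW.
have uI' : 0 <= u' <= 1 by rewrite !ltW.
have p1 t : 0 <= t <= u -> D a b (gam t).
  by move=> /ends[->|->|/F1[] //]; rewrite ?gam0 ?gu.
have p3 t : u <= t <= 1 -> D c d (gam t).
  move=> /ends[->|->|/F2[k1 k2]]; rewrite ?gam1 ?gu ?e2 ?e1//.
  have qA : gam t <> phi a by move=> e; apply: k2; rewrite e.
  have qB : gam t <> phi b by move=> e; apply: k2; rewrite e.
  by have [[_ _ []]|[_ k _ _]] := linked_quad Hphi L (gs t) qA qB.
have p1' t : 0 <= t <= u' -> D a b (gam' t).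
  move=> /ends[->|->|/F1'[k1 k2]]; rewrite ?gam0' ?gu' -?e1//.
  have qA : gam' t <> phi c by move=> e; apply: k2; rewrite e.
  have qB : gam' t <> phi b by move=> e; apply: k2; rewrite e e2.
  by have [[_ k _ _]|[k _ []//]] := linked_quad Hphi L' (gs' t) qB qA; rewrite (arcimT Hphi) in k.
have p3' t : u' <= t <= 1 -> D c d (gam' t).
  by move=> /ends[->|->|/F2'[] //]; rewrite ?gam1' ?gu' ?e2.
have n0 : psi N f (gam 0) <> psi N f z by apply: psne; rewrite gam0.
have n0' : psi N f (gam' 0) <> psi N f z by apply: psne; rewrite gam0'.
rewrite (two_region_wind fr n0 c1 a1 c3 a3 cg uI p1 p3 hw).
rewrite (two_region_wind fr n0' c1 a1 c3 a3 cg' uI' p1' p3' hw').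
by rewrite gam0 gam1 gu gam0' gam1' gu' -e1; ring.
Qed.

(** A pole inside [D d (a + T)] and a centre inside [D b c] serve both pairs at once, so the two
    winding numbers, each [T] or [- T], can be compared directly. *)
Lemma linked_sign a b c d : linked a b c d -> Zpos a c <-> ~ Zpos b d.
Proof.
move=> L; have [ab bc cd da [e1 e2 ne]] := L; have [ac ca DB sA sB] := linked_sbd Hphi L.
have L' := linked_rot Hphi L; have [bd db _ _ _] := linked_sbd Hphi L'.
have ba := lt_trans bc ca; have cb : c < b + T by rewrite (lt_trans ca)// ltrD2r.
have aTd : a + T < d + T by rewrite ltrD2r (lt_trans ac).
have [N sN] := sint_arcim_neq0 Hphi da aTd.
have [z sz] := sint_arcim_neq0 Hphi bc cb.
have sNc : sint (D c (a + T)) N by apply: sint_mono sN; apply: arcim_sub; rewrite ?lexx ?ltW.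
have sza : sint (D a c) z by apply: sint_mono sz; apply: arcim_sub; rewrite ?lexx ?ltW.
have sNd : sint (D d (b + T)) N by apply: sint_mono sN; apply: arcim_sub; rewrite ?lexx ?lerD2r ?ltW.
have szb : sint (D b d) z by apply: sint_mono sz; apply: arcim_sub; rewrite ?lexx ?ltW.
rewrite (Zpos_linked Hphi L sNc sza) (Zpos_linked Hphi L' sNd szb).
have T0 := tau_gt0 R.
have wE gam i j : i < j -> j < i + T -> jloop i j gam -> sint (D j (i + T)) N -> sint (D i j) z ->
    exists w, wnum N z gam w.
  move=> ij ji [cg _ _ _ [gs _]] sN' sz'; apply: wind_exists.
    have [SN' nN'] : S2 N /\ ~ D i j N by move: sN'; rewrite (sint_arcim Hphi) ?ltrD2r// (arcimT Hphi).
    have k t : S2 (gam t) /\ gam t <> N.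
      have /sbdE[k1 k2] := gs t; split; first exact: (arcim_S2 Hphi k1).
      by move=> e; apply: nN'; rewrite -e.
    have Dz := sint_sub sz'; have Sz := arcim_S2 Hphi Dz.
    have zN : z <> N by move=> e; apply: nN'; rewrite -e.
    move=> t; have [k1 k2] := k t; have [k3 k4] := k 0.
    by apply: (@continuous_Zc _ _ _ (fun=> N) (fun=> z) (fun=> gam 0) gam) => //;
      first [exact: continuous_at_cst | exact: cg].
  move=> t _; have [SN' nN'] : S2 N /\ ~ D i j N by move: sN'; rewrite (sint_arcim Hphi) ?ltrD2r// (arcimT Hphi).
  have Dz := sint_sub sz'; have Sz := arcim_S2 Hphi Dz.
  have k s : [/\ S2 (gam s), gam s <> N & gam s <> z].
    have /sbdE[k1 k2] := gs s; split; first exact: (arcim_S2 Hphi k1).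
      by move=> e; apply: nN'; rewrite -e.
    by move=> e; apply: k2; rewrite e.
  have [k1 k2 k3] := k t; have [k4 k5 k6] := k 0.
  by apply: Zc_neq0 => //; move=> e; apply: nN'; rewrite -e.
split.
  move=> [gam [u [J F hw]]] [gam' [u' [J' F' hw']]].
  have := linked_wnum_opp L J F J' F' sN sz hw hw'.
  by have := T0; lra.
move=> H.
have [gam [u [J F pm]]] := jloop_first_exists Hphi L.
have [gam' [u' [J' F' pm']]] := jloop_first_exists Hphi L'.
have [w hw] := wE gam a c ac ca J sNc sza.
have [w' hw'] := wE gam' b d bd db J' sNd szb.
exists gam, u; split=> //.
have [<- //|wT] := pm _ _ _ sNc sza hw.
case: H; exists gam', u'; split=> //.
by have := linked_wnum_opp L J F J' F' sN sz hw hw'; rewrite wT opprK => <-.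
Qed.

End SignAlternation.

(** * Pairs of each sign *)

Section PairCombinatorics.
Variable R : realType.
Notation P2 := (R * R)%type.
Notation P3 := (R * R * R)%type.
Notation T := (tau R).
Variable phi : R -> P3.
Hypothesis Hphi : catherine_line phi.
Notation D := (arcim phi).
Notation linked := (linked phi).
Notation Zpos := (Zpos phi).

(** The boundary of [D a b] has a point other than [phi a], for instance the one opposite to it in a
    parametrisation, and it is a value of [phi] on both complementary arcs. *)
Lemma crossing_exists a b : a < b -> b < a + T -> phi a = phi b ->
  exists c d, linked a c b d.
Proof.
move=> ab ba eab; have T0 := tau_gt0 R.
have [g [h [N [dp SN nD]]]] := arcim_disk Hphi ab ba.
have [_ sA _] := (let: And4 _ _ _ H := Hphi in H) a b ab ba.
have [al _ gA] := boundary_cover Hphi 0 ab ba dp sA.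
pose y := g (expi (al + T / 2)).
have yA : y <> phi a.
  by rewrite gA; apply: nesym; apply: (boundary_inj dp); lra.
have := boundary_point Hphi (al + T / 2) ab ba dp; rewrite -/y (sbd_arcim Hphi) //.
move=> [[c /= /andP[c1 c2] ec] [d /= /andP[d1 d2] ed]].
exists c, d; split.
- by rewrite lt_neqAle c1 andbT; apply/eqP => e; apply: yA; rewrite -ec e.
- by rewrite lt_neqAle c2 andbT; apply/eqP => e; apply: yA; rewrite -ec e eab.
- by rewrite lt_neqAle d1 andbT; apply/eqP => e; apply: yA; rewrite -ed -e eab.
- by rewrite lt_neqAle d2 andbT; apply/eqP => e; apply: yA; rewrite -ed e (phiT Hphi).
- by split=> //; [rewrite ec ed|rewrite ec; exact: nesym].
Qed.

(** Both readings of the pair have the sign opposite to that of a pair crossing it. *)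
Lemma Zpos_compl a b : a < b -> b < a + T -> phi a = phi b -> Zpos a b <-> Zpos b (a + T).
Proof.
move=> ab ba eab; have [c [d L]] := crossing_exists ab ba eab.
rewrite (linked_sign Hphi L) (linked_sign Hphi (linked_rot Hphi L)).
by split=> [H|H K]; [exact: contrapT|exact: K].
Qed.

Lemma ZposT a b : a < b -> b < a + T -> phi a = phi b -> Zpos (a + T) (b + T) <-> Zpos a b.
Proof.
move=> ab ba eab; rewrite (Zpos_compl ab ba eab) (@Zpos_compl b (a + T))//.
  by rewrite ltrD2r.
by rewrite (phiT Hphi).
Qed.

Lemma touching_sign a b c s t : a < s -> s < b -> b < t -> t < c -> c < a + T ->
  phi a = phi b -> phi b = phi c -> phi s = phi t -> phi s <> phi a -> Zpos a b <-> Zpos b c.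
Proof.
move=> as_ sb bt tc ca e1 e2 est ne.
have L1 : linked a s b t by split=> //; [rewrite (lt_trans tc)|split=> //; exact: nesym].
have L2 : linked s b t c by split=> //; [rewrite (lt_trans ca)// ltrD2r|split=> //; rewrite -e1].
rewrite (linked_sign Hphi L1) (linked_sign Hphi L2).
by split=> [H|H K]; [exact: contrapT|exact: K].
Qed.

(** The pair crossing one side of the triangle ends on one of the other two arcs, hence crosses a
    second side, and these two sides have the same sign by [touching_sign]. Doing this for each side
    gives three alternatives, which together force all signs to agree. *)
Lemma Zpos_triple a b c : a < b -> b < c -> c < a + T -> phi a = phi b -> phi b = phi c ->
  (Zpos a b <-> Zpos b c) /\ (Zpos a b <-> Zpos a c).
Proof.
move=> ab bc ca e1 e2.
have ac := lt_trans ab bc; have ba := lt_trans bc ca; have cb : c < b + T by rewrite (lt_trans ca)// ltrD2r.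
have aTcT : a + T < c + T by rewrite ltrD2r.
have e3 : phi c = phi (a + T) by rewrite (phiT Hphi) e1.
have e13 : phi a = phi c by rewrite e1.
have [s1 [t1 [q1 q2 q3 q4 [q5 q6 q7]]]] := crossing_exists ab ba e1.
have [s2 [t2 [r1 r2 r3 r4 [r5 r6 r7]]]] := crossing_exists bc cb e2.
have [s3 [t3 [p1 p2 p3 p4 [p5 p6 p7]]]] := crossing_exists ca aTcT e3.
have ZT := ZposT ab ba e1; have Zc := Zpos_compl ac ca e13.
have k12 s t : a < s -> s < b -> b < t -> t < c -> phi s = phi t -> phi s <> phi a -> Zpos a b <-> Zpos b c.
  by move=> *; apply: (@touching_sign a b c s t).
have k23 s t : b < s -> s < c -> c < t -> t < a + T -> phi s = phi t -> phi s <> phi b -> Zpos b c <-> Zpos c (a + T).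
  by move=> *; apply: (@touching_sign b c (a + T) s t) => //; rewrite ltrD2r.
have k31 s t : c < s -> s < a + T -> a + T < t -> t < b + T -> phi s = phi t -> phi s <> phi c -> Zpos c (a + T) <-> Zpos a b.
  move=> *; rewrite -ZT; apply: (@touching_sign c (a + T) (b + T) s t) => //; first by rewrite ltrD2r.
  by rewrite !(phiT Hphi).
have x1 : (Zpos a b <-> Zpos b c) \/ (Zpos c (a + T) <-> Zpos a b).
  have [h|h|h] := ltgtP t1 c.
  - by left; apply: (k12 s1 t1) => //; exact: nesym.
  - right; apply: (k31 t1 (s1 + T)); rewrite ?ltrD2r// ?(phiT Hphi)//.
    by rewrite -q6 -e2 -e1; exact: nesym.
  - by case: q7; rewrite q6 h -e2.
have x2 : (Zpos b c <-> Zpos c (a + T)) \/ (Zpos a b <-> Zpos b c).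
  have [h|h|h] := ltgtP t2 (a + T).
  - by left; apply: (k23 s2 t2) => //; exact: nesym.
  - right; apply: (k12 (t2 - T) s2); rewrite ?ltrBrDr ?ltrBlDr//.
    + by rewrite r6 -[in RHS](subrK T t2) (phiT Hphi).
    + by have := phiT Hphi (t2 - T); rewrite subrK => <-; rewrite -r6 e1; exact: nesym.
  - by case: r7; rewrite r6 h (phiT Hphi) e1.
have x3 : (Zpos c (a + T) <-> Zpos a b) \/ (Zpos b c <-> Zpos c (a + T)).
  have [h|h|h] := ltgtP t3 (b + T).
  - by left; apply: (k31 s3 t3) => //; exact: nesym.
  - right; apply: (k23 (t3 - T) s3); rewrite ?ltrBrDr ?ltrBlDr//.
    + by rewrite p6 -[in RHS](subrK T t3) (phiT Hphi).
    + by have := phiT Hphi (t3 - T); rewrite subrK => <-; rewrite -p6 e2; exact: nesym.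
  - by case: p7; rewrite p6 h (phiT Hphi) e2.
move: ZT Zc x1 x2 x3; clear; tauto.
Qed.

Lemma closed_ends (gam : R -> P3) (E : set P3) v w : v < w -> continuous gam -> closed E ->
  (forall t, v < t < w -> E (gam t)) -> E (gam v) /\ E (gam w).
Proof.
move=> vw cg cE H.
have key x : (forall e, 0 < e -> exists2 t, v < t < w & `|x - t| < e) -> E (gam x).
  move=> Hx; apply: contrapT => nE.
  have : nbhs (gam x) (~` E) by apply: open_nbhs_nbhs; split=> //; rewrite openC.
  move=> /(cg x) /nbhs_ballP[e /= e0 he]; have [t ht xt] := Hx e e0.
  by apply: (he t); [rewrite -ball_normE|exact: H].
split; apply: key => e e0.
  pose d := Num.min e (w - v); have d0 : 0 < d by rewrite lt_min e0 subr_gt0.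
  have [de dw] : d <= e /\ d <= w - v by rewrite !ge_min !lexx orbT.
  exists (v + d / 2); first by apply/andP; split; lra.
  by rewrite opprD addrA subrr add0r normrN gtr0_norm ?divr_gt0//; lra.
pose d := Num.min e (w - v); have d0 : 0 < d by rewrite lt_min e0 subr_gt0.
have [de dw] : d <= e /\ d <= w - v by rewrite !ge_min !lexx orbT.
exists (w - d / 2); first by apply/andP; split; lra.
by rewrite opprB addrC subrK gtr0_norm ?divr_gt0//; lra.
Qed.

(* The fibres over an open arc of the boundary of [D a b] sweep from [phi b]
   to [phi a], hence one of them (possibly that of an endpoint) crosses both
   [(a, b)] and the given pair [(s1, t1)]. *)
Lemma opposite_crossing a b s1 t1 (gam : R -> P3) v w :
  a < s1 -> s1 < b -> b < t1 -> t1 < a + T -> phi a <> phi b ->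
  phi s1 = phi t1 -> phi s1 <> phi a -> phi s1 <> phi b ->
  continuous gam -> v < w -> gam v = phi b -> gam w = phi a ->
  (forall t, v < t < w -> [/\ sbd (D a b) (gam t), gam t <> phi a, gam t <> phi b & gam t <> phi s1]) ->
  exists c d, [/\ a < c < b, b < d < a + T, phi c = phi d & Zpos c d <-> ~ Zpos s1 t1].
Proof.
move=> as1 s1b bt1 t1a ne est nA nB cg vw gv gw H; have T0 := tau_gt0 R.
have ab := lt_trans as1 s1b; have ba := lt_trans bt1 t1a.
have st := lt_trans s1b bt1; have ts : t1 < s1 + T by rewrite (lt_trans t1a)// ltrD2r.
have aT := phiT Hphi.
have neq x y (p q : R) : x <> y -> phi p = x -> phi q = y -> p != q.
  by move=> xy ep eq; apply: contra_notN xy => /eqP e; rewrite -ep -eq e.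
have lt1 (p q : R) : p <= q -> p != q -> p < q by move=> h1 h2; rewrite lt_neqAle h2.
(* The points [a], [s1], [b], [t1] cut the circle into arcs numbered 1 to 4; a fibre joining
   opposite arcs crosses both pairs. *)
have Q13 p q : a < p -> p < s1 -> b < q -> q < t1 -> phi p = phi q -> phi p <> phi s1 ->
    exists c d, [/\ a < c < b, b < d < a + T, phi c = phi d & Zpos c d <-> ~ Zpos s1 t1].
  move=> h1 h2 h3 h4 e en; exists p, q; split=> //.
  - by rewrite h1 (lt_trans h2).
  - by rewrite h3 (lt_trans h4).
  - by apply: (linked_sign Hphi); split=> //; [exact: lt_trans h3|rewrite (lt_trans t1a)// ltrD2r].
have Q24 p q : s1 < p -> p < b -> t1 < q -> q < a + T -> phi p = phi q -> phi p <> phi s1 ->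
    exists c d, [/\ a < c < b, b < d < a + T, phi c = phi d & Zpos c d <-> ~ Zpos s1 t1].
  move=> h1 h2 h3 h4 e en; exists p, q; split=> //.
  - by rewrite h2 andbT (lt_trans as1).
  - by rewrite h4 andbT (lt_trans bt1).
  - have L : linked s1 p t1 q.
      split=> //; [exact: lt_trans bt1|by rewrite (lt_trans h4)// ltrD2r|split=> //; exact: nesym].
    by rewrite (linked_sign Hphi L); split=> [K|/contrapT//] K'; exact: K'.
have decomp t : v < t < w -> exists p q, [/\ a < p < b, b < q < a + T, phi p = gam t & phi q = gam t].
  move=> /H[sb qA qB _]; move: sb; rewrite (sbd_arcim Hphi) // => -[[p /= /andP[p1 p2] ep] [q /= /andP[q1 q2] eq]].
  exists p, q; split=> //; apply/andP; split; apply: lt1 => //.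
  - exact: (neq _ _ _ _ (nesym qA)).
  - exact: (neq _ _ _ _ qB).
  - exact: (neq _ _ _ _ (nesym qB)).
  - by apply: (neq _ _ _ _ qA) => //; rewrite aT.
(* If some point of the boundary arc is hit on both sides of [{s1, t1}], two of its preimages lie in
   opposite arcs. *)
have [[t [ht [E1 E2]]]|nn] := pselect (exists t, [/\ v < t < w & D s1 t1 (gam t) /\ D t1 (s1 + T) (gam t)]).
  have [p [q [/andP[ap pb] /andP[bq qa] ep eq]]] := decomp t ht.
  have [_ qA qB qY] := H t ht.
  have [s /= /andP[h1 h2] es] := E1; have [s' /= /andP[h1' h2'] es'] := E2.
  have {}h1 : s1 < s by apply: lt1 => //; apply: (neq _ _ _ _ (nesym qY)).
  have {}h2 : s < t1 by apply: lt1 => //; apply: (neq _ _ _ _ qY).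
  have {}h1' : t1 < s' by apply: lt1 => //; apply: (neq _ _ _ _ (nesym qY)).
  have {}h2' : s' < s1 + T by apply: lt1 => //; apply: (neq _ _ _ _ qY) => //; rewrite aT.
  have sb : s != b by apply: (neq _ _ _ _ qB).
  have s'a : s' != a + T by apply: (neq _ _ _ _ qA) => //; rewrite aT.
  have ps : p != s1 by apply: (neq _ _ _ _ qY).
  have qt : q != t1 by apply: (neq _ _ _ _ qY).
  have [k1|k1|k1] := ltgtP p s1; last by rewrite k1 eqxx in ps.
    have [k2|k2|k2] := ltgtP q t1; last by rewrite k2 eqxx in qt.
      by apply: (Q13 p q); rewrite ?ep ?eq.
    have [k3|k3|k3] := ltgtP s b; last by rewrite k3 eqxx in sb.
      by apply: (Q24 s q); rewrite ?es ?eq.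
    by apply: (Q13 p s); rewrite ?es ?ep.
  have [k2|k2|k2] := ltgtP q t1; last by rewrite k2 eqxx in qt.
    have [k3|k3|k3] := ltgtP s' (a + T); last by rewrite k3 eqxx in s'a.
      by apply: (Q24 p s'); rewrite ?es' ?ep.
    have es2 : phi (s' - T) = gam t by rewrite -es' -[in RHS](subrK T s') aT.
    by apply: (Q13 (s' - T) q); rewrite ?es2 ?eq// ?ltrBrDr ?ltrBlDr.
  by apply: (Q24 p q); rewrite ?ep ?eq.
have clE i j : i < j -> j < i + T -> closed (D i j) := arcim_closed Hphi (a := i) (b := j).
have cov x : v < x < w -> D s1 t1 (gam x) \/ D t1 (s1 + T) (gam x).
  move=> hx; apply: (arcim_cover Hphi); have [/sbdE[h _] _ _ _] := H x hx.
  exact: (arcim_S2 Hphi h).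
have dis x : v < x < w -> ~ (D s1 t1 (gam x) /\ D t1 (s1 + T) (gam x)).
  by move=> hx [h1 h2]; apply: nn; exists x.
have [] := itv_open_sub cg (clE _ _ st ts) (clE _ _ ts (ltac:(by rewrite ltrD2r) : s1 + T < t1 + T)) cov dis.
(* Here all fibres join arcs 2 and 3. In the limit [phi a] is attained on both, at [s] and [t], and
   by [Zpos_triple] the pair [(s, t)] has the sign of [(a, s)], which is linked with [(s1, t1)]. *)
- move=> allE.
  have hh t : v < t < w -> D s1 b (gam t) /\ D b t1 (gam t).
    move=> ht; have [p [q [/andP[ap pb] /andP[bq qa] ep eq]]] := decomp t ht.
    have nE' : ~ D t1 (s1 + T) (gam t) by move=> k; apply: (dis t ht); split=> //; exact: allE.
    split.
      rewrite -ep; apply: arcim_mem; last exact: ltW.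
      rewrite leNgt; apply/negP => k; apply: nE'; rewrite -ep -aT; apply: arcim_mem; rewrite ?lerD2r ?ltW//.
      by rewrite (lt_trans t1a)// ltrD2r.
    rewrite -eq; apply: arcim_mem; first exact: ltW.
    rewrite leNgt; apply/negP => k; apply: nE'; rewrite -eq; apply: arcim_mem; rewrite ?ltW//.
    by rewrite (lt_trans qa)// ltrD2r.
  have [_ E1] := closed_ends vw cg (clE _ _ s1b (lt_trans ba (ltac:(by rewrite ltrD2r) : a + T < s1 + T))) (fun t ht => (hh t ht).1).
  have [_ E2] := closed_ends vw cg (clE _ _ bt1 (lt_trans t1a (ltac:(by rewrite ltrD2r) : a + T < b + T))) (fun t ht => (hh t ht).2).
  rewrite gw in E1 E2; have [s /= /andP[h1 h2] es] := E1; have [t /= /andP[h3 h4] et] := E2.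
  have {}h1 : s1 < s by apply: lt1 => //; apply: (neq _ _ _ _ nA).
  have {}h2 : s < b by apply: lt1 => //; apply: (neq _ _ _ _ ne).
  have {}h3 : b < t by apply: lt1 => //; apply: (neq _ _ _ _ (nesym ne)).
  have {}h4 : t < t1 by apply: lt1 => //; apply: (neq _ _ _ _ (nesym nA)).
  exists s, t; split; [by rewrite (lt_trans as1)|by rewrite h3 (lt_trans h4)|by rewrite es et|].
  have [k1 k2] : (Zpos a s <-> Zpos s t) /\ (Zpos a s <-> Zpos a t).
    apply: Zpos_triple => //; [exact: lt_trans as1 _|exact: lt_trans h3|exact: lt_trans t1a|by rewrite es et].
  rewrite -k1; apply: (linked_sign Hphi); split=> //; first exact: lt_trans bt1.
  by split=> //; exact: nesym.
(* Here all fibres join arcs 4 and 1, and the limit at [v] gives two further preimages of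
   [phi b]. *)
- move=> allE'.
  have hh t : v < t < w -> D a s1 (gam t) /\ D t1 (a + T) (gam t).
    move=> ht; have [p [q [/andP[ap pb] /andP[bq qa] ep eq]]] := decomp t ht.
    have nE : ~ D s1 t1 (gam t) by move=> k; apply: (dis t ht); split=> //; exact: allE'.
    split.
      rewrite -ep; apply: arcim_mem; first exact: ltW.
      rewrite leNgt; apply/negP => k; apply: nE; rewrite -ep; apply: arcim_mem; rewrite ?ltW//.
      exact: lt_trans bt1.
    rewrite -eq; apply: arcim_mem; last exact: ltW.
    rewrite leNgt; apply/negP => k; apply: nE; rewrite -eq; apply: arcim_mem; rewrite ?ltW//.
    exact: lt_trans bq.
  have [E1 _] := closed_ends vw cg (clE _ _ as1 (lt_trans s1b ba)) (fun t ht => (hh t ht).1).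
  have [E2 _] := closed_ends vw cg (clE _ _ t1a (ltac:(by rewrite ltrD2r (lt_trans as1)) : a + T < t1 + T)) (fun t ht => (hh t ht).2).
  rewrite gv in E1 E2; have [s /= /andP[h1 h2] es] := E1; have [t /= /andP[h3 h4] et] := E2.
  have {}h1 : a < s by apply: lt1 => //; apply: (neq _ _ _ _ ne).
  have {}h2 : s < s1 by apply: lt1 => //; apply: (neq _ _ _ _ (nesym nB)).
  have {}h3 : t1 < t by apply: lt1 => //; apply: (neq _ _ _ _ nB) => //; rewrite -est.
  have {}h4 : t < a + T by apply: lt1 => //; apply: (neq _ _ _ _ (nesym ne)); rewrite ?aT.
  exists s, t; split; [by rewrite h1 (lt_trans h2)|by rewrite h4 andbT (lt_trans bt1)|by rewrite es et|].
  have [k1 k2] : (Zpos s b <-> Zpos b t) /\ (Zpos s b <-> Zpos s t).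
    apply: Zpos_triple => //; [exact: lt_trans s1b|exact: lt_trans h3|by rewrite (lt_trans h4)// ltrD2r].
  have L : linked s1 b t1 t.
    by split=> //; rewrite (lt_trans h4)// ltrD2r.
  by rewrite -k2 k1 (linked_sign Hphi L); split=> [K|/contrapT//] K'; exact: K'.
Qed.

End PairCombinatorics.

(** * The closed relations given by the two signs *)

Section SignedPairs.
Variable R : realType.
Notation P2 := (R * R)%type.
Notation P3 := (R * R * R)%type.
Notation T := (tau R).
Variable phi : R -> P3.
Hypothesis Hphi : catherine_line phi.
Notation D := (arcim phi).
Notation Zpos := (Zpos phi).

(* [s = true] stands for the positive sign, where [Z^+] is empty. *)
Definition signed (s : bool) (a b : R) :=
  [/\ a < b, b < a + T, phi a = phi b & if s then ~ Zpos a b else Zpos a b].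

Lemma signed_or s a b : a < b -> b < a + T -> phi a = phi b -> signed s a b \/ signed (~~ s) a b.
Proof.
by move=> ab ba e; have [h|h] := pselect (Zpos a b); case: s; [right|left|left|right].
Qed.

Lemma signed_excl s a b : signed s a b -> signed (~~ s) a b -> False.
Proof. by move=> [_ _ _ h] [_ _ _ h']; case: s h h'. Qed.

Lemma signed_equiv s a b a' b' : a' < b' -> b' < a' + T -> phi a' = phi b' ->
  (Zpos a b <-> Zpos a' b') -> signed s a b -> signed s a' b'.
Proof. by move=> h1 h2 h3 e [_ _ _ h]; split=> //; case: s h; rewrite e. Qed.

Lemma signed_compl s a b : signed s a b -> signed s b (a + T).
Proof.
move=> h; case: (h) => ab ba e _; apply: signed_equiv h => //; first by rewrite ltrD2r.
  by rewrite (phiT Hphi).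
exact: (Zpos_compl Hphi).
Qed.

Lemma signedT s a b : signed s (a + T) (b + T) <-> signed s a b.
Proof.
split=> h; last exact/signed_compl/signed_compl.
case: (h) => h1 h2 h3 _; rewrite !ltrD2r in h1 h2; rewrite !(phiT Hphi) in h3.
apply: signed_equiv h => //; exact: (ZposT Hphi).
Qed.

Lemma signedTz s a b (k : int) : signed s (a + T * k%:~R) (b + T * k%:~R) <-> signed s a b.
Proof.
have nat_case (n : nat) a' b' : signed s (a' + T * n%:R) (b' + T * n%:R) <-> signed s a' b'.
  elim: n a' b' => [|n IH] a' b'; first by rewrite mulr0 !addr0.
  have -> : n.+1%:R = n%:R + 1 :> R by rewrite -natr1.
  by rewrite mulrDr mulr1 !addrA signedT.
case: k => n; first by rewrite -pmulrn.
rewrite NegzE mulrNz -pmulrn -(nat_case n.+1 (a + _)).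
by rewrite -!addrA -mulrDr addNr mulr0 !addr0.
Qed.

Lemma signed_triple s a b c : a < b -> b < c -> c < a + T -> phi a = phi b -> phi b = phi c ->
  (signed s a b <-> signed s b c) /\ (signed s a b <-> signed s a c).
Proof.
move=> ab bc ca e1 e2; have [k1 k2] := Zpos_triple Hphi ab bc ca e1 e2.
have ba := lt_trans bc ca; have cb : c < b + T by rewrite (lt_trans ca)// ltrD2r.
have ac := lt_trans ab bc; have e3 : phi a = phi c by rewrite e1.
by split; split; apply: signed_equiv => //; rewrite -?k1 -?k2.
Qed.

Lemma signed_unlinked s a b c d : a < b -> b < c -> c < d -> d < a + T ->
  signed s a c -> signed s b d -> phi a = phi b.
Proof.
move=> ab bc cd da [_ _ e1 z1] [_ _ e2 z2]; apply: contrapT => ne.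
have L : linked phi a b c d by [].
by have := linked_sign Hphi L; case: s z1 z2 => z1 z2 [h1 h2]; [apply: z1; exact: h2|apply: h1].
Qed.

(** A pair of the wrong sign is crossed by one of the right sign. If [phi a <> phi b], a boundary
    point of [D a b] provides a crossing pair, and [opposite_crossing] replaces it when its sign is
    wrong. *)
Lemma signed_cross s a b : a < b -> b < a + T -> ~ signed s a b ->
  exists c d, [/\ a < c < b, b < d < a + T & signed s c d].
Proof.
move=> ab ba nab; have T0 := tau_gt0 R.
have [eab|nab'] := pselect (phi a = phi b).
  have [c [d L]] := crossing_exists Hphi ab ba eab; have [h1 h2 h3 h4 [h5 h6 h7]] := L.
  exists c, d; split; [by rewrite h1|by rewrite h3|].
  have [//|hs] := signed_or s ab ba eab; case: hs => _ _ _ hs.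
  split=> //; [exact: lt_trans h3|by rewrite (lt_trans h4)// ltrD2r|].
  by have := linked_sign Hphi L; case: (s) hs => hs [k1 k2]; [exact: k1|apply: contrapT => k; exact: hs (k2 k)].
have [g [h [N [dp SN nD]]]] := arcim_disk Hphi ab ba.
have [_ sA sB] := (let: And4 _ _ _ H := Hphi in H) a b ab ba.
have [al [be [ab' ba' gA gB [gd1 gd2 _]]]] := boundary_arcs Hphi ab ba dp sA sB nab'.
pose m := (al + be) / 2; have hm : al < m < be by rewrite /m; apply/andP; split; lra.
have [sm mA mB] := gd1 _ hm.
have := sm; rewrite (sbd_arcim Hphi) // => -[[s1 /= /andP[p1 p2] es] [t1 /= /andP[q1 q2] et]].
have as1 : a < s1 by rewrite lt_neqAle p1 andbT; apply/eqP => e; apply: mA; rewrite -es e.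
have s1b : s1 < b by rewrite lt_neqAle p2 andbT; apply/eqP => e; apply: mB; rewrite -es e.
have bt1 : b < t1 by rewrite lt_neqAle q1 andbT; apply/eqP => e; apply: mB; rewrite -et e.
have t1a : t1 < a + T.
  by rewrite lt_neqAle q2 andbT; apply/eqP => e; apply: mA; rewrite -et e (phiT Hphi).
have est : phi s1 = phi t1 by rewrite es et.
have st := lt_trans s1b bt1; have ts : t1 < s1 + T by rewrite (lt_trans t1a)// ltrD2r.
have [hs|[_ _ _ hs]] := signed_or s st ts est.
  by exists s1, t1; split=> //; apply/andP.
have cg : continuous (fun t => g (expi t)).
  by have ce := @continuous_expi R; case: (dp) => cg _ _ _ _ t; cont.
have gw : g (expi (al + T)) = phi a by rewrite expiDT.
(* The second boundary arc, from [be] to [al + T], is used because it avoids the point at [m], which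
   is [phi s1]. *)
have [|||c [d [/andP[h1 h2] /andP[h3 h4] e Z]]] :=
  opposite_crossing Hphi as1 s1b bt1 t1a nab' est _ _ cg ba' gB gw.
- by rewrite es.
- by rewrite es.
- move=> t ht; have [k1 k2 k3] := gd2 t ht; split=> //; rewrite es.
  by case/andP: ht => t1' t2'; apply: nesym; apply: (boundary_inj dp); move: hm => /andP[]; lra.
exists c, d; split; [by rewrite h1|by rewrite h3|split=> //].
- exact: lt_trans h3.
- by rewrite (lt_trans h4)// ltrD2r.
- by case: (s) hs => hs; [move=> k; exact: (Z.1 k)|exact: Z.2].
Qed.

(** Signed pairs together with their degenerate limits, where the two points of the circle coincide:
    [p.2 = p.1] or [p.2 = p.1 + T]. *)
Definition weak_pair (s : bool) (p : P2) :=
  [/\ p.1 <= p.2, p.2 <= p.1 + T, phi p.1 = phi p.2 & p.1 < p.2 -> p.2 < p.1 + T -> signed s p.1 p.2].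

Lemma nbhs_lt_cont (S : topologicalType) (F G : S -> R) x : continuous F -> continuous G ->
  F x < G x -> \forall y \near x, F y < G y.
Proof.
move=> cF cG h; have c : continuous (fun y => G y - F y) by move=> y; cont.
have : nbhs (G x - F x) [set r | 0 < r].
  by apply: open_nbhs_nbhs; split; [exact: open_gt|rewrite /= subr_gt0].
move=> /(c x) H; have {}H : nbhs x (fun y => 0 < G y - F y) := H.
by apply: filterS H => y; rewrite subr_gt0.
Qed.

(** If [phi t = phi u] but [(t, u)] does not have the sign, it is crossed by a pair [(c, d)] of the
    sign, which is in another fibre by [signed_triple]. That pair also crosses every pair close to
    [(t, u)], which by [signed_unlinked] cannot have the sign either. *)
Lemma closed_weak_pair s : closed (weak_pair s).
Proof.
have cphi := phi_continuous Hphi.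
have c1 : continuous (fun p : P2 => p.1) by move=> p; cont.
have c2 : continuous (fun p : P2 => p.2) by move=> p; cont.
have c1T : continuous (fun p : P2 => p.1 + T) by move=> p; cont.
rewrite -openC openE => -[t u] nW; rewrite /interior.
have W (P : P2 -> Prop) : (\forall p \near (t, u), P p) -> (forall p, P p -> ~ weak_pair s p) ->
   nbhs (t, u) (~` weak_pair s) by move=> h1 h2; apply: filterS h1 => p; exact: h2.
have [tu|ut] := leP t u; last first.
  apply: (W (fun p => p.2 < p.1)); first exact: nbhs_lt_cont.
  by move=> p h [h1 _ _ _]; move: (lt_le_trans h h1); rewrite ltxx.
have [uT|Tu] := leP u (t + T); last first.
  apply: (W (fun p => p.1 + T < p.2)); first exact: (nbhs_lt_cont c1T c2).
  by move=> p h [_ h1 _ _]; move: (lt_le_trans h h1); rewrite ltxx.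
have sep (F G : P2 -> P3) : continuous F -> continuous G -> F (t, u) <> G (t, u) -> \forall p \near (t, u), F p <> G p.
  move=> cF cG ne; have cl : closed [set x : P3 | x = 0].
    by apply: accessible_closed_set1; apply: hausdorff_accessible; exact: norm_hausdorff.
  have cFG : continuous (fun p => F p - G p) by move=> p; apply: cvgB; [exact: cF|exact: cG].
  have : nbhs (F (t, u) - G (t, u)) (~` [set x : P3 | x = 0]).
    by apply: open_nbhs_nbhs; split; [rewrite openC|move=> /eqP; rewrite subr_eq0 => /eqP].
  move=> /(cFG (t, u)) H; have {}H : nbhs (t, u) (fun p => ~ (F p - G p = 0)) := H.
  by apply: filterS H => p h e; apply: h; rewrite e subrr.
have [e|ne] := pselect (phi t = phi u); last first.
  apply: (W (fun p => phi p.1 <> phi p.2)).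
    by apply: (@sep (fun p => phi p.1) (fun p => phi p.2)) => // p; cont.
  by move=> p h [_ _ h1 _].
have [tu' uT'] : t < u /\ u < t + T.
  split; rewrite ltNge; apply/negP => h; apply: nW; split=> //= h1 h2.
    by move: (lt_le_trans h1 h); rewrite ltxx.
  by move: (lt_le_trans h2 h); rewrite ltxx.
have nS : ~ signed s t u by move=> h; apply: nW; split.
have [c [d [/andP[tc cu] /andP[ud dt] scd]]] := signed_cross tu' uT' nS.
have [cd dc ecd _] := scd.
have ne : phi t <> phi c.
  move=> etc; apply: nS.
  have dcT := lt_trans dt (ltac:(by rewrite ltrD2r) : t + T < c + T).
  have [k1 _] := signed_triple s tc cu uT' etc (etrans (esym etc) e).
  have [k2 k3] := signed_triple s cu ud dcT (etrans (esym etc) e) (etrans (esym (etrans (esym etc) e)) ecd).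
  have [_ k4] := signed_triple s tc cu uT' etc (etrans (esym etc) e).
  by rewrite -k4 k1 k3.
apply: (W (fun p => [/\ p.1 < c, c < p.2, p.2 < d & d < p.1 + T /\ phi p.1 <> phi c])).
  have n1 : \forall p \near (t, u), p.1 < c by apply: (nbhs_lt_cont c1); [exact: cst_continuous|].
  have n2 : \forall p \near (t, u), c < p.2 by apply: (@nbhs_lt_cont _ (fun=> c) _ _ _ c2); [exact: cst_continuous|].
  have n3 : \forall p \near (t, u), p.2 < d by apply: (nbhs_lt_cont c2); [exact: cst_continuous|].
  have n4 : \forall p \near (t, u), d < p.1 + T by apply: (@nbhs_lt_cont _ (fun=> d) _ _ _ c1T); [exact: cst_continuous|].
  have n5 : \forall p \near (t, u), phi p.1 <> phi c.
    by apply: (@sep (fun p => phi p.1) (fun=> phi c)) => // p; [cont|exact: cst_continuous].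
  by near=> p; split; [near: p|near: p|near: p|split; near: p].
move=> p [h1 h2 h3 [h4 h5]] [_ _ _ K]; apply: h5.
have h6 := lt_trans h1 h2; have h7 := lt_trans h3 h4.
exact: (signed_unlinked h1 h2 h3 h4 (K h6 h7) scd).
Unshelve. all: by end_near. Qed.

End SignedPairs.

(** * Convex hulls of classes *)

Section Chords.
Variable R : realType.
Notation P2 := (R * R)%type.
Notation T := (tau R).

Definition orient (a b x : P2) : R := cross2 (sub2 b a) (sub2 x a).
(** Negative on the arc from [a] to [b], positive on the arc from [b] to [a + T]; a positive value
    means that the chord separates [x] from the arc from [a] to [b]. *)
Definition side (a b : R) (x : P2) : R := orient (expi a) (expi b) x.

Lemma side_opp a b x : side b a x = - side a b x.
Proof. by rewrite /side /orient /cross2 /sub2 /=; ring. Qed.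

Lemma side_self a b : side a b (expi a) = 0.
Proof. by rewrite /side /orient /cross2 /sub2 /= !subrr !mulr0 subrr. Qed.
Lemma side_self2 a b : side a b (expi b) = 0.
Proof. by rewrite /side /orient /cross2 /sub2 /=; ring. Qed.

Lemma sideT1 a b x : side (a + T) b x = side a b x.
Proof. by rewrite /side expiDT. Qed.
Lemma sideT2 a b x : side a (b + T) x = side a b x.
Proof. by rewrite /side expiDT. Qed.

(* With [u = b - a], the chord direction is [2 sin (u / 2)] times the unit
   tangent at [a] turned by [u / 2] towards the centre. *)
Lemma side_half a b x : let h := (b - a) / 2 in
  side a b x = 2 * sin h * (cos h * (1 - dot2 x (expi a)) - sin h * cross2 (expi a) x).
Proof.
move=> h; have hb : b = a + (h + h) by rewrite /h; lra.
have ch := cos2sin2 h; have ca := cos2sin2 a.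
rewrite /side /orient /cross2 /sub2 /dot2 /= hb (cosD a) (sinD a) (cosD h h) (sinD h h).
move: (cos h) (sin h) (cos a) (sin a) ch ca => c s ca sa ch caa.
have e1 : c * c - s * s = 1 - 2 * s ^+ 2 by rewrite -!expr2; lra.
rewrite e1.
transitivity (2 * s * (c * ((ca ^+ 2 + sa ^+ 2) - (x.1 * ca + x.2 * sa)) - s * (ca * x.2 - sa * x.1))); last by rewrite caa.
ring.
Qed.

Lemma dot2_expi_lt1 (x : P2) a : sq2 x < 1 -> dot2 x (expi a) < 1.
Proof.
move=> hx; apply: disk_half_plane; first exact: ltW.
by move=> e; move: hx; rewrite e sq2_expi ltxx.
Qed.

Lemma half_in_pi (a b : R) : a < b -> b < a + T -> 0 < (b - a) / 2 < pi.
Proof. by rewrite /tau => h1 h2; apply/andP; split; lra. Qed.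

(** By [side_half], [side a b x <= 0] bounds the cotangent of [(b - a) / 2] by a ratio that does not
    depend on [b], and the cotangent decreases. *)
Lemma side_mono_r a b b' x : sq2 x < 1 -> a < b -> b < b' -> b' < a + T ->
  side a b x <= 0 -> side a b' x < 0.
Proof.
move=> hx ab bb ba; rewrite !side_half.
have h0 := half_in_pi ab (lt_trans bb ba); have h1 := half_in_pi (lt_trans ab bb) ba.
set h := (b - a) / 2 in h0 *; set h' := (b' - a) / 2 in h1 *.
have hh : h < h' by rewrite /h /h'; lra.
have s0 := sin_gt0_pi h0; have s1 := sin_gt0_pi h1.
have be0 : 0 < 1 - dot2 x (expi a) by rewrite subr_gt0 dot2_expi_lt1.
have s2 : 0 < sin (h' - h).
  by apply: sin_gt0_pi; move: h0 h1 => /andP[? ?] /andP[? ?]; apply/andP; split; lra.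
rewrite sinB in s2; move: (cross2 _ x) be0 => al; move: (1 - dot2 _ _) => be be0.
rewrite pmulr_rle0 ?mulr_gt0// pmulr_rlt0 ?mulr_gt0// !subr_le0 !subr_lt0 => H.
rewrite -(ltr_pM2l s0).
have : 0 < be * (sin h' * cos h - cos h' * sin h) by rewrite mulr_gt0.
have : 0 <= sin h' * (sin h * al - cos h * be) by rewrite mulr_ge0 ?(ltW s1)// subr_ge0.
nra.
Qed.

Lemma side_reflect a b (x : P2) : side (- b) (- a) (x.1, - x.2) = side a b x.
Proof. by rewrite /side /orient /cross2 /sub2 /= !cosN !sinN; ring. Qed.

Lemma side_mono_l a a' b x : sq2 x < 1 -> a' < a -> a < b -> b < a' + T ->
  side a b x <= 0 -> side a' b x < 0.
Proof.
move=> hx aa ab ba; rewrite -side_reflect -(side_reflect a').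
apply: side_mono_r; [by move: hx; rewrite /sq2 /= sqrrN|lra|lra|lra].
Qed.

Lemma side_mono a b a' b' x : sq2 x < 1 -> a' <= a -> a < b -> b <= b' -> b' < a' + T ->
  side a b x < 0 -> side a' b' x < 0.
Proof.
move=> hx; rewrite le_eqVlt => /orP[/eqP->|aa] ab; rewrite le_eqVlt => /orP[/eqP<-|bb] ba H //.
- exact: (side_mono_r hx ab bb ba (ltW H)).
- exact: (side_mono_l hx aa ab ba (ltW H)).
- apply: (side_mono_l hx aa (lt_trans ab bb) ba); apply/ltW.
  by apply: (side_mono_r hx ab bb _ (ltW H)); lra.
Qed.

Lemma side_pos a b c : a < b -> b < c -> c < a + T -> 0 < side a b (expi c).
Proof.
move=> ab bc ca; rewrite side_half.
have h0 := half_in_pi ab (lt_trans bc ca); have h1 := half_in_pi (lt_trans ab bc) ca.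
set h := (b - a) / 2 in h0 *; set h' := (c - a) / 2 in h1 *.
have s0 := sin_gt0_pi h0; have s1 := sin_gt0_pi h1.
have s2 : 0 < sin (h' - h).
  have -> : h' - h = (c - b) / 2 by rewrite /h /h'; lra.
  by apply/sin_gt0_pi/half_in_pi => //; rewrite (lt_trans ca)// ltrD2r.
have -> : dot2 (expi c) (expi a) = cos (h' + h') :> R.
  by rewrite /dot2 /= -cosB; congr cos; rewrite /h'; lra.
have -> : cross2 (expi a) (expi c) = sin (h' + h') :> R.
  have -> : h' + h' = c - a by rewrite /h'; lra.
  by rewrite sinB /cross2 /=; ring.
rewrite cosD sinD.
have -> : 2 * sin h * (cos h * (1 - (cos h' * cos h' - sin h' * sin h')) - sin h * (sin h' * cos h' + cos h' * sin h'))
   = 4 * sin h * sin h' * sin (h' - h).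
  rewrite sinB; have c2 := cos2sin2 h'.
  have -> : 1 - (cos h' * cos h' - sin h' * sin h') = 2 * sin h' ^+ 2.
    by rewrite -[X in X - _]c2; ring.
  ring.
by rewrite !mulr_gt0.
Qed.

Lemma side_neg a b c : a < b -> b < c -> c < a + T -> side a c (expi b) < 0.
Proof.
move=> ab bc ca; have := side_pos ab bc ca.
have -> : side a b (expi c) = - side a c (expi b).
  by rewrite /side /orient /cross2 /sub2 /=; ring.
by rewrite oppr_gt0.
Qed.

Definition in_triangle (p q r x : P2) := exists u v w : R,
  [/\ 0 <= u, 0 <= v, 0 <= w, u + v + w = 1 &
     x = (u * p.1 + v * q.1 + w * r.1, u * p.2 + v * q.2 + w * r.2)].

(** The barycentric coordinates are ratios of signed areas. *)
Lemma side_triangle a b c x : a < b -> b < c -> c < a + T ->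
  0 <= side a b x -> 0 <= side b c x -> 0 <= side c a x ->
  in_triangle (expi a) (expi b) (expi c) x.
Proof.
move=> ab bc ca; have := side_pos ab bc ca; rewrite /side.
move: (expi a) (expi b) (expi c) => p q r d0 h1 h2 h3.
set d := orient p q r in d0.
exists (orient q r x / d), (orient r p x / d), (orient p q x / d).
have dn : d != 0 by rewrite lt0r_neq0.
split; try by rewrite divr_ge0// ltW.
  by rewrite -!mulrDl (_ : _ + _ = d) ?divff// /d /orient /cross2 /sub2 /=; ring.
have e (y : P2) : y = (d * y.1 / d, d * y.2 / d).
  by rewrite ![d * _]mulrC !mulfK//; case: y.
rewrite [LHS]e; congr pair.
  have -> : d * x.1 = orient q r x * p.1 + orient r p x * q.1 + orient p q x * r.1.
    by rewrite /d /orient /cross2 /sub2 /=; ring.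
  by field.
have -> : d * x.2 = orient q r x * p.2 + orient r p x * q.2 + orient p q x * r.2.
  by rewrite /d /orient /cross2 /sub2 /=; ring.
by field.
Qed.

(** On the line through [p] and [q] one has [sq2 x = 1 + L * (l * (l - 1))], so [sq2 x <= 1]
    confines [l] to [[0, 1]]. *)
Lemma on_chord (p q x : P2) : sq2 p = 1 -> sq2 q = 1 -> p <> q -> sq2 x <= 1 -> orient p q x = 0 ->
  exists l : R, 0 <= l <= 1 /\ x = ((1 - l) * p.1 + l * q.1, (1 - l) * p.2 + l * q.2).
Proof.
move=> sp sq ne sx o0.
pose L := sq2 (sub2 q p).
have L0 : 0 < L.
  by rewrite lt_neqAle sq2_ge0 andbT; apply/eqP => /esym/sq2_eq0; apply: sub2_neq0; exact: nesym.
pose l := dot2 (sub2 x p) (sub2 q p) / L.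
have xE : x = ((1 - l) * p.1 + l * q.1, (1 - l) * p.2 + l * q.2).
  have Ln : L != 0 by rewrite lt0r_neq0.
  have e1 : L * (x.1 - p.1) = dot2 (sub2 x p) (sub2 q p) * (q.1 - p.1) - orient p q x * (q.2 - p.2).
    by rewrite /L /dot2 /orient /cross2 /sq2 /sub2 /=; ring.
  have e2 : L * (x.2 - p.2) = dot2 (sub2 x p) (sub2 q p) * (q.2 - p.2) + orient p q x * (q.1 - p.1).
    by rewrite /L /dot2 /orient /cross2 /sq2 /sub2 /=; ring.
  rewrite o0 mul0r subr0 in e1; rewrite o0 mul0r addr0 in e2.
  have lE : dot2 (sub2 x p) (sub2 q p) = l * L by rewrite /l divfK.
  rewrite lE in e1 e2.
  have f1 : x.1 - p.1 = l * (q.1 - p.1) by apply: (mulfI Ln); rewrite e1; ring.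
  have f2 : x.2 - p.2 = l * (q.2 - p.2) by apply: (mulfI Ln); rewrite e2; ring.
  by rewrite [LHS]surjective_pairing; congr pair; lra.
exists l; split=> //.
have : sq2 x = 1 + L * (l * (l - 1)).
  rewrite {1}xE /sq2 /=.
  have := sp; have := sq; rewrite /L /sq2 /sub2 /= => k1 k2.
  have -> : (q.1 - p.1) ^+ 2 + (q.2 - p.2) ^+ 2 = (q.1 ^+ 2 + q.2 ^+ 2) + (p.1 ^+ 2 + p.2 ^+ 2) - 2 * (p.1 * q.1 + p.2 * q.2) by ring.
  rewrite k1 k2.
  have -> : ((1 - l) * p.1 + l * q.1) ^+ 2 + ((1 - l) * p.2 + l * q.2) ^+ 2 =
    (1 - l) ^+ 2 * (p.1 ^+ 2 + p.2 ^+ 2) + l ^+ 2 * (q.1 ^+ 2 + q.2 ^+ 2) + 2 * l * (1 - l) * (p.1 * q.1 + p.2 * q.2) by ring.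
  by rewrite k1 k2; ring.
move=> e; have : L * (l * (l - 1)) <= 0 by lra.
rewrite pmulr_rle0// => H; apply/andP; split; nra.
Qed.

Lemma chord_triangle a b x : a < b -> b < a + T -> sq2 x <= 1 -> side a b x = 0 ->
  in_triangle (expi a) (expi b) (expi b) x.
Proof.
move=> ab ba sx s0.
have ne : expi a <> expi b :> P2.
  have : ang (sub2 (expi a) (expi b)) ((a + b) / 2 - pi / 2) by apply: ang_chord; rewrite ab ba.
  by move=> /ang_neq0 h e; apply: h; rewrite e /sub2 !subrr.
have [l [/andP[l0 l1] ->]] := on_chord (sq2_expi a) (sq2_expi b) ne sx s0.
exists (1 - l), l, 0; split=> //; [by rewrite subr_ge0|ring|].
by rewrite /= !mul0r !addr0.
Qed.

Lemma ray_hits_circle (a : R) (x : P2) : sq2 x < 1 ->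
  exists2 q, a < q < a + T & side a q x = 0.
Proof.
move=> sx; pose p := expi a : P2; pose d := sub2 x p.
have dp := dot2_expi_lt1 a sx; rewrite -/p in dp.
have d0 : 0 < sq2 d.
  rewrite lt_neqAle sq2_ge0 andbT; apply/eqP => /esym/sq2_eq0; apply: sub2_neq0 => e.
  by move: sx; rewrite e sq2_expi ltxx.
have dn := lt0r_neq0 d0.
(* The nonzero root of [sq2 (p + k d) = 1]. *)
pose k := - (2 * dot2 p d) / sq2 d.
pose v : P2 := (p.1 + k * d.1, p.2 + k * d.2).
have pd : dot2 p d = dot2 x p - 1.
  by rewrite -(cos2sin2 a) /dot2 /d /sub2 /p /=; ring.
have k0 : 0 < k by rewrite divr_gt0// oppr_gt0 pmulr_rlt0// pd subr_lt0.
have sv : sq2 v = 1.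
  have -> : sq2 v = sq2 p + k * (2 * dot2 p d + k * sq2 d) by rewrite /sq2 /dot2 /v /=; ring.
  by rewrite sq2_expi /k divfK// subrr mulr0 addr0.
have [q /andP[q1 q2] vq] := expi_surj_from a sv.
exists q.
  rewrite q2 andbT lt_neqAle q1 andbT; apply/eqP => e.
  have : sq2 (sub2 v p) = 0 by rewrite vq -e /sq2 /sub2 /= !subrr expr0n /= addr0.
  have -> : sq2 (sub2 v p) = k ^+ 2 * sq2 d by rewrite /sq2 /sub2 /v /=; ring.
  by move=> /eqP; rewrite mulf_eq0 (negbTE dn) orbF sqrf_eq0 (gt_eqF k0).
by rewrite /side -vq /orient /cross2 -/p /v /d /sub2 /=; ring.
Qed.

End Chords.

(** * The hulls of one sign cover the disk *)

Section HullsCover.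
Variable R : realType.
Notation P2 := (R * R)%type.
Notation P3 := (R * R * R)%type.
Notation T := (tau R).
Variable phi : R -> P3.
Hypothesis Hphi : catherine_line phi.
Variable s : bool.
Notation signed := (signed phi s).

Definition same_class (p q : P2) :=
  (S1 p /\ p = q) \/ exists a b, [/\ p = expi a, q = expi b & signed a b].

(** The three vertices may coincide. With their number fixed, the points of all hulls become an
    image of a compact set ([compact_triangles]), which [conv] does not offer. *)
Definition hull3 (x : P2) := exists p q r : P2,
  [/\ same_class p q, same_class p r, same_class q r & in_triangle p q r x].

Lemma expi_eq (a b : R) : expi a = expi b -> exists k : int, a = b + T * k%:~R.
Proof.
move=> e; have h := ang_expi a; rewrite e in h.
by have [k hk] := ang_uniq h (ang_expi b); exists k; rewrite -hk; ring.
Qed.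

Lemma same_class_refl a : same_class (expi a) (expi a).
Proof. by left; split=> //; exact: S1_expi. Qed.

Lemma same_class_signed a b : signed a b -> same_class (expi a) (expi b).
Proof. by move=> h; right; exists a, b. Qed.

(** The representatives behind [same_class] may differ from [a] and [b] by multiples of [T]; the
    bounds on the two differences force the same multiple. *)
Lemma signed_same_class a b : a < b -> b < a + T -> same_class (expi a) (expi b) -> signed a b.
Proof.
move=> ab ba [[_ /expi_eq[k hk]]|[a' [b' [/expi_eq[k hk] /expi_eq[l hl] sg]]]].
  have T0 := tau_gt0 R.
  have k1 : T * k%:~R < T * 0%:~R by rewrite mulr0; lra.
  have k2 : T * (- 1)%:~R < T * k%:~R by rewrite mulrN1z mulrN1; lra.
  by move: k1 k2; rewrite !ltr_pM2l// !ltr_int; lia.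
have [h1 h2 _ _] := sg; have T0 := tau_gt0 R.
have k1 : T * l%:~R < T * (k + 1)%:~R by rewrite intrD mulrDr mulr1; lra.
have k2 : T * k%:~R < T * (l + 1)%:~R by rewrite intrD mulrDr mulr1; lra.
have kl : k = l by move: k1 k2; rewrite !ltr_pM2l// !ltr_int; lia.
by rewrite hk hl kl; apply/signedTz.
Qed.

Lemma same_class_sym p q : same_class p q -> same_class q p.
Proof.
move=> [[h e]|[a [b [e1 e2 h]]]]; first by left; rewrite -e.
right; exists b, (a + T); split=> //; first by rewrite expiDT.
exact: signed_compl.
Qed.

(** [side] without the factor [- (2 * sin ((u - t) / 2))], which vanishes at degenerate pairs.
    Inside the disk [ell] is negative at [u = t] and positive at [u = t + T], so the closed
    condition [ell x t u <= 0] rules out a full turn. *)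
Definition ell (x : P2) (t u : R) := dot2 x (expi ((t + u) / 2)) - cos ((u - t) / 2).

Lemma side_ell x t u : side t u x = - (2 * sin ((u - t) / 2)) * ell x t u.
Proof.
rewrite /ell; set m := (t + u) / 2; set h := (u - t) / 2.
have ht : t = m - h by rewrite /m /h; lra.
have hu : u = m + h by rewrite /m /h; lra.
have cm := cos2sin2 m.
rewrite /side /orient /cross2 /sub2 /dot2 /= ht hu cosB sinB cosD sinD.
move: (cos h) (sin h) (cos m) (sin m) cm => c z cm sm e.
transitivity (- (2 * z) * (x.1 * cm + x.2 * sm - c * (cm ^+ 2 + sm ^+ 2))); last by rewrite e mulr1.
ring.
Qed.

(* [Pp q] below: no chord of a pair separates [q] from [x]. Two such points
   form a pair, as a pair crossing them would separate one of them from [x]; a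
   point cut off from [x] lies behind a maximal chord, whose ends are not cut
   off. So [x] lies in an ideal triangle with such vertices. *)
Lemma hull3_cover (x : P2) : sq2 x < 1 -> hull3 x.
Proof.
move=> sx; apply: contrapT => nh; have T0 := tau_gt0 R.
have side0 t u : signed t u -> side t u x <> 0.
  move=> sg e; have [h1 h2 _ _] := sg; apply: nh; exists (expi t), (expi u), (expi u).
  split; [exact: same_class_signed|exact: same_class_signed|exact: same_class_refl|].
  by apply: chord_triangle => //; exact: ltW.
pose Out t u := signed t u /\ 0 < side t u x.
have OutT t u : Out (t + T) (u + T) <-> Out t u by rewrite /Out signedT// sideT1 sideT2.
pose Pp q := ~ exists t u, Out t u /\ t < q < u.
have PpT q : Pp (q + T) <-> Pp q.
  split=> H [t [u [h1 /andP[h2 h3]]]]; apply: H.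
    by exists (t + T), (u + T); rewrite OutT !ltrD2r h2 h3.
  exists (t - T), (u - T); rewrite -OutT !subrK; split=> //.
  by apply/andP; split; lra.
have tri a b c : a < b -> b < c -> c < a + T -> signed a b -> signed b c ->
    0 <= side a b x -> 0 <= side b c x -> 0 <= side c a x -> False.
  move=> ab bc ca s1 s2 h1 h2 h3; have [_ _ e1 _] := s1; have [_ _ e2 _] := s2.
  have [_ [k _]] := signed_triple Hphi s ab bc ca e1 e2.
  apply: nh; exists (expi a), (expi b), (expi c); split; try exact: same_class_signed.
    exact/same_class_signed/k.
  exact: side_triangle.
have pairP p q : p < q -> q < p + T -> Pp p -> Pp q -> signed p q.
  move=> pq qp Hp Hq; apply: contrapT => nsg.
  have [c [d [/andP[pc cq] /andP[qd dp] scd]]] := signed_cross Hphi pq qp nsg.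
  have [h|h|h] := ltgtP 0 (side c d x).
  - by apply: Hq; exists c, d; rewrite cq qd.
  - have : Pp (p + T) by apply/PpT.
    apply; exists d, (c + T); rewrite dp ltrD2r pc; split=> //.
    by split; [exact: signed_compl|rewrite sideT2 side_opp oppr_gt0].
  - exact: (side0 _ _ scd).
have maxarc q : ~ Pp q -> exists t u, [/\ Out t u, t < q, q < u, Pp t & Pp u].
  move=> /contrapT[t0 [u0 [[sg0 o0] /andP[t0q qu0]]]].
  have [t0u0 u0t0 _ _] := sg0.
  (* The maximum needs closed conditions: [weak_pair] stands in for [signed], and
     [ell x p.1 p.2 <= 0] for [0 < side p.1 p.2 x]. That the maximiser satisfies the strict ones is
     shown afterwards. *)
  pose K : set P2 := [set p | [/\ q - T <= p.1, p.1 <= q, q <= p.2 & p.2 <= q + T] /\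
    weak_pair phi s p /\ ell x p.1 p.2 <= 0].
  have cell : continuous (fun p : P2 => ell x p.1 p.2).
    by move=> p; rewrite /ell /dot2 /expi /=; cont.
  have cK : compact K.
    apply: (@subclosed_compact _ _ (`[q - T, q]%classic `*` `[q, q + T]%classic : set P2)).
    - have c1 : continuous (fun p : P2 => p.1) by move=> p; cont.
      have c2 : continuous (fun p : P2 => p.2) by move=> p; cont.
      have -> : K = ([set p | q - T <= p.1] `&` [set p | p.1 <= q] `&` [set p | q <= p.2] `&`
         [set p | p.2 <= q + T]) `&` (weak_pair phi s `&` [set p | ell x p.1 p.2 <= 0]).
        by apply/seteqP; split=> p; [move=> [[? ? ? ?] [? ?]]|move=> [[[[? ?] ?] ?] [? ?]]]; split.
      apply: closedI; last by apply: closedI; [exact: closed_weak_pair|exact: closed_le_cont].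
      by do !apply: closedI; first [exact: closed_le_cont | exact: closed_ge_cont].
    - by apply: compact_setX; exact: segment_compact.
    - by move=> [p1 p2] /= [[h1 h2 h3 h4] _]; rewrite !in_itv /= h1 h2 h3 h4.
  have OutK t u : Out t u -> t <= q -> q <= u -> K (t, u).
    move=> [sg o] tq qu; have [h1 h2 e _] := sg; split=> /=; first by split=> //; lra.
    split; first by split=> //=; exact: ltW.
    move: o; rewrite side_ell mulNr oppr_gt0 pmulr_rlt0; first exact: ltW.
    by rewrite mulr_gt0// sin_gt0_pi// half_in_pi.
  have K0 : K !=set0 by exists (t0, u0); apply: OutK => //; exact: ltW.
  have clen : continuous (fun p : P2 => p.2 - p.1) by move=> p; cont.
  have [[t u] /set_mem Ktu mx] := compact_EVT_max K0 cK (continuous_subspaceT clen).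
  have mxO a b : Out a b -> a <= q -> q <= b -> b - a <= u - t.
    by move=> o h1 h2; apply: (mx (a, b)); apply/mem_set/OutK.
  have tu : t < u by have := mxO t0 u0 (conj sg0 o0) (ltW t0q) (ltW qu0); lra.
  have [[/= k1 tq qu k2] [[/= k3 k4 k5 k6] k7]] := Ktu.
  have uT : u < t + T.
    rewrite lt_neqAle k4 andbT; apply/eqP => e; move: k7; rewrite /ell.
    have -> : (u - t) / 2 = pi by rewrite e /tau; lra.
    rewrite cospi opprK => h.
    have := dot2_expi_lt1 ((t + u) / 2 + pi) sx.
    rewrite (expiDpi ((t + u) / 2)).
    have -> : dot2 x (- cos ((t + u) / 2), - sin ((t + u) / 2)) = - dot2 x (expi ((t + u) / 2)).
      by rewrite /dot2 /=; ring.
    by move=> h'; lra.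
  have sg := k6 tu uT.
  have Ou : Out t u.
    split=> //; rewrite lt_neqAle; apply/andP; split; first by apply/eqP => e; exact: (side0 _ _ sg (esym e)).
    by rewrite side_ell mulNr oppr_ge0 pmulr_rle0// mulr_gt0// sin_gt0_pi// half_in_pi.
  have [_ o] := Ou; have [_ _ etu _] := sg.
  (* A pair [(a, b)] cutting off [t] is longer than [(t, u)] if it reaches [u]. If it is linked with
     [(t, u)], then [(a, u)] is longer, unless [x] lies in the triangle [a], [t], [u]. In the
     remaining case [b] and [a + T] are both inside [[t, u]], and [x] is on the wrong side. *)
  have Pt : Pp t.
    move=> [a [b [[sab oab] /andP[at_ tb]]]]; have [h1 h2 eab _] := sab.
    have [bu|ub] := ltP b u; last first.
      have := mxO a b (conj sab oab) (ltW (lt_le_trans at_ tq)) (le_trans qu ub); lra.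
    have [uaT|aTu] := ltP u (a + T).
      have ea := signed_unlinked Hphi at_ tb bu uaT sab sg.
      have [k8 k9] := signed_triple Hphi s at_ tu uaT ea etu.
      have sau : signed a u by rewrite -k9 k8.
      have sat : signed a t by rewrite k8.
      have oau : 0 < side a u x.
        rewrite ltNge; apply/negP => h; apply: (tri a t u) => //; [|exact: ltW|].
          rewrite leNgt; apply/negP => h'.
          by have := side_mono sx (lexx a) at_ (ltW tb) h2 h'; move: oab; lra.
        by rewrite side_opp oppr_ge0.
      by have := mxO a u (conj sau oau) (ltW (lt_le_trans at_ tq)) qu; lra.
    have hb : side b (a + T) x < 0 by rewrite sideT2 side_opp oppr_lt0.
    by have := side_mono sx (ltW tb) h2 aTu uT hb; move: o; lra.
  have Pu : Pp u.
    move=> [a [b [[sab oab] /andP[au ub]]]]; have [h1 h2 eab _] := sab.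
    have [ta|at_] := ltP t a; last first.
      have := mxO a b (conj sab oab) (le_trans at_ tq) (ltW (le_lt_trans qu ub)); lra.
    have [btT|tTb] := ltP b (t + T).
      have ea := signed_unlinked Hphi ta au ub btT sg sab.
      have eub : phi u = phi b by rewrite -etu ea.
      have [k8 k9] := signed_triple Hphi s tu ub btT etu eub.
      have stb : signed t b by rewrite -k9.
      have sub : signed u b by rewrite -k8.
      have otb : 0 < side t b x.
        rewrite ltNge; apply/negP => h; apply: (tri t u b) => //; [exact: ltW| |].
          rewrite leNgt; apply/negP => h'.
          by have := side_mono sx (ltW au) ub (lexx b) h2 h'; move: oab; lra.
        by rewrite side_opp oppr_ge0.
      by have := mxO t b (conj stb otb) tq (ltW (le_lt_trans qu ub)); lra.
    have hb : side u (t + T) x < 0 by rewrite sideT2 side_opp oppr_lt0.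
    by have := side_mono sx (ltW au) uT tTb h2 hb; move: oab; lra.
  exists t, u; split=> //.
    rewrite lt_neqAle tq andbT; apply/eqP => e; apply: Pt; exists t0, u0; rewrite e t0q qu0.
    by split.
  rewrite lt_neqAle qu andbT; apply/eqP => e; apply: Pu; exists t0, u0; rewrite -e t0q qu0.
  by split.
have [p0 P0] : exists p, Pp p.
  have [h|/maxarc[t [u [_ _ _ h _]]]] := pselect (Pp 0); by [exists 0|exists t].
(* The ray from [p0] through [x] ends at [q]. Either [q] is not cut off and [x] is on a chord of a
   pair, or [q] is behind a maximal chord [(t, u)], and [x] is on that of [p0] with an end or in the
   triangle [p0], [t], [u]. *)
have [q /andP[pq qp] sq] := ray_hits_circle p0 sx.
have [Pq|/maxarc[t [u [[sg o] tq qu Pt Pu]]]] := pselect (Pp q).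
  exact: (side0 _ _ (pairP _ _ pq qp P0 Pq)).
have [tu uT etu _] := sg.
have P0T : Pp (p0 + T) by apply/PpT.
have pt : p0 <= t.
  rewrite leNgt; apply/negP => h; apply: P0; exists t, u; rewrite h (lt_trans pq qu).
  by split.
have up : u <= p0 + T.
  rewrite leNgt; apply/negP => h; apply: P0T; exists t, u; rewrite h (lt_trans tq qp).
  by split.
have sq' : side q (p0 + T) x = 0 by rewrite sideT2 side_opp sq oppr0.
have [ept|npt] := eqVneq p0 t.
  have upT : u < p0 + T by rewrite ept.
  have := side_mono_r sx pq qu upT (ltac:(rewrite sq; exact: lexx) : side p0 q x <= 0).
  by rewrite ept; move: o; lra.
have {}pt : p0 < t by rewrite lt_neqAle npt.
have [eup|nup] := eqVneq u (p0 + T).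
  have h : p0 + T < t + T by rewrite ltrD2r.
  have := side_mono_l sx tq qp h (ltac:(rewrite sq'; exact: lexx) : side q (p0 + T) x <= 0).
  by rewrite -eup; move: o; lra.
have {}up : u < p0 + T by rewrite lt_neqAle nup.
have spt := pairP _ _ pt (lt_trans tu up) P0 Pt.
apply: (tri p0 t u pt tu up spt sg) (ltW o) _.
  rewrite leNgt; apply/negP => h.
  by have := side_mono sx (lexx p0) pt (ltW tq) qp h; rewrite sq ltxx.
rewrite leNgt; apply/negP => h.
have h1 : side u (p0 + T) x < 0 by rewrite sideT2.
have h2 : p0 + T < q + T by rewrite ltrD2r.
by have := side_mono sx (ltW qu) up (lexx _) h2 h1; rewrite sq' ltxx.
Qed.

End HullsCover.

(** * Hulls of different classes of one sign are disjoint *)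

Section HullsDisjoint.
Variable R : realType.
Notation P2 := (R * R)%type.
Notation P3 := (R * R * R)%type.
Notation T := (tau R).
Variable phi : R -> P3.
Hypothesis Hphi : catherine_line phi.
Variable s : bool.
Notation signed := (signed phi s).
Notation same_class := (same_class phi s).

Lemma same_class_rep p q : same_class p q -> S1 p /\ S1 q.
Proof. by move=> [[h <-]|[a [b [-> -> _]]]] //; split; exact: S1_expi. Qed.

Lemma same_class_trans p q r : same_class p q -> same_class q r -> same_class p r.
Proof.
move=> h1 h2; have [S1p S1q] := same_class_rep h1; have [_ S1r] := same_class_rep h2.
have [->|pq] := pselect (p = q); first by [].
have [<-|qr] := pselect (q = r); first by [].
have [pr|pr] := pselect (p = r); first by left.
have [a ea] := expi_surj S1p; have [b /andP[b1 b2] eb] := expi_surj_from a S1q.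
have [c /andP[c1 c2] ec] := expi_surj_from a S1r.
have ab : a < b by rewrite lt_neqAle b1 andbT; apply/eqP => e; apply: pq; rewrite ea eb e.
have ac : a < c by rewrite lt_neqAle c1 andbT; apply/eqP => e; apply: pr; rewrite ea ec e.
rewrite ea ec; apply: same_class_signed.
rewrite ea eb in h1; have sab := signed_same_class Hphi ab b2 h1; have [_ _ eab _] := sab.
have [bc|cb|e] := ltgtP b c; last by case: qr; rewrite eb ec e.
  rewrite eb ec in h2; have cbT : c < b + T by rewrite (lt_trans c2)// ltrD2r.
  have sbc := signed_same_class Hphi bc cbT h2; have [_ _ ebc _] := sbc.
  by have [_ [k _]] := signed_triple Hphi s ab bc c2 eab ebc; exact: k.
have h3 := same_class_sym Hphi h2; rewrite ec eb in h3.
have bcT : b < c + T by rewrite (lt_trans b2)// ltrD2r.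
have scb := signed_same_class Hphi cb bcT h3; have [_ _ ecb _] := scb.
have [k1 _] := signed_triple Hphi s ac cb b2 (etrans eab (esym ecb)) ecb.
by rewrite k1.
Qed.

Lemma orient_conv (p q : P2) n (w : 'I_n -> R) (pt : 'I_n -> P2) : \sum_i w i = 1 ->
  orient p q (\sum_i w i * (pt i).1, \sum_i w i * (pt i).2) = \sum_i w i * orient p q (pt i).
Proof.
move=> w1; pose A := - (q.2 - p.2); pose B := q.1 - p.1; pose C := - (A * p.1 + B * p.2).
have e x : orient p q x = A * x.1 + B * x.2 + C.
  by rewrite /orient /cross2 /sub2 /C /A /B /=; ring.
rewrite e /= !mulr_sumr -[C]mulr1 -w1 mulr_sumr -!big_split /=.
by apply: eq_bigr => i _; rewrite e; ring.
Qed.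

(** The second class lies in a single gap [(c, d)] of the closed first class. The chord of this gap
    separates the two: [side c d] is nonnegative on the first class and negative on the second,
    hence also on their hulls. *)
Lemma hulls_disjoint p1 q1 p2 x : same_class p1 q1 -> p1 <> q1 -> S1 p2 ->
  conv [set q | same_class p1 q] x -> conv [set q | same_class p2 q] x -> same_class p1 p2.
Proof.
move=> h1 ne1 S1p2 [n [w [pt [w0 w1 ptc ex]]]] [n' [w' [pt' [w0' w1' ptc' ex']]]].
apply: contrapT => nsc; have [S1p1 S1q1] := same_class_rep h1.
have [b eb] := expi_surj S1p2.
have [a0 /andP[a1 a2] ea0] := expi_surj_from (b - T) S1p1.
have a0b : a0 < b by lra.
have ba0 : b < a0 + T.
  have : a0 != b - T.
    apply/eqP => e; apply: nsc; rewrite ea0 e eb -[in X in same_class _ X](subrK T b) expiDT.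
    exact: same_class_refl.
  by rewrite eq_sym => ne; have : b - T < a0; [rewrite lt_neqAle ne|lra].
have T0 := tau_gt0 R.
pose A := [set t | a0 <= t <= a0 + T /\ weak_pair phi s (a0, t)].
have AE t : a0 <= t -> t <= a0 + T -> same_class p1 (expi t) -> A t.
  move=> t0 t1 h; split; first by rewrite t0.
  split=> //=; last first.
    by move=> k1 k2; apply: (signed_same_class Hphi) => //; rewrite -ea0.
  have [->|n0] := eqVneq t a0; first by [].
  have [->|nT] := eqVneq t (a0 + T); first by rewrite (phiT Hphi).
  have k1 : a0 < t by rewrite lt_neqAle eq_sym n0.
  have k2 : t < a0 + T by rewrite lt_neqAle nT.
  by rewrite ea0 in h; have [_ _ e _] := signed_same_class Hphi k1 k2 h.
have EA t : A t -> same_class p1 (expi t).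
  move=> [/andP[t0 t1] [_ _ _ k]]; rewrite ea0.
  have [->|n0] := eqVneq t a0; first exact: same_class_refl.
  have [->|nT] := eqVneq t (a0 + T); first by rewrite expiDT; exact: same_class_refl.
  apply/same_class_signed/k => /=; first by rewrite lt_neqAle eq_sym n0.
  by rewrite lt_neqAle nT.
have cA : closed A.
  have -> : A = ([set t | a0 <= t] `&` [set t | t <= a0 + T]) `&` (fun t => (a0, t)) @^-1` weak_pair phi s.
    by apply/seteqP; split=> t; [move=> [/andP[? ?] ?]|move=> [[k1 k2] ?]; split=> //; rewrite k1 k2].
  apply: closedI; first by apply: closedI; [exact: closed_ge|exact: closed_le].
  apply: preimage_closed; last exact: closed_weak_pair.
  by move=> t _; apply: continuous_at_pair; [exact: continuous_at_cst|exact: continuous_at_id].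
have cid : continuous (fun t : R => t) by move=> t; exact: continuous_at_id.
have cpt (lo hi : R) : compact (A `&` `[lo, hi]%classic).
  apply: (@subclosed_compact _ _ `[lo, hi]%classic); last by move=> t [].
    by apply: closedI => //; exact: compact_closed (@segment_compact _ _ _).
  exact: segment_compact.
have A0 : A a0 by apply: AE; rewrite ?lexx ?lerDl ?(ltW T0)//; rewrite -ea0; left.
have AT : A (a0 + T).
  by apply: AE; rewrite ?lexx ?lerDl ?(ltW T0)// expiDT -ea0; left.
have nAb : ~ A b by move=> /EA; rewrite -eb.
have [c /set_mem[Ac /=]] : exists2 c, c \in A `&` `[a0, b]%classic & forall t, t \in A `&` `[a0, b]%classic -> t <= c.
  apply: (compact_EVT_max _ (cpt _ _) (continuous_subspaceT cid)).
  by exists a0; split=> //=; rewrite in_itv /= lexx ltW.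
rewrite in_itv /= => /andP[ac cb] mxc.
have [d /set_mem[Ad /=]] : exists2 d, d \in A `&` `[b, a0 + T]%classic & forall t, t \in A `&` `[b, a0 + T]%classic -> d <= t.
  apply: (compact_EVT_min _ (cpt _ _) (continuous_subspaceT cid)).
  by exists (a0 + T); split=> //=; rewrite in_itv /= lexx ltW.
rewrite in_itv /= => /andP[bd da] mnd.
have {}cb : c < b by rewrite lt_neqAle cb andbT; apply/eqP => e; apply: nAb; rewrite -e.
have {}bd : b < d by rewrite lt_neqAle bd andbT; apply/eqP => e; apply: nAb; rewrite e.
have gap t : A t -> t <= c \/ d <= t.
  move=> At; have [/andP[t0 t1] _] := At; have [h|/ltW h] := leP t b.
    by left; apply: mxc; apply/mem_set; split=> //=; rewrite in_itv /= t0.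
  by right; apply: mnd; apply/mem_set; split=> //=; rewrite in_itv /= h.
have cd := lt_trans cb bd.
(* The second point [q1] of the class keeps the gap from being the whole circle. *)
have dc : d < c + T.
  have [t /andP[t0 t1] et] := expi_surj_from a0 S1q1.
  have At : A t by apply: AE => //; [exact: ltW|rewrite -et].
  have t0' : a0 < t.
    by rewrite lt_neqAle t0 andbT; apply/eqP => e; apply: ne1; rewrite ea0 et -e.
  have [h|h] := gap t At; last by apply: (le_lt_trans h); rewrite (lt_le_trans t1)// lerD2r.
  by rewrite (le_lt_trans da)// ltrD2r (lt_le_trans t0').
have scd : signed c d.
  by apply: (signed_same_class Hphi) => //; apply: same_class_trans (EA _ Ad); apply: (same_class_sym Hphi); exact: EA.
have pos i : 0 <= side c d (pt i).
  have h := ptc i; have [_ S1i] := same_class_rep h.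
  have [u /andP[u0 u1] eu] := expi_surj_from a0 S1i; rewrite eu.
  have Au : A u by apply: AE => //; [exact: ltW|rewrite -eu].
  have [k|k] := gap u Au.
    have [->|nuc] := eqVneq u c; first by rewrite side_self.
    have uc : u < c by rewrite lt_neqAle nuc.
    have [e|ne] := eqVneq d (u + T); first by rewrite -expiDT -e side_self2.
    rewrite -expiDT; apply/ltW/side_pos; rewrite ?ltrD2r//.
    by rewrite lt_neqAle ne (le_trans da)// lerD2r.
  have [->|nud] := eqVneq u d; first by rewrite side_self2.
  have du : d < u by rewrite lt_neqAle eq_sym nud.
  by apply/ltW/side_pos => //; rewrite (lt_le_trans u1)// lerD2r.
(* A point of the second class outside the gap would form with [b] a pair linked with [(c, d)], and
   unlinkedness would merge the two classes. *)
have neg i : side c d (pt' i) < 0.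
  have h := ptc' i; have [_ S1i] := same_class_rep h.
  have [v /andP[v0 v1] ev] := expi_surj_from c S1i; rewrite ev.
  have nvA : ~ same_class p1 (expi v).
    move=> k; apply: nsc; apply: same_class_trans k _; apply: (same_class_sym Hphi).
    by rewrite -ev.
  have vc : c < v.
    by rewrite lt_neqAle v0 andbT; apply/eqP => e; apply: nvA; rewrite -e; exact: EA.
  have [vd|dv|e] := ltgtP v d; last by case: nvA; rewrite e; exact: EA.
    exact: side_neg.
  exfalso; have bv := lt_trans bd dv.
  have vb : v < b + T by rewrite (lt_trans v1)// ltrD2r.
  have sbv : signed b v by apply: (signed_same_class Hphi) => //; rewrite -eb -ev.
  have ecb := signed_unlinked Hphi cb bd dv v1 scd sbv.
  have [_ _ ecd _] := scd.
  have [_ k] := signed_triple Hphi s cb bd dc ecb (etrans (esym ecb) ecd).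
  apply: nsc; rewrite eb; apply: same_class_trans (EA _ Ac) _.
  by apply: same_class_signed; rewrite k.
have e1 := orient_conv (expi c) (expi d) pt w1; have e2 := orient_conv (expi c) (expi d) pt' w1'.
rewrite -ex in e1; rewrite -ex' in e2.
have : 0 <= orient (expi c) (expi d) x.
  by rewrite e1; apply: sumr_ge0 => i _; apply: mulr_ge0 => //; exact: pos.
rewrite e2 leNgt => /negP; apply.
have [i wi] : exists i, 0 < w' i.
  apply: contrapT => H; have : \sum_i w' i <= 0.
    by apply: sumr_le0 => i _; rewrite leNgt; apply/negP => k; apply: H; exists i.
  by rewrite w1' ler10.
rewrite (bigD1 i) //=; apply: ltr_wnDr.
  by apply: sumr_le0 => j _; apply: mulr_ge0_le0 => //; apply/ltW/neg.
by rewrite pmulr_rlt0//; exact: neg.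
Qed.

End HullsDisjoint.

(** * The decomposition *)

Section FromTheCircle.
Variable R : realType.
Notation P2 := (R * R)%type.
Notation P3 := (R * R * R)%type.
Notation T := (tau R).

Lemma rot_expi th a : rot th (expi a) = expi (a + th) :> P2.
Proof. by rewrite /rot /expi /= cosD sinD; congr pair; ring. Qed.

Lemma ccw_expi a b th : a <= b -> b < a + T -> ccw (expi a) (expi b) th <-> th = b - a.
Proof.
move=> ab ba; rewrite /ccw rot_expi; split=> [[/andP[h0 h1] /expi_eq[k hk]]|->]; last first.
  by rewrite addrCA subrr addr0; split=> //; apply/andP; split; [lra|move: ba; rewrite /tau; lra].
have T0 := tau_gt0 R; rewrite -/T in h1.
have k1 : T * k%:~R < T * 1%:~R by rewrite mulr1; lra.
have k2 : T * (- 1)%:~R < T * k%:~R by rewrite mulrN1z mulrN1; lra.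
have k0 : k = 0 by move: k1 k2; rewrite !ltr_pM2l// !ltr_int; lia.
by move: hk; rewrite k0 mulr0 addr0 => ->; ring.
Qed.

Lemma arc_expi a b r : a < b -> b < a + T ->
  arc (expi a) (expi b) r <-> exists2 t, a <= t <= b & r = expi t.
Proof.
move=> ab ba; split.
  move=> [S1r [thr [thq [[/andP[h0 h1] hr] hq hrq]]]].
  have eq := (ccw_expi thq (ltW ab) ba).1 hq.
  exists (a + thr); last by rewrite hr rot_expi.
  by apply/andP; split; lra.
move=> [t /andP[h1 h2] ->]; split; first exact: S1_expi.
exists (t - a), (b - a); split; last by rewrite lerD2r.
  by apply/ccw_expi => //; exact: le_lt_trans ba.
by apply/ccw_expi => //; exact: ltW.
Qed.

Lemma arcle_expi a b u v : a < b -> b < a + T -> a <= u <= b -> a <= v <= b ->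
  arcle (expi a) (expi u) (expi v) <-> u <= v.
Proof.
move=> ab ba /andP[u0 u1] /andP[v0 v1]; split.
  move=> [ths [tht [/ccw_expi-/(_ u0 (le_lt_trans u1 ba)) -> /ccw_expi-/(_ v0 (le_lt_trans v1 ba)) ->]]].
  by rewrite lerD2r.
move=> uv; exists (u - a), (v - a); split; last by rewrite lerD2r.
  by apply/ccw_expi => //; exact: le_lt_trans ba.
by apply/ccw_expi => //; exact: le_lt_trans ba.
Qed.

Variable f : P2 -> P3.
Hypothesis Hf : catherine f.
Definition unroll (t : R) : P3 := f (expi t).
Notation phi := unroll.

Lemma arc_image a b : a < b -> b < a + T -> f @` arc (expi a) (expi b) = arcim phi a b.
Proof.
move=> ab ba; apply/seteqP; split.
  by move=> _ [r /(arc_expi _ ab ba)[t ht ->] <-]; exists t.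
by move=> _ [t ht <-]; exists (expi t) => //; apply/arc_expi => //; exists t.
Qed.

Lemma expi_neq a b : a < b -> b < a + T -> expi a <> expi b :> P2.
Proof.
move=> ab ba e; have : ang (sub2 (expi a) (expi b)) ((a + b) / 2 - pi / 2).
  by apply: ang_chord; rewrite ab ba.
by move=> /ang_neq0; apply; rewrite e /sub2 !subrr.
Qed.

Lemma unroll_catherine : catherine_line phi.
Proof.
case: Hf => cf im H; split.
- by apply: (continuous_comp_within cf (@continuous_expi R)) => t; exact: S1_expi.
- by move=> t; rewrite /phi expiDT.
- move=> y; rewrite -im; split=> [[p /expi_surj[t ->] <-]|[t <-]]; first by exists t.
  by exists (expi t) => //; exact: S1_expi.
- move=> a b ab ba; rewrite -arc_image//.
  exact: (H _ _ (S1_expi a) (S1_expi b) (expi_neq ab ba)).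
Qed.

Lemma Zplus_Zpos a b : a < b -> b < a + T ->
  Zplus_nonempty f (expi a) (expi b) <-> Zpos phi a b.
Proof.
move=> ab ba; rewrite /Zplus_nonempty arc_image// /Zpos.
split=> -[Y [cY [gam [pl g0 mono]]]]; exists Y; split=> //; exists gam; split=> //.
  move=> u v x y hu hv Yu Yv uv hx hy gx gy.
  apply: (mono (expi u) (expi v) x y) => //.
  - by apply/arc_expi => //; exists u.
  - by apply/arc_expi => //; exists v.
  - exact/(arcle_expi ab ba).
move=> p q x y /(arc_expi _ ab ba)[u hu ->] /(arc_expi _ ab ba)[v hv ->] Yu Yv.
by move=> /(arcle_expi ab ba hu hv) uv; exact: (mono u v).
Qed.

Lemma pos_degenerate_signed a b : a < b -> b < a + T ->
  pos_degenerate f (expi a) (expi b) <-> signed phi true a b.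
Proof.
move=> ab ba; rewrite /pos_degenerate (Zplus_Zpos ab ba); split=> [[[_ _ _ e] z]|[_ _ e z]] //.
by split=> //; split=> //; [exact: S1_expi|exact: S1_expi|exact: expi_neq].
Qed.

Lemma neg_degenerate_signed a b : a < b -> b < a + T ->
  neg_degenerate f (expi a) (expi b) <-> signed phi false a b.
Proof.
move=> ab ba; rewrite /neg_degenerate (Zplus_Zpos ab ba); split=> [[[_ _ _ e] z]|[_ _ e z]] //.
by split=> //; split=> //; [exact: S1_expi|exact: S1_expi|exact: expi_neq].
Qed.

Definition Lsign (s : bool) : P2 -> P2 -> Prop := if s then Lplus f else Lminus f.

(** [Lplus] and [Lminus] are symmetric by definition, while [signed] orders its arguments;
    [signed_compl] reconciles the two readings. *)
Lemma Lsign_signed s a b : a < b -> b < a + T ->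
  Lsign s (expi a) (expi b) <-> signed phi s a b.
Proof.
move=> ab ba; have aT : a + T < b + T by rewrite ltrD2r.
have key : signed phi s b (a + T) -> signed phi s a b.
  by move=> /(signed_compl unroll_catherine); rewrite signedT //; exact: unroll_catherine.
case: s key => key; rewrite /Lsign /= /Lplus /Lminus -(expiDT a).
  rewrite (pos_degenerate_signed ba aT) expiDT (pos_degenerate_signed ab ba).
  by split=> [[//|/key]|h] //; left.
rewrite (neg_degenerate_signed ba aT) expiDT (neg_degenerate_signed ab ba).
by split=> [[//|/key]|h] //; left.
Qed.

Lemma Lsign_same_class s p q : S1 p -> S1 q -> p <> q -> Lsign s p q <-> same_class phi s p q.
Proof.
move=> S1p S1q ne; have [a ea] := expi_surj S1p; have [b /andP[b1 b2] eb] := expi_surj_from a S1q.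
have ab : a < b by rewrite lt_neqAle b1 andbT; apply/eqP => e; apply: ne; rewrite ea eb e.
rewrite ea eb Lsign_signed//; split; first exact: same_class_signed.
exact: (signed_same_class unroll_catherine).
Qed.

Lemma Lsign_degenerate s p q : Lsign s p q -> [/\ S1 p, S1 q & p <> q].
Proof. by case: s => /=; case=> -[[h1 h2 h3 _] _]; split=> //; exact: nesym. Qed.

Lemma eqclass_same_class s p : S1 p -> eqclass (Lsign s) p = [set q | same_class phi s p q].
Proof.
move=> S1p; apply/seteqP; split=> q /=.
  move=> [S1q [->|h]]; first by left.
  by apply/Lsign_same_class => //; have [] := Lsign_degenerate h.
move=> h; have [_ S1q] := same_class_rep h; split=> //.
have [->|ne] := pselect (q = p); first by left.
by right; apply/Lsign_same_class => //; exact: nesym.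
Qed.

Lemma nt_classE s nu : nt_class (Lsign s) nu <->
  exists p q, [/\ same_class phi s p q, p <> q & nu = [set r | same_class phi s p r]].
Proof.
split.
  move=> [p [S1p [q Lpq] ->]]; have [_ S1q ne] := Lsign_degenerate Lpq; exists p, q; split=> //.
    exact/Lsign_same_class.
  exact: eqclass_same_class.
move=> [p [q [h ne ->]]]; have [S1p S1q] := same_class_rep h; exists p; split=> //.
  by exists q; apply/Lsign_same_class.
by rewrite eqclass_same_class.
Qed.

End FromTheCircle.

(** * The sphere as two Klein disks glued along the circle *)

Section Hemispheres.
Variable R : realType.
Notation P2 := (R * R)%type.
Notation P3 := (R * R * R)%type.
Notation T := (tau R).

Definition hemi (s : bool) : R := if s then 1 else -1.
(** Klein coordinates on each closed hemisphere: hyperbolic hulls become Euclidean ones, and both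
    charts agree on the circle ([emb_circle]). *)
Definition emb (s : bool) (k : P2) : P3 := lift (hemi s) (KtoP k).
Definition PtoK (p : P2) : P2 := (2 / (1 + sq2 p) * p.1, 2 / (1 + sq2 p) * p.2).

Lemma hemi_sqr s : hemi s * hemi s = 1. Proof. by case: s; rewrite /hemi ?mulr1// mulrNN mulr1. Qed.

Lemma KtoP_circle (k : P2) : sq2 k = 1 -> KtoP k = k.
Proof. by move=> e; rewrite /KtoP e subrr sqrtr0 addr0 invr1 !mul1r; case: k {e}. Qed.

Lemma sq2_KtoP (k : P2) : sq2 k <= 1 ->
  sq2 (KtoP k) = (1 - Num.sqrt (1 - sq2 k)) / (1 + Num.sqrt (1 - sq2 k)).
Proof.
move=> hk; rewrite /KtoP sq2Z.
have s2 : Num.sqrt (1 - sq2 k) ^+ 2 = 1 - sq2 k by rewrite sqr_sqrtr// subr_ge0.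
have s0 := sqrtr_ge0 (1 - sq2 k); move: (Num.sqrt _) s2 s0 => r s2 s0.
have -> : sq2 k = (1 - r) * (1 + r) by have : sq2 k = 1 - r ^+ 2 by [rewrite s2; lra]; lra.
by field; rewrite lt0r_neq0// ltr_pwDl.
Qed.

Lemma PtoKK (k : P2) : sq2 k <= 1 -> PtoK (KtoP k) = k.
Proof.
move=> hk; rewrite /PtoK sq2_KtoP// /KtoP /=.
have s0 := sqrtr_ge0 (1 - sq2 k); move: (Num.sqrt _) s0 => r s0.
have r1 : 1 + r != 0 by rewrite lt0r_neq0// ltr_pwDl.
have -> : 2 / (1 + (1 - r) / (1 + r)) = 1 + r.
  by field; rewrite r1 (_ : 1 + r + (1 - r) = 2) ?pnatr_eq0//; ring.
by rewrite !mulrA divff// !mul1r; case: k {hk}.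
Qed.

Lemma sq2_PtoK (p : P2) : 1 - sq2 (PtoK p) = ((1 - sq2 p) / (1 + sq2 p)) ^+ 2.
Proof.
rewrite /PtoK sq2Z; have s0 := sq2_ge0 p; move: (sq2 p) s0 => m s0.
by field; rewrite lt0r_neq0// ltr_pwDl.
Qed.

Lemma KtoPK (p : P2) : sq2 p <= 1 -> KtoP (PtoK p) = p.
Proof.
move=> hp; rewrite /KtoP sq2_PtoK sqrtr_sqr ger0_norm; last first.
  by rewrite divr_ge0 ?subr_ge0// addr_ge0// sq2_ge0.
rewrite /PtoK /=; have s0 := sq2_ge0 p; move: (sq2 p) s0 => m s0.
have m1 : 1 + m != 0 by rewrite lt0r_neq0// ltr_pwDl.
have -> : (1 + (1 - m) / (1 + m))^-1 = (1 + m) / 2.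
  by field; rewrite m1 (_ : 1 + m + (1 - m) = 2) ?pnatr_eq0//; ring.
have e (z : R) : (1 + m) / 2 * (2 / (1 + m) * z) = z by field.
by rewrite !e; case: p {hp}.
Qed.

Lemma KtoP_le1 (k : P2) : sq2 k <= 1 -> sq2 (KtoP k) <= 1.
Proof.
move=> hk; rewrite sq2_KtoP//; have s0 := sqrtr_ge0 (1 - sq2 k).
by rewrite ler_pdivrMr ?ltr_pwDl// mul1r; lra.
Qed.

Lemma PtoK_le1 (p : P2) : sq2 (PtoK p) <= 1.
Proof. by rewrite -subr_ge0 sq2_PtoK sqr_ge0. Qed.

Lemma emb_S2 s k : sq2 k <= 1 -> S2 (emb s k).
Proof.
move=> /KtoP_le1 h; rewrite /S2 /emb /lift /dot3 /=.
have e : hemi s * Num.sqrt (1 - sq2 (KtoP k)) * (hemi s * Num.sqrt (1 - sq2 (KtoP k))) = 1 - sq2 (KtoP k).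
  by rewrite mulrACA hemi_sqr mul1r -expr2 sqr_sqrtr// subr_ge0.
by rewrite e /sq2 /=; ring.
Qed.

Lemma emb_surj P : S2 P -> exists s k, sq2 k <= 1 /\ P = emb s k.
Proof.
case: P => [p z] hP; have {}hP : sq2 p = 1 - z ^+ 2 by move: hP; rewrite /S2 /dot3 /sq2 /=; lra.
have hp : sq2 p <= 1 by rewrite hP; have := sqr_ge0 z; lra.
exists (0 <= z), (PtoK p); split; first exact: PtoK_le1.
rewrite /emb /lift KtoPK// hP subKr sqrtr_sqr /hemi.
have [z0|z0] := leP 0 z; first by rewrite ger0_norm// mul1r.
by rewrite ltr0_norm// mulrNN mul1r.
Qed.

Lemma emb_circle s k : sq2 k = 1 -> emb s k = equator k.
Proof. by move=> e; rewrite /emb /lift KtoP_circle// e subrr sqrtr0 mulr0. Qed.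

Lemma emb_inj s s' k k' : sq2 k <= 1 -> sq2 k' <= 1 -> emb s k = emb s' k' ->
  k = k' /\ (s = s' \/ sq2 k = 1).
Proof.
move=> hk hk' e; have e1 : KtoP k = KtoP k' := congr1 fst e.
have kk : k = k' by rewrite -(PtoKK hk) e1 PtoKK.
split=> //; have [//|/eqP ne] := eqVneq s s'; first by left.
right; have e2 : hemi s * Num.sqrt (1 - sq2 (KtoP k)) = hemi s' * Num.sqrt (1 - sq2 (KtoP k')) := congr1 snd e.
have z : Num.sqrt (1 - sq2 (KtoP k)) = 0.
  by move: e2; rewrite -e1; case: s s' ne {e} => -[] // _; rewrite /hemi; lra.
have h0 : sq2 (KtoP k) = 1.
  have h := KtoP_le1 hk; apply/eqP; rewrite eq_le h /= -subr_le0.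
  by move/eqP: z; rewrite sqrtr_eq0.
have := sq2_PtoK (KtoP k); rewrite PtoKK// h0 subrr mul0r expr0n /= => /eqP.
by rewrite subr_eq0 => /eqP.
Qed.

Lemma continuous_emb s : continuous (emb s).
Proof.
move=> k; rewrite /emb /lift /KtoP /sq2 /=.
have n0 : 1 + Num.sqrt (1 - (k.1 ^+ 2 + k.2 ^+ 2)) != 0.
  by rewrite lt0r_neq0// ltr_pwDl// sqrtr_ge0.
by cont.
Qed.

(** The mean of the squared norms exceeds the squared norm of the mean by a weighted sum of squared
    distances between the vertices. *)
Lemma triangle_disk (p q r x : P2) : S1 p -> S1 q -> S1 r -> in_triangle p q r x -> sq2 x <= 1.
Proof.
rewrite /S1 /sq2 /= => hp hq hr [u [v [w [u0 v0 w0 uvw ->]]]] /=.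
have := sqr_ge0 (p.1 - q.1); have := sqr_ge0 (p.2 - q.2); have := sqr_ge0 (p.1 - r.1).
have := sqr_ge0 (p.2 - r.2); have := sqr_ge0 (q.1 - r.1); have := sqr_ge0 (q.2 - r.2).
move=> h1 h2 h3 h4 h5 h6.
have e : (u * p.1 + v * q.1 + w * r.1) ^+ 2 + (u * p.2 + v * q.2 + w * r.2) ^+ 2 =
  (u + v + w) * (u * (p.1 ^+ 2 + p.2 ^+ 2) + v * (q.1 ^+ 2 + q.2 ^+ 2) + w * (r.1 ^+ 2 + r.2 ^+ 2))
  - (u * v * ((p.1 - q.1) ^+ 2 + (p.2 - q.2) ^+ 2) + u * w * ((p.1 - r.1) ^+ 2 + (p.2 - r.2) ^+ 2)
   + v * w * ((q.1 - r.1) ^+ 2 + (q.2 - r.2) ^+ 2)) by ring.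
rewrite e uvw mul1r hp hq hr !mulr1 uvw.
by rewrite gerBl !addr_ge0// mulr_ge0// ?mulr_ge0// addr_ge0.
Qed.

(** The linear form [dot2 _ x] is at most 1 on the circle and equals 1 only at [x]. *)
Lemma triangle_extreme (p q r x : P2) : S1 p -> S1 q -> S1 r -> sq2 x = 1 -> in_triangle p q r x ->
  [\/ x = p, x = q | x = r].
Proof.
move=> hp hq hr hx [u [v [w [u0 v0 w0 uvw ex]]]].
have [//|np] := pselect (x = p); first by constructor 1.
have [//|nq] := pselect (x = q); first by constructor 2.
have [//|nr] := pselect (x = r); first by constructor 3.
exfalso; have [t et] := expi_surj hx.
have lt y : S1 y -> x <> y -> dot2 y x < 1.
  move=> hy ny; rewrite et; apply: disk_half_plane; first by rewrite /cdisk /=; move: hy; rewrite /S1 /= => ->.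
  by rewrite -et; exact: nesym.
have := lt p hp np; have := lt q hq nq; have := lt r hr nr => d3 d2 d1.
have e : u * dot2 p x + v * dot2 q x + w * dot2 r x = 1.
  have -> : 1 = dot2 x x by rewrite -hx /sq2 /dot2; ring.
  by rewrite {4}ex /dot2 /=; ring.
have [up|u0'] : 0 < u \/ u = 0 by move: u0; rewrite le_eqVlt => /orP[/eqP|]; [right|left].
  have : u * dot2 p x < u * 1 by rewrite ltr_pM2l.
  have : v * dot2 q x <= v * 1 by apply: ler_wpM2l => //; exact: ltW.
  have : w * dot2 r x <= w * 1 by apply: ler_wpM2l => //; exact: ltW.
  lra.
have [vp|v0'] : 0 < v \/ v = 0 by move: v0; rewrite le_eqVlt => /orP[/eqP|]; [right|left].
  have : v * dot2 q x < v * 1 by rewrite ltr_pM2l.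
  have : w * dot2 r x <= w * 1 by apply: ler_wpM2l => //; exact: ltW.
  by rewrite u0' mul0r in e; rewrite u0' in uvw; lra.
have w1 : w = 1 by lra.
by move: e; rewrite u0' v0' w1 !mul0r; lra.
Qed.

Lemma conv_triangle (nu : set P2) p q r x : nu p -> nu q -> nu r -> in_triangle p q r x -> conv nu x.
Proof.
move=> hp hq hr [u [v [w [u0 v0 w0 uvw ->]]]].
exists 3%N, (fun i : 'I_3 => nth 0 [:: u; v; w] i), (fun i : 'I_3 => nth p [:: p; q; r] i).
split.
- by case=> [[|[|[|]]] //=].
- by rewrite !big_ord_recr big_ord0 /= add0r.
- by case=> [[|[|[|]]] //=].
- by rewrite !big_ord_recr !big_ord0 /= !add0r.
Qed.

Lemma conv_disk (nu : set P2) x : nu `<=` @S1 R -> conv nu x -> sq2 x = 1 -> nu x.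
Proof.
move=> nS [n [w [pt [w0 w1 hpt ex]]]] hx; have [t et] := expi_surj hx.
apply: contrapT => nx.
have lt i : dot2 (pt i) x < 1.
  rewrite et; apply: disk_half_plane; first by have := nS _ (hpt i); rewrite /S1 /cdisk /= => ->.
  by rewrite -et => e; apply: nx; rewrite -e.
have e : \sum_i w i * dot2 (pt i) x = 1.
  have -> : 1 = dot2 x x by rewrite -hx /sq2 /dot2; ring.
  rewrite {2}ex /dot2 /= mulr_suml mulr_suml -big_split /=.
  by apply: eq_bigr => i _; ring.
have [i wi] : exists i, 0 < w i.
  apply: contrapT => H; have : \sum_i w i <= 0.
    by apply: sumr_le0 => i _; rewrite leNgt; apply/negP => k; apply: H; exists i.
  by rewrite w1 ler10.
have : \sum_i w i * dot2 (pt i) x < \sum_i w i.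
  rewrite (bigD1 i) //= [ltRHS](bigD1 i) //=; apply: ltr_leD.
    by rewrite -[ltRHS]mulr1 ltr_pM2l.
  by apply: ler_sum => j _; rewrite -[leRHS]mulr1; apply: ler_wpM2l => //; exact: ltW.
by rewrite e w1 ltxx.
Qed.

End Hemispheres.

(** * The graph of the quotient map and its fibres *)

Section QuotientMap.
Variable R : realType.
Notation P2 := (R * R)%type.
Notation P3 := (R * R * R)%type.
Notation T := (tau R).
Variable f : P2 -> P3.
Hypothesis Hf : catherine f.
Notation phi := (unroll f).
Notation same_class := (same_class phi).
Let Hphi := unroll_catherine Hf.

Lemma same_class_image s p q : same_class s p q -> f p = f q.
Proof. by move=> [[_ ->]|[a [b [-> -> [_ _ e _]]]]]. Qed.

Definition hull_value (s : bool) (k : P2) (y : P3) := exists p q r : P2,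
  [/\ same_class s p q, same_class s p r, same_class s q r, in_triangle p q r k & f p = y].

Definition sphere_value (P y : P3) := exists s k, [/\ sq2 k <= 1, P = emb s k & hull_value s k y].

Lemma triangle_self (p : P2) : in_triangle p p p p.
Proof.
exists 1, 0, 0; split=> //; first by rewrite !addr0.
by rewrite !mul1r !mul0r !addr0; case: p.
Qed.

Lemma hull_value_exists s k : sq2 k <= 1 -> exists y, hull_value s k y.
Proof.
rewrite le_eqVlt => /orP[/eqP k1|k1].
  have h : same_class s k k by left.
  by exists (f k), k, k, k; split=> //; exact: triangle_self.
have [p [q [r [h1 h2 h3 h4]]]] := hull3_cover Hphi s k1.
by exists (f p), p, q, r.
Qed.

Lemma hull_value_circle s k y : sq2 k = 1 -> hull_value s k y -> y = f k.
Proof.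
move=> k1 [p [q [r [h1 h2 h3 h4 <-]]]].
have [S1p S1q] := same_class_rep h1; have [_ S1r] := same_class_rep h2.
have [->|->|->] := triangle_extreme S1p S1q S1r k1 h4; [by []|exact: same_class_image h1|exact: same_class_image h2].
Qed.

Lemma hull_value_class s k y : sq2 k < 1 -> hull_value s k y -> exists p q,
  [/\ same_class s p q, p <> q, f p = y & conv [set r | same_class s p r] k].
Proof.
move=> k1 [p [q [r [h1 h2 h3 h4 e]]]]; have [S1p S1q] := same_class_rep h1.
have cv : conv [set r | same_class s p r] k by apply: conv_triangle h4 => //=; left.
have [pq|pq] := pselect (p = q); last by exists p, q.
have [pr|pr] := pselect (p = r); last by exists p, r.
exfalso; have : k = p.
  case: h4 => u [v [w [_ _ _ uvw ->]]]; rewrite -pq -pr -!mulrDl uvw !mul1r.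
  by case: (p).
by move=> e'; move: k1; rewrite e' S1p ltxx.
Qed.

Lemma hull_value_uniq s k y y' : sq2 k <= 1 -> hull_value s k y -> hull_value s k y' -> y = y'.
Proof.
rewrite le_eqVlt => /orP[/eqP k1|k1] h h'.
  by rewrite (hull_value_circle k1 h) (hull_value_circle k1 h').
have [p [q [h1 ne <- cv]]] := hull_value_class k1 h.
have [p' [q' [h1' ne' <- cv']]] := hull_value_class k1 h'.
have [S1p' _] := same_class_rep h1'.
exact: (same_class_image (hulls_disjoint Hphi h1 ne S1p' cv cv')).
Qed.

Lemma sphere_value_exists P : S2 P -> exists y, sphere_value P y.
Proof.
move=> /emb_surj[s [k [k1 ->]]]; have [y hy] := hull_value_exists s k1.
by exists y, s, k.
Qed.

Lemma sphere_value_uniq P y y' : sphere_value P y -> sphere_value P y' -> y = y'.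
Proof.
move=> [s [k [k1 -> h]]] [s' [k' [k1' e h']]]; have [kk [ss|c]] := emb_inj k1 k1' e.
  by apply: (hull_value_uniq k1 h); rewrite kk ss.
by rewrite (hull_value_circle c h); apply/esym/(hull_value_circle c (s := s')); rewrite kk.
Qed.

Lemma sphere_value_S2 P y : sphere_value P y -> S2 P /\ S2 y.
Proof.
move=> [s [k [k1 -> [p [q [r [h1 _ _ _ <-]]]]]]]; split; first exact: emb_S2.
have [/expi_surj[t ->] _] := same_class_rep h1; exact: (phi_S2 Hphi).
Qed.

Lemma sphere_value_equator p : S1 p -> sphere_value (equator p) (f p).
Proof.
move=> S1p; exists true, p; split; first by rewrite S1p.
  by rewrite emb_circle.
have h : same_class true p p by left.
by exists p, p, p; split=> //; exact: triangle_self.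
Qed.

Lemma compact_same_class s : compact [set z : P2 * P2 | same_class s z.1 z.2].
Proof.
have T0 := tau_gt0 R.
(* The first angle is taken in one period, the second in the period that follows it. *)
pose A := (`[0, T]%classic `*` `[0, T + T]%classic : set P2) `&` weak_pair phi s.
have cA : compact A.
  apply: (@subclosed_compact _ _ (`[0, T]%classic `*` `[0, T + T]%classic : set P2)); last by move=> x [].
    apply: closedI; last exact: closed_weak_pair.
    by apply: compact_closed; [exact: norm_hausdorff|apply: compact_setX; exact: segment_compact].
  by apply: compact_setX; exact: segment_compact.
have -> : [set z : P2 * P2 | same_class s z.1 z.2] = (fun x : P2 => (expi x.1, expi x.2)) @` A.
  apply/seteqP; split.
    move=> [p q] /= h; have [S1p S1q] := same_class_rep h.
    have [t /andP[t0 t1] et] := expi_surj_from 0 S1p.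
    have [u /andP[u0 u1] eu] := expi_surj_from t S1q.
    exists (t, u); last by rewrite /= -et -eu.
    rewrite add0r in t1; split.
      by split; rewrite /= in_itv /=; apply/andP; split; lra.
    have [->|ne] := eqVneq u t.
      by split; rewrite /= ?lexx ?lerDl ?(ltW T0)// ltxx.
    have tu : t < u by rewrite lt_neqAle eq_sym ne.
    rewrite et eu in h; have sg := signed_same_class Hphi tu u1 h; have [_ _ e _] := sg.
    by split=> //=; exact: ltW.
  move=> _ [[t u] [_ [/= h1 h2 h3 h4]] <-] /=.
  have [->|ne] := eqVneq u t; first exact: same_class_refl.
  have [->|ne'] := eqVneq u (t + T); first by rewrite expiDT; exact: same_class_refl.
  by apply/same_class_signed/h4; rewrite lt_neqAle ?h1 ?h2 andbT// eq_sym.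
apply: continuous_compact => //; apply: continuous_subspaceT => x.
by have ce := @continuous_expi R; cont.
Qed.

Lemma compact_circle_preimage (C : set P3) : closed C -> compact [set p : P2 | S1 p /\ C (f p)].
Proof.
move=> cC; have -> : [set p : P2 | S1 p /\ C (f p)] = @expi R @` (`[0, T]%classic `&` phi @^-1` C).
  apply/seteqP; split.
    move=> p [S1p Cp]; have [t /andP[t0 t1] et] := expi_surj_from 0 S1p.
    rewrite add0r in t1; exists t => //; split; last by rewrite /preimage /= /unroll -et.
    by rewrite /= in_itv /= t0 ltW.
  by move=> _ [t [_ Ct] <-]; split; [exact: S1_expi|].
apply: continuous_compact; first exact/continuous_subspaceT/continuous_expi.
apply: (@subclosed_compact _ _ `[0, T]%classic); last by move=> x [].
  apply: closedI; first exact: compact_closed (@segment_compact _ _ _).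
  by apply: preimage_closed => // t _; exact: (phi_continuous Hphi).
exact: segment_compact.
Qed.

(* Barycentric coordinates together with the vertices of an ideal triangle. *)
Notation Simp := ((R * R * R) * (P2 * (P2 * P2)))%type.
Definition combine (m : Simp) : P2 :=
  (m.1.1.1 * m.2.1.1 + m.1.1.2 * m.2.2.1.1 + m.1.2 * m.2.2.2.1,
   m.1.1.1 * m.2.1.2 + m.1.1.2 * m.2.2.1.2 + m.1.2 * m.2.2.2.2).
Definition triangles s (C : set P3) : set Simp := [set m |
  [/\ 0 <= m.1.1.1, 0 <= m.1.1.2, 0 <= m.1.2 & m.1.1.1 + m.1.1.2 + m.1.2 = 1] /\
  [/\ same_class s m.2.1 m.2.2.1, same_class s m.2.1 m.2.2.2, same_class s m.2.2.1 m.2.2.2 &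
      S1 m.2.1 /\ C (f m.2.1)]].

Lemma compact_triangles s C : closed C -> compact (triangles s C).
Proof.
move=> cC; have hd2 := norm_hausdorff.
have clS : closed [set z : P2 * P2 | same_class s z.1 z.2].
  by apply: compact_closed; [exact: norm_hausdorff|exact: compact_same_class].
have clC : closed [set p : P2 | S1 p /\ C (f p)].
  by apply: compact_closed; [exact: norm_hausdorff|exact: compact_circle_preimage].
have ci := @segment_compact R 0 1.
apply: (@subclosed_compact _ _ (((`[0, 1]%classic `*` `[0, 1]%classic) `*` `[0, 1]%classic) `*`
  (@S1 R `*` (@S1 R `*` @S1 R)) : set Simp)).
- have c1 : continuous (fun m : Simp => m.1.1.1) by move=> m; cont.
  have c2 : continuous (fun m : Simp => m.1.1.2) by move=> m; cont.
  have c3 : continuous (fun m : Simp => m.1.2) by move=> m; cont.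
  have c4 : continuous (fun m : Simp => m.1.1.1 + m.1.1.2 + m.1.2) by move=> m; cont.
  have c5 : continuous (fun m : Simp => (m.2.1, m.2.2.1)) by move=> m; cont.
  have c6 : continuous (fun m : Simp => (m.2.1, m.2.2.2)) by move=> m; cont.
  have c7 : continuous (fun m : Simp => (m.2.2.1, m.2.2.2)) by move=> m; cont.
  have c8 : continuous (fun m : Simp => m.2.1) by move=> m; cont.
  have -> : triangles s C = ([set m : Simp | 0 <= m.1.1.1] `&` [set m : Simp | 0 <= m.1.1.2] `&`
     [set m : Simp | 0 <= m.1.2] `&` [set m : Simp | m.1.1.1 + m.1.1.2 + m.1.2 = 1]) `&`
     ((fun m : Simp => (m.2.1, m.2.2.1)) @^-1` [set z | same_class s z.1 z.2] `&`
      (fun m : Simp => (m.2.1, m.2.2.2)) @^-1` [set z | same_class s z.1 z.2] `&`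
      (fun m : Simp => (m.2.2.1, m.2.2.2)) @^-1` [set z | same_class s z.1 z.2] `&`
      (fun m : Simp => m.2.1) @^-1` [set p | S1 p /\ C (f p)]).
    by apply/seteqP; split=> m; [move=> [[? ? ? ?] [? ? ? ?]]|move=> [[[[? ?] ?] ?] [[[? ?] ?] ?]]].
  apply: closedI.
    apply: closedI; last exact: closed_eq_cont.
    apply: closedI; last exact: closed_ge_cont.
    by apply: closedI; exact: closed_ge_cont.
  apply: closedI; last by apply: preimage_closed clC => m _; exact: c8.
  apply: closedI; last by apply: preimage_closed clS => m _; exact: c7.
  apply: closedI; last by apply: preimage_closed clS => m _; exact: c6.
  by apply: preimage_closed clS => m _; exact: c5.
- have c2 := compact_setX ci ci; have c3 := compact_setX c2 ci.
  have cS := @compact_S1 R; have cSS := compact_setX cS cS.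
  exact: (compact_setX c3 (compact_setX cS cSS)).
- move=> m [[h1 h2 h3 h4] [k1 k2 k3 [S1p _]]].
  have [_ S1q] := same_class_rep k1; have [_ S1r] := same_class_rep k2.
  by split; split=> //=; try split=> //=; rewrite in_itv /=; apply/andP; split=> //; lra.
Qed.

(** Each hemisphere contributes the continuous image of a compact set of triangles with vertex
    values in [C]; here closedness of the pairs of one sign turns into continuity of [F]. *)
Lemma closed_sphere_value C : closed C -> closed [set P | exists2 y, C y & sphere_value P y].
Proof.
move=> cC.
have -> : [set P | exists2 y, C y & sphere_value P y] =
    (fun m => emb true (combine m)) @` triangles true C `|`
    (fun m => emb false (combine m)) @` triangles false C.
  apply/seteqP; split=> P.
    move=> [y Cy [s [k [k1 -> [p [q [r [h1 h2 h3 [u [v [w [u0 v0 w0 uvw ek]]]] e]]]]]]]].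
    have [S1p _] := same_class_rep h1.
    have H : triangles s C ((u, v, w), (p, (q, r))) by split=> //=; split=> //; rewrite e.
    by case: s h1 h2 h3 H => h1 h2 h3 H; [left|right]; exists ((u, v, w), (p, (q, r))) => //;
      rewrite /combine /= -ek.
  have key s : ((fun m => emb s (combine m)) @` triangles s C) P ->
      exists2 y, C y & sphere_value P y.
    move=> [[[[u v] w] [p [q r]]] [/= [u0 v0 w0 uvw] [h1 h2 h3 [S1p Cp]]] <-].
    exists (f p) => //; have [_ S1q] := same_class_rep h1; have [_ S1r] := same_class_rep h2.
    have tr : in_triangle p q r (combine (u, v, w, (p, (q, r)))) by exists u, v, w.
    exists s, (combine (u, v, w, (p, (q, r)))); split=> //; first exact: triangle_disk tr.
    by exists p, q, r.
  by case; exact: key.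
have cl s : closed ((fun m => emb s (combine m)) @` triangles s C).
  apply: compact_closed; first exact: norm_hausdorff.
  apply: continuous_compact; last exact: compact_triangles.
  apply: continuous_subspaceT => m; apply: continuous_at_compT; first exact: continuous_emb.
  by rewrite /combine; cont.
by apply: closedU; exact: cl.
Qed.

Lemma fibre_singleton p P y : S1 p -> (forall q, S1 q -> f q = f p -> q = p) ->
  f p = y -> sphere_value P y <-> P = equator p.
Proof.
move=> S1p sing <-; split=> [[s [k [k1 -> [p' [q [r [h1 h2 h3 h4 e]]]]]]]|->]; last exact: sphere_value_equator.
have [S1p' S1q] := same_class_rep h1; have [_ S1r] := same_class_rep h2.
have ep : p' = p by apply: sing.
have eq : q = p by apply: sing => //; rewrite -e (same_class_image h1).
have er : r = p by apply: sing => //; rewrite -e (same_class_image h2).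
have ek : k = p.
  case: h4 => u [v [w [_ _ _ uvw ->]]]; rewrite ep eq er -!mulrDl uvw !mul1r.
  by case: (p).
by rewrite ek emb_circle.
Qed.

(** Whatever the cyclic order of the three points, [signed_triple] carries the sign from one pair of
    a fibre to the others. *)
Lemma fibre_sign s p q r : same_class s p q -> p <> q -> S1 r -> f r = f p -> same_class s p r.
Proof.
move=> h ne S1r er; have [S1p S1q] := same_class_rep h.
have [pr|pr] := pselect (p = r); first by left.
have [qr|qr] := pselect (q = r); first by rewrite -qr.
have [a ea] := expi_surj S1p; have [b /andP[b1 b2] eb] := expi_surj_from a S1q.
have [c /andP[c1 c2] ec] := expi_surj_from a S1r.
have ab : a < b by rewrite lt_neqAle b1 andbT; apply/eqP => e; apply: ne; rewrite ea eb e.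
have ac : a < c by rewrite lt_neqAle c1 andbT; apply/eqP => e; apply: pr; rewrite ea ec e.
rewrite ea eb in h; have sab := signed_same_class Hphi ab b2 h; have [_ _ eab _] := sab.
have eac : phi a = phi c by rewrite /unroll -ea -ec.
rewrite ea ec; apply: same_class_signed.
have [bc|cb|e] := ltgtP b c; last by case: qr; rewrite eb ec e.
  have [_ k] := signed_triple Hphi s ab bc c2 eab (etrans (esym eab) eac).
  exact/k.
have [_ k] := signed_triple Hphi s ac cb b2 eac (etrans (esym eac) eab).
by rewrite k.
Qed.

Lemma fibre_sign_excl s p q : same_class s p q -> same_class (~~ s) p q -> p = q.
Proof.
move=> h1 h2; apply: contrapT => ne; have [S1p S1q] := same_class_rep h1.
have [a ea] := expi_surj S1p; have [b /andP[b1 b2] eb] := expi_surj_from a S1q.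
have ab : a < b by rewrite lt_neqAle b1 andbT; apply/eqP => e; apply: ne; rewrite ea eb e.
rewrite ea eb in h1 h2.
exact: (signed_excl (signed_same_class Hphi ab b2 h1) (signed_same_class Hphi ab b2 h2)).
Qed.

Lemma fibre_class s p q P : same_class s p q -> p <> q ->
  sphere_value P (f p) <-> elem (hemi R s) [set r | same_class s p r] P.
Proof.
move=> h ne; have [S1p S1q] := same_class_rep h; split.
  move=> [s' [k [k1 -> [p' [q' [r' [h1 h2 h3 h4 e]]]]]]].
  have [S1p' S1q'] := same_class_rep h1; have [_ S1r'] := same_class_rep h2.
  have cp := fibre_sign h ne S1p' e.
  have cq : same_class s p q' by apply: (fibre_sign h ne) => //; rewrite -e (same_class_image h1).
  have cr : same_class s p r' by apply: (fibre_sign h ne) => //; rewrite -e (same_class_image h2).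
  have nS : [set r | same_class s p r] `<=` @S1 R by move=> x /same_class_rep[].
  have cv : conv [set r | same_class s p r] k by apply: conv_triangle h4.
  have [kc|kl] : sq2 k = 1 \/ sq2 k < 1 by move: k1; rewrite le_eqVlt => /orP[/eqP|]; [left|right].
    by left; exists k; [exact: conv_disk|rewrite emb_circle].
  have [ss|/eqP ss] := eqVneq s' s.
    by right; exists k => //; rewrite /emb ss.
  (* On the opposite hemisphere the three vertices coincide, since distinct points cannot form pairs
     of both signs; then [k] would be on the circle. *)
  have sn : s' = ~~ s by case: s s' ss {h h1 h2 h3 cp cq cr nS cv} => -[].
  have trans x : same_class s p x -> same_class s p' x.
    by apply: (same_class_trans Hphi); apply: (same_class_sym Hphi).
  rewrite sn in h1 h2; have e1 := fibre_sign_excl (trans _ cq) h1.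
  have e2 := fibre_sign_excl (trans _ cr) h2.
  case: h4 => u [v [w [_ _ _ uvw ek]]]; have : k = p'.
    by rewrite ek -e1 -e2 -!mulrDl uvw !mul1r; case: (p').
  by move=> ekp; move: kl; rewrite ekp S1p' ltxx.
case=> [[r hr <-]|[k [cv k1] <-]].
  by rewrite (same_class_image hr); apply: sphere_value_equator; have [] := same_class_rep hr.
exists s, k; split=> //; first exact: ltW.
have [y hy] := hull_value_exists s (ltW k1).
have [p' [q' [h1 ne' ey cv']]] := hull_value_class k1 hy.
have [S1p' _] := same_class_rep h1.
have e := same_class_image (hulls_disjoint Hphi h ne S1p' cv cv').
by rewrite e ey.
Qed.

(** A one-point fibre of [f] is in no nontrivial class, and a larger fibre is exactly one class, of
    one sign only; so the collection consists of the fibres of the map under construction. *)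
Lemma CcollE K : Ccoll f K <-> exists2 y, S2 y & K = [set P | sphere_value P y].
Proof.
split.
  have cls s nu : nt_class (Lsign f s) nu -> exists2 y, S2 y &
      elem (hemi R s) nu = [set P | sphere_value P y].
    move=> /(nt_classE Hf)[p [q [h ne ->]]]; exists (f p).
      by have [/expi_surj[t ->] _] := same_class_rep h; exact: (phi_S2 Hphi).
    by apply/seteqP; split=> P /(fibre_class P h ne).
  move=> [[p [S1p np nm ->]]|[[nu [hnu ->]]|[nu [hnu ->]]]].
  - exists (f p); first by have [t ->] := expi_surj S1p; exact: (phi_S2 Hphi).
    have sing q : S1 q -> f q = f p -> q = p.
      move=> S1q e; apply: contrapT => ne'; have ne := nesym ne'.
      have key s : same_class s p q -> exists nu, nt_class (Lsign f s) nu /\ nu p.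
        move=> h; exists [set r | same_class s p r]; split; last by left.
        by apply/(nt_classE Hf); exists p, q.
      have [a ea] := expi_surj S1p; have [b /andP[b1 b2] eb] := expi_surj_from a S1q.
      have ab : a < b by rewrite lt_neqAle b1 andbT; apply/eqP => e'; apply: ne; rewrite ea eb e'.
      have eab : phi a = phi b by rewrite /unroll -ea -eb.
      case: (signed_or true ab b2 eab) => sg.
        by apply: np; apply: (key true); rewrite ea eb; exact: same_class_signed.
      by apply: nm; apply: (key false); rewrite ea eb; exact: same_class_signed.
    by apply/seteqP; split=> P /(fibre_singleton P S1p sing erefl).
  - exact: (cls true).
  - exact: (cls false).
move=> [y Sy ->].
have [p S1p <-] : exists2 p, S1 p & f p = y.
  have [t _ <-] := phi_surj_from Hphi 0 Sy; exists (expi t) => //; exact: S1_expi.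
have [[q [S1q e ne]]|sing] := pselect (exists q, [/\ S1 q, f q = f p & q <> p]).
  have [a ea] := expi_surj S1p; have [b /andP[b1 b2] eb] := expi_surj_from a S1q.
  have ab : a < b by rewrite lt_neqAle b1 andbT; apply/eqP => e'; apply: ne; rewrite ea eb e'.
  have eab : phi a = phi b by rewrite /unroll -ea -eb.
  have [s sg] : exists s, signed phi s a b.
    by case: (signed_or true ab b2 eab) => h; [exists true|exists false].
  have h : same_class s p q by rewrite ea eb; exact: same_class_signed.
  have E : [set P | sphere_value P (f p)] = elem (hemi R s) [set r | same_class s p r].
    by apply/seteqP; split=> P /(fibre_class P h (nesym ne)).
  have nt : nt_class (Lsign f s) [set r | same_class s p r].
    by apply/(nt_classE Hf); exists p, q; split=> //; exact: nesym.
  right; case: s sg h E nt => sg h E nt; [left|right].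
    by exists [set r | same_class true p r].
  by exists [set r | same_class false p r].
have {}sing q : S1 q -> f q = f p -> q = p.
  by move=> S1q e; apply: contrapT => ne; apply: sing; exists q.
left; exists p; split=> //.
- move=> [nu [/(nt_classE Hf true)[p' [q' [h ne ->]]] hp]].
  have eq : q' = p by apply: sing; [by have [] := same_class_rep h|rewrite -(same_class_image h) (same_class_image hp)].
  have ep : p' = p by apply: sing; [by have [] := same_class_rep h|rewrite (same_class_image hp)].
  by apply: ne; rewrite eq ep.
- move=> [nu [/(nt_classE Hf false)[p' [q' [h ne ->]]] hp]].
  have eq : q' = p by apply: sing; [by have [] := same_class_rep h|rewrite -(same_class_image h) (same_class_image hp)].
  have ep : p' = p by apply: sing; [by have [] := same_class_rep h|rewrite (same_class_image hp)].
  by apply: ne; rewrite eq ep.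
- by apply/seteqP; split=> P /(fibre_singleton P S1p sing erefl).
Qed.

End QuotientMap.

Lemma closed_S2 (R : realType) : closed (@S2 R).
Proof.
by apply: closed_eq_cont => x; rewrite /dot3; cont.
Qed.

Lemma compact_S2 (R : realType) : compact (@S2 R).
Proof.
have ci := @segment_compact R (-1) 1.
apply: (subclosed_compact (@closed_S2 R) (compact_setX (compact_setX ci ci) ci)).
move=> [[x y] z]; rewrite /S2 /dot3 /= => h.
have hx := sqr_ge0 x; have hy := sqr_ge0 y; have hz := sqr_ge0 z.
have key (t : R) : t ^+ 2 <= 1 -> t \in `[-1, 1].
  by move=> t1; rewrite in_itv /= -ler_norml -(@ler_pXn2r _ 2)// ?nnegrE// expr1n real_normK ?num_real.
by split; [split|] => /=; apply: key; lra.
Qed.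

(** * Closed maps of the sphere and the quotient topology *)

Section ClosedQuotientMap.
Variable R : realType.
Notation P3 := (R * R * R)%type.
Notation S2 := (@Defs.S2 R).
Variables (C : set (set P3)) (F : P3 -> P3).
Hypothesis FS : forall P, S2 P -> S2 (F P).
Hypothesis Fsurj : forall y, S2 y -> exists2 P, S2 P & F P = y.
Hypothesis Fclosed : forall Y, closed Y -> closed (S2 `&` F @^-1` Y).
Hypothesis CE : forall K, C K <-> exists2 y, S2 y & K = S2 `&` F @^-1` [set y].

Lemma closed_preimage_continuous : {within S2, continuous F}.
Proof.
apply/continuous_closedP => Y cY; apply/closed_subspaceP.
exists (S2 `&` F @^-1` Y); first exact: Fclosed.
by apply/seteqP; split=> x [] => [[]|].
Qed.

Lemma closed_image A : closed A -> closed (F @` (S2 `&` A)).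
Proof.
move=> cA; apply: compact_closed; first exact: norm_hausdorff.
apply: continuous_compact.
  by apply: continuous_subspaceW closed_preimage_continuous; exact: subIsetl.
by apply: (subclosed_compact (closedI (@closed_S2 R) cA) (@compact_S2 R)) => x [].
Qed.

(** [U] is the union of the fibres contained in [V]: those meeting the closed complement of [V] are
    removed, and their union is closed because [F] is a closed continuous map. *)
Lemma ropen_saturated V : ropen S2 V ->
  let U := S2 `&` F @^-1` (~` (F @` (S2 `&` ~` V))) in ropen S2 U /\ U `<=` V.
Proof.
move=> [W [oW ->]] U; split.
  have e : S2 `&` ~` (W `&` S2) = S2 `&` ~` W.
    by apply/seteqP; split=> x [Sx h]; split=> // h'; apply: h; [split|case: h'].
  have cl := Fclosed (closed_image (open_closedC oW)).
  exists (~` (S2 `&` F @^-1` (F @` (S2 `&` ~` W)))); split; first exact: closed_openC.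
  rewrite /U e; apply/seteqP; split=> x [h1 h2]; split=> //; first by case.
  by move=> h; apply: h1.
by move=> x [Sx h]; apply: contrapT => nx; apply: h; exists x.
Qed.

Lemma closed_map_quotient :
  usc_decomposition S2 C /\ quotient_onto_S2 S2 C F.
Proof.
split.
  split.
  - move=> K /CE[y _ ->]; split; first exact: subIsetl.
    by apply: Fclosed; apply: compact_closed; [exact: norm_hausdorff|exact: compact_set1].
  - move=> K K' /CE[y _ ->] /CE[y' _ ->] ne; apply/seteqP; split=> // x [[_ h] [_ h']].
    by apply: ne; congr (_ `&` _ @^-1` [set _]); rewrite -h -h'.
  - move=> x Sx; exists (S2 `&` F @^-1` [set F x]); split=> //.
    by apply/CE; exists (F x) => //; exact: FS.
  - move=> K V /CE[y Sy ->] oV KV; have [oU UV] := ropen_saturated oV.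
    eexists; split; [exact: oU| |exact: UV|].
      move=> x [Sx ex]; split=> // -[z [Sz nz] ez]; apply: nz; apply: KV; split=> //.
      by rewrite /preimage /= ez.
    move=> K' /CE[y' _ ->] [z [[Sz ez] [_ hz]]] x [Sx ex]; split=> //.
    by rewrite /preimage /= ex -ez.
split.
- exact: closed_preimage_continuous.
- apply/seteqP; split=> [_ [x Sx <-]|y /Fsurj[x Sx <-]]; first exact: FS.
  by exists x.
- move=> x y Sx Sy; split=> [e|[K [/CE[z _ ->] [_ ->] [_ ->]]]] //.
  exists (S2 `&` F @^-1` [set F x]); split=> //.
  by apply/CE; exists (F x) => //; exact: FS.
- move=> V VS; split.
    move=> [W [oW eV]]; have cl := Fclosed (open_closedC oW).
    exists (~` (S2 `&` F @^-1` (~` W))); split; first exact: closed_openC.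
    apply/seteqP; split=> x.
      by move=> [Sx]; rewrite /preimage /= eV => -[Wx _]; split=> // -[_]; apply.
    move=> [h Sx]; split=> //; rewrite /preimage /= eV; split; last exact: FS.
    by apply: contrapT => nW; apply: h.
  move=> [W [oW eW]].
  exists (~` (F @` (S2 `&` ~` W))); split; first exact/closed_openC/closed_image/open_closedC.
  apply/seteqP; split=> y.
    move=> Vy; split; last exact: VS.
    move=> [x [Sx nWx] ex]; apply: nWx.
    have : (S2 `&` F @^-1` V) x by split=> //; rewrite /preimage /= ex.
    by rewrite eW => -[].
  move=> [ny /Fsurj[x Sx ex]].
  have : (S2 `&` F @^-1` V) x.
    rewrite eW; split=> //; apply: contrapT => nW; apply: ny; exists x => //.
  by case=> _; rewrite /preimage /= ex.
Qed.

End ClosedQuotientMap.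

Theorem theorem1p20 (R : realType) (f : R * R -> R * R * R) :
  catherine f ->
  usc_decomposition (@S2 R) (Ccoll f) /\
  exists F : R * R * R -> R * R * R,
    [/\ quotient_onto_S2 (@S2 R) (Ccoll f) F,
        (forall p, S1 p -> F (equator p) = f p) &
        forall G : R * R * R -> R * R * R,
          quotient_onto_S2 (@S2 R) (Ccoll f) G ->
          (forall p, S1 p -> G (equator p) = f p) ->
          forall x, S2 x -> G x = F x].
Proof.
move=> Hf.
(* Off the sphere the value of [F] is arbitrary. *)
have [F HF] : {F : R * R * R -> R * R * R & forall P, S2 P -> sphere_value f P (F P)}.
  apply: (choice (P := fun P y => S2 P -> sphere_value f P y)) => P.
  have [/(sphere_value_exists Hf)[y hy]|nP] := pselect (S2 P); first by exists y.
  by exists P.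
have FE P y : sphere_value f P y <-> S2 P /\ F P = y.
  split=> [h|[/HF h <-] //]; have [SP _] := sphere_value_S2 Hf h.
  by split=> //; apply: (sphere_value_uniq Hf) h; exact: HF.
have Feq p : S1 p -> S2 (equator p) /\ F (equator p) = f p.
  by move=> S1p; apply/FE; exact: sphere_value_equator.
have surj y : S2 y -> exists2 p, S1 p & f p = y.
  by move=> /(phi_surj_from (unroll_catherine Hf) 0)[t _ <-]; exists (expi t) => //; exact: S1_expi.
have CE K : Ccoll f K <-> exists2 y, S2 y & K = @S2 R `&` F @^-1` [set y].
  rewrite (CcollE Hf); split=> -[y Sy ->]; exists y => //.
    by apply/seteqP; split=> P /FE.
  by apply/seteqP; split=> P /FE.
have FS P : S2 P -> S2 (F P) by move=> /HF/(sphere_value_S2 Hf)[].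
have Fsurj y : S2 y -> exists2 P, S2 P & F P = y.
  by move=> /surj[p /Feq[Sp ep] <-]; exists (equator p).
have Fclosed Y : closed Y -> closed (@S2 R `&` F @^-1` Y).
  move=> /(closed_sphere_value Hf); congr closed; apply/seteqP; split=> P.
    by move=> [y Yy /FE[SP e]]; split=> //; rewrite /preimage /= e.
  by move=> [SP YP]; exists (F P) => //; exact: HF.
have [usc quo] := closed_map_quotient FS Fsurj Fclosed CE.
split=> //; exists F; split=> [//|p /Feq[]//|G [_ _ GE _] Geq x Sx].
(* Uniqueness: every fibre of [F] meets the equator, where [G] is prescribed, and [G] has the same
   fibres. *)
have [p S1p ep] := surj _ (FS _ Sx); have [Sp epF] := Feq _ S1p.
have [_ _ FE' _] := quo.
by rewrite -ep -Geq//; apply/(GE _ _ Sx Sp)/(FE' _ _ Sx Sp); rewrite epF ep.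
Qed.
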